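(* Let $\mathcal{O}$ be an order in a finite dimensional division $\mathbb{Q}$-algebra such that $\mathcal{U}(\mathcal{O})$ is finite. Then $$\operatorname{rank}_{\mathbb{Z}}\mathrm{E}_2(\mathcal{O})^{ab}=\operatorname{rank}_{\mathbb{Z}}\mathcal{O}-\operatorname{inv}_{\mathcal{O}}.$$ Moreover, the following properties are equivalent: (1) $\mathrm{E}_2(\mathcal{O})^{ab}$ is finite; (2) $\mathcal{O}$ has a $\mathbb{Z}$-basis consisting of units of $\mathcal{O}$; (3) $\mathcal{O}$ is isomorphic to a maximal order in $\mathbb{Q}$, $\mathbb{Q}(\sqrt{-1})$, $\mathbb{Q}(\sqrt{-3})$ or in one of the quaternion algebras $\left(\frac{-1,-1}{\mathbb{Q}}\right)$, $\left(\frac{-1,-3}{\mathbb{Q}}\right)$, or it is isomorphic to the order of Lipschitz quaternions $\left(\frac{-1,-1}{\mathbb{Z}}\right)$.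
   Context: An order in a finite dimensional $\mathbb{Q}$-algebra $A$ is a subring that is finitely generated as a $\mathbb{Z}$-module and contains a $\mathbb{Q}$-basis of $A$. $\mathcal{U}(R)$ is the unit group of $R$; $\Gamma^{ab}=\Gamma/\Gamma'$. $\mathrm{E}_2(R)\le\mathrm{GL}_2(R)$ is generated by the matrices with $1$'s on the diagonal and one non-zero off-diagonal entry. For a finitely generated abelian group $B$, $\operatorname{rank}_{\mathbb{Z}}B$ is the largest $n$ such that $\mathbb{Z}^n$ embeds in $B$. $\operatorname{inv}_{\mathcal{O}}=\max\{|B\cap\mathcal{U}(\mathcal{O})| : B\text{ a }\mathbb{Z}\text{-module basis of }\mathcal{O}\}$. $\left(\frac{u,v}{K}\right)$ is the quaternion $K$-algebra with basis $1,i,j,k$, $i^2=u$, $j^2=v$, $ij=k=-ji$; the Lipschitz quaternions are $\mathbb{Z}+\mathbb{Z}i+\mathbb{Z}j+\mathbb{Z}k\subset\left(\frac{-1,-1}{\mathbb{Q}}\right)$. *)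

(* Defs.v *)
From HB Require Import structures.
From mathcomp Require Import all_boot all_order all_algebra all_field.
From mathcomp Require Import boolp classical_sets cardinality.
From mathcomp Require Import ring.

Set Implicit Arguments.
Unset Strict Implicit.
Unset Printing Implicit Defensive.

Import Order.TTheory GRing.Theory Num.Theory.

Local Open Scope classical_set_scope.
Local Open Scope ring_scope.

Section Generated.
Variables (G : groupType) (S : set G).

Definition gen_subgroup : set G :=
  smallest (fun H : set G => group_closed (mem H)) S.

Lemma gen_subgroup_closed : group_closed (mem gen_subgroup).
Proof.
split; first by rewrite inE => H /= [[H1 _] _]; move: H1; rewrite inE.
move=> x y; rewrite !inE => gx gy H /= [HG SH].
have [_ HD] := HG.
have Hx := gx H (conj HG SH); have Hy := gy H (conj HG SH).
by have := HD x y; rewrite !inE; apply.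
Qed.

Lemma sub_gen_subgroup x : S x -> gen_subgroup x.
Proof. by move=> Sx; exact: sub_gen_smallest. Qed.

Record gen_group := GenGroup { gen_val : G; _ : gen_val \in gen_subgroup }.

HB.instance Definition _ := [isSub for gen_val].
HB.instance Definition _ := [Choice of gen_group by <:].
HB.instance Definition _ :=
  SubChoice_isSubGroup.Build G (mem gen_subgroup) gen_group gen_subgroup_closed.

End Generated.

Section Abelianization.
Variable G : groupType.
Local Open Scope group_scope.

Definition derived : set G :=
  gen_subgroup [set g : G | exists x y : G, g = [~ x, y]].

Let derived_closed := @gen_subgroup_closed G [set g : G | exists x y : G, g = [~ x, y]].

Lemma derived1 : 1 \in derived.
Proof. exact: (proj1 derived_closed). Qed.

Lemma derivedM x y : x \in derived -> y \in derived -> x * y \in derived.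
Proof. exact: (group_closedM derived_closed). Qed.

Lemma derivedV x : x \in derived -> x^-1 \in derived.
Proof. exact: (group_closedV derived_closed). Qed.

Lemma derivedR x y : [~ x, y] \in derived.
Proof. by rewrite inE; apply: sub_gen_subgroup; exists x, y. Qed.

Lemma derivedJ x y : x \in derived -> x ^ y \in derived.
Proof.
by move=> dx; have := derivedM dx (derivedR x y); rewrite commgEl mulVKg.
Qed.

Definition derived_rel : rel G := fun x y => x^-1 * y \in derived.

Lemma derived_rel_equiv : equiv_class_of derived_rel.
Proof.
split=> [x|x y|y x z]; rewrite /derived_rel.
- by rewrite mulVg derived1.
- by apply/idP/idP => /derivedV; rewrite invgM invgK.
- by move=> dxy dyz; have := derivedM dxy dyz; rewrite mulgA mulgK.
Qed.

Canonical derived_equiv := EquivRelPack derived_rel_equiv.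

(* The quotient of G by its derived subgroup, written additively. *)
Definition abelianization := {eq_quot derived_equiv}%qT.

HB.instance Definition _ : EqQuotient G derived_equiv abelianization :=
  EqQuotient.on abelianization.
HB.instance Definition _ := Choice.on abelianization.

Lemma pi_ab_eq x y : \pi_abelianization%qT x = \pi_abelianization%qT y
  <-> x^-1 * y \in derived.
Proof. by split=> [/eqmodP //|dxy]; apply/eqmodP. Qed.

Definition ab_zero : abelianization := \pi_abelianization%qT 1.
Definition ab_add (a b : abelianization) : abelianization :=
  \pi_abelianization%qT (repr a * repr b).
Definition ab_opp (a : abelianization) : abelianization :=
  \pi_abelianization%qT (repr a)^-1.

Lemma ab_addE x y :
  ab_add (\pi_abelianization%qT x) (\pi_abelianization%qT y) =
  \pi_abelianization%qT (x * y).
Proof.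
rewrite /ab_add; case: piP => x' /pi_ab_eq dx; case: piP => y' /pi_ab_eq dy.
apply/esym/pi_ab_eq.
have -> : (x * y)^-1 * (x' * y') = (x^-1 * x') ^ y * (y^-1 * y').
  by rewrite /conjg invgM !mulgA mulgK.
by rewrite derivedM ?derivedJ.
Qed.

Lemma ab_oppE x :
  ab_opp (\pi_abelianization%qT x) = \pi_abelianization%qT x^-1.
Proof.
rewrite /ab_opp; case: piP => x' /pi_ab_eq dx; apply/pi_ab_eq.
have -> : x'^-1^-1 * x^-1 = (x^-1 * x') ^ x^-1.
  by rewrite /conjg !mulgA !invgK mulgV mul1g.
exact: derivedJ.
Qed.

Lemma ab_addA : associative ab_add.
Proof.
elim/quotW=> x; elim/quotW=> y; elim/quotW=> z.
by rewrite (ab_addE x y) (ab_addE y z) !ab_addE mulgA.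
Qed.

Lemma ab_addC : commutative ab_add.
Proof.
elim/quotW=> x; elim/quotW=> y; rewrite !ab_addE; apply/pi_ab_eq.
rewrite invgM -mulgA; exact: derivedR.
Qed.

Lemma ab_add0 : left_id ab_zero ab_add.
Proof. by elim/quotW=> x; rewrite ab_addE mul1g. Qed.

Lemma ab_addN : left_inverse ab_zero ab_opp ab_add.
Proof. by elim/quotW=> x; rewrite ab_oppE ab_addE mulVg. Qed.

HB.instance Definition _ := GRing.isZmodule.Build abelianization
  ab_addA ab_addC ab_add0 ab_addN.

End Abelianization.

Section UnitGroup.
Variable R : nzRingType.

(* The units of a ring, with no computable inverse assumed (R need not carry
   a unitRingType structure). *)
Definition ring_units : set R := [set x | exists y, y * x = 1 /\ x * y = 1].

Record unit_group := UnitGroup { unit_val : R; _ : unit_val \in ring_units }.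

HB.instance Definition _ := [isSub for unit_val].
HB.instance Definition _ := [Choice of unit_group by <:].

Implicit Types x y z : unit_group.

Lemma unit_valP x : exists y : R, y * unit_val x = 1 /\ unit_val x * y = 1.
Proof. by case: x => x xU /=; move: xU; rewrite inE. Qed.

Lemma unit_one_subproof : (1 : R) \in ring_units.
Proof. by rewrite inE; exists 1; rewrite mulr1. Qed.

Lemma unit_mul_subproof x y : unit_val x * unit_val y \in ring_units.
Proof.
have [x' [xl xr]] := unit_valP x; have [y' [yl yr]] := unit_valP y.
rewrite inE; exists (y' * x'); split.
  by rewrite mulrA -(mulrA y') xl mulr1.
by rewrite mulrA -(mulrA (unit_val x)) yr mulr1.
Qed.

Lemma unit_inv_subproof x : sval (cid (unit_valP x)) \in ring_units.
Proof.
by case: cid => y [yl yr] /=; rewrite inE; exists (unit_val x).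
Qed.

Definition unit_one := UnitGroup unit_one_subproof.
Definition unit_mul x y := UnitGroup (unit_mul_subproof x y).
Definition unit_inv x := UnitGroup (unit_inv_subproof x).

Lemma unit_mulA : associative unit_mul.
Proof. by move=> x y z; apply: val_inj; rewrite /= mulrA. Qed.

Lemma unit_mul1 : left_id unit_one unit_mul.
Proof. by move=> x; apply: val_inj; rewrite /= mul1r. Qed.

Lemma unit_mulr1 : right_id unit_one unit_mul.
Proof. by move=> x; apply: val_inj; rewrite /= mulr1. Qed.

Lemma unit_mulV : left_inverse unit_one unit_inv unit_mul.
Proof. by move=> x; apply: val_inj => /=; case: cid => y []. Qed.

Lemma unit_mulrV : right_inverse unit_one unit_inv unit_mul.
Proof. by move=> x; apply: val_inj => /=; case: cid => y []. Qed.

HB.instance Definition _ := isGroup.Build unit_group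
  unit_mulA unit_mul1 unit_mulr1 unit_mulV unit_mulrV.

End UnitGroup.

Definition GL2 (R : nzRingType) : groupType := unit_group 'M[R]_2.

Definition elementary2 (R : nzRingType) : set (GL2 R) :=
  [set g | exists (i j : 'I_2) (x : R),
    [/\ i != j, x != 0 & unit_val g = 1 + x *: delta_mx i j]].

Definition E2 (R : nzRingType) : groupType := gen_group (@elementary2 R).

Section ZModules.
Variable V : zmodType.

Definition zspan (B : seq V) : set V :=
  [set x | exists c : 'I_(size B) -> int, x = \sum_(i < size B) B`_i *~ c i].

Definition zfree (B : seq V) : Prop :=
  forall c : 'I_(size B) -> int,
    \sum_(i < size B) B`_i *~ c i = 0 -> forall i, c i = 0.

Definition zbasis (B : seq V) : Prop := zfree B /\ zspan B = setT.

Definition zembeds (n : nat) : Prop :=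
  exists f : {additive 'rV[int]_n -> V}, injective f.

(* A relation rather than a function: it asserts that the largest n exists. *)
Definition has_zrank (n : nat) : Prop :=
  zembeds n /\ forall m, zembeds m -> (m <= n)%N.

End ZModules.

Record zorder (A : falgType rat) := ZOrder {
  order_pred :> {pred A};
  order_subring : subring_closed order_pred;
  order_fg : exists B : seq A, forall x, x \in order_pred <-> zspan B x;
  order_full : exists2 B : seq A, basis_of fullv B & {subset B <= order_pred}
}.

Section OrderRing.
Variables (A : falgType rat) (O : zorder A).

Record order_ring := OrderElt { order_val : A; _ : order_val \in O }.

HB.instance Definition _ := [isSub for order_val].
HB.instance Definition _ := [Choice of order_ring by <:].
HB.instance Definition _ :=
  GRing.SubChoice_isSubNzRing.Build A (order_pred O) order_ring
    (order_subring O).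

End OrderRing.

Coercion order_ring_type (A : falgType rat) (O : zorder A) : nzRingType :=
  order_ring O.

Definition maximal_order (A : falgType rat) (O : zorder A) : Prop :=
  forall O' : zorder A, {subset O <= O'} -> {subset O' <= O}.

(* k = inv_R; since a basis B is duplicate-free, the count is |B :&: U(R)|. *)
Definition is_inv (R : nzRingType) (k : nat) : Prop :=
  (exists2 B : seq R, zbasis B & count (mem (@ring_units R)) B = k) /\
  (forall B : seq R, zbasis B -> (count (mem (@ring_units R)) B <= k)%N).

Definition ring_iso (R S : nzRingType) : Prop :=
  exists f : {rmorphism R -> S}, bijective f.

Definition iso_maximal_order_in (R : nzRingType) (A : falgType rat) : Prop :=
  exists2 M : zorder A, maximal_order M & ring_iso R M.

(* Q(sqrt d) for a non-square d. *)
Definition quadratic (d : rat) := {poly %/ ('X^2 - d%:P)}.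

HB.instance Definition _ (d : rat) := GRing.ComUnitRing.on (quadratic d).
HB.instance Definition _ (d : rat) := GRing.UnitAlgebra.on (quadratic d).
HB.instance Definition _ (d : rat) := Vector.on (quadratic d).

Lemma mk_monic_quadratic (d : rat) : mk_monic ('X^2 - d%:P) = 'X^2 - d%:P.
Proof.
by rewrite /mk_monic size_XnsubC ?monicXnsubC.
Qed.

(* Quaternion a b c d stands for a + b i + c j + d k, where i ^ 2 = u,
   j ^ 2 = v and i j = k = - j i. *)
Record quaternion (K : fieldType) (u v : K) :=
  Quaternion { qre : K; qi : K; qj : K; qk : K }.

Section Quaternion.
Variables (K : fieldType) (u v : K).
Local Notation Q := (quaternion u v).
Local Notation quat := (@Quaternion K u v).

Definition quat_tuple (x : Q) : K * K * K * K := (qre x, qi x, qj x, qk x).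
Definition tuple_quat (t : K * K * K * K) : Q :=
  quat t.1.1.1 t.1.1.2 t.1.2 t.2.

Lemma quat_tupleK : cancel quat_tuple tuple_quat.
Proof. by case. Qed.

HB.instance Definition _ := Choice.copy Q (can_type quat_tupleK).

Definition quat_zero := quat 0 0 0 0.
Definition quat_opp (x : Q) := quat (- qre x) (- qi x) (- qj x) (- qk x).
Definition quat_add (x y : Q) :=
  quat (qre x + qre y) (qi x + qi y) (qj x + qj y) (qk x + qk y).

Lemma quat_addA : associative quat_add.
Proof. by move=> x y z; congr Quaternion; apply: addrA. Qed.
Lemma quat_addC : commutative quat_add.
Proof. by move=> x y; congr Quaternion; apply: addrC. Qed.
Lemma quat_add0 : left_id quat_zero quat_add.
Proof. by case=> *; congr Quaternion; apply: add0r. Qed.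
Lemma quat_addN : left_inverse quat_zero quat_opp quat_add.
Proof. by case=> *; congr Quaternion; apply: addNr. Qed.

HB.instance Definition _ :=
  GRing.isZmodule.Build Q quat_addA quat_addC quat_add0 quat_addN.

Definition quat_one := quat 1 0 0 0.
Definition quat_mul (x y : Q) :=
  let: Quaternion a b c d := x in let: Quaternion a' b' c' d' := y in
  quat (a * a' + u * b * b' + v * c * c' - u * v * d * d')
       (a * b' + b * a' - v * c * d' + v * d * c')
       (a * c' + c * a' + u * b * d' - u * d * b')
       (a * d' + d * a' + b * c' - c * b').

Lemma quat_mulA : associative quat_mul.
Proof. by case=> ? ? ? ? [? ? ? ?] [? ? ? ?]; congr Quaternion; ring. Qed.
Lemma quat_mul1 : left_id quat_one quat_mul.
Proof. by case=> *; congr Quaternion; ring. Qed.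
Lemma quat_mulr1 : right_id quat_one quat_mul.
Proof. by case=> *; congr Quaternion; ring. Qed.
Lemma quat_mulDl : left_distributive quat_mul +%R.
Proof. by case=> ? ? ? ? [? ? ? ?] [? ? ? ?]; congr Quaternion => /=; ring. Qed.
Lemma quat_mulDr : right_distributive quat_mul +%R.
Proof. by case=> ? ? ? ? [? ? ? ?] [? ? ? ?]; congr Quaternion => /=; ring. Qed.
Lemma quat_one_neq0 : quat_one != 0.
Proof. by apply/eqP => -[] /eqP; rewrite oner_eq0. Qed.

HB.instance Definition _ := GRing.Zmodule_isNzRing.Build Q
  quat_mulA quat_mul1 quat_mulr1 quat_mulDl quat_mulDr quat_one_neq0.

Definition quat_scale (a : K) (x : Q) :=
  quat (a * qre x) (a * qi x) (a * qj x) (a * qk x).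

Lemma quat_scaleA a b x :
  quat_scale a (quat_scale b x) = quat_scale (a * b) x.
Proof. by congr Quaternion; apply: mulrA. Qed.
Lemma quat_scale1 : left_id 1 quat_scale.
Proof. by case=> *; congr Quaternion; apply: mul1r. Qed.
Lemma quat_scaleDr : right_distributive quat_scale +%R.
Proof. by move=> *; congr Quaternion; apply: mulrDr. Qed.
Lemma quat_scaleDl x : {morph quat_scale^~ x : a b / a + b}.
Proof. by move=> *; congr Quaternion; apply: mulrDl. Qed.

HB.instance Definition _ := GRing.Zmodule_isLmodule.Build K Q
  quat_scaleA quat_scale1 quat_scaleDr quat_scaleDl.

Lemma quat_scaleAl (a : K) (x y : Q) : a *: (x * y) = (a *: x) * y.
Proof.
by case: x y => ? ? ? ? [? ? ? ?]; congr Quaternion => /=; ring.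
Qed.

HB.instance Definition _ := GRing.Lmodule_isLalgebra.Build K Q quat_scaleAl.

Lemma quat_scaleAr (a : K) (x y : Q) : a *: (x * y) = x * (a *: y).
Proof.
by case: x y => ? ? ? ? [? ? ? ?]; congr Quaternion => /=; ring.
Qed.

HB.instance Definition _ := GRing.Lalgebra_isAlgebra.Build K Q quat_scaleAr.

Definition quat_row (x : Q) : 'rV[K]_4 :=
  \row_i [:: qre x; qi x; qj x; qk x]`_i.
Definition row_quat (r : 'rV[K]_4) : Q :=
  quat (r 0 (inord 0)) (r 0 (inord 1)) (r 0 (inord 2)) (r 0 (inord 3)).

Lemma quat_vect_axiom : Vector.axiom 4 Q.
Proof.
exists quat_row.
  move=> a x y; apply/rowP=> i; rewrite !mxE.
  by case: i => -[|[|[|[|]]]].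
exists row_quat => [[a b c d]|r].
  by rewrite /row_quat !mxE !inordK.
apply/rowP=> i; rewrite mxE.
by case: i => -[|[|[|[|//]]]] ilt /=; congr (r 0 _); apply: val_inj;
  rewrite /= inordK.
Qed.

HB.instance Definition _ := Lmodule_hasFinDim.Build K Q quat_vect_axiom.
HB.instance Definition _ := Algebra_isFalgebra.Build K Q.

Definition quatI : Q := quat 0 1 0 0.
Definition quatJ : Q := quat 0 0 1 0.
Definition quatK : Q := quat 0 0 0 1.

Lemma quat_relations :
  [/\ quatI ^+ 2 = u%:A, quatJ ^+ 2 = v%:A, quatI * quatJ = quatK
    & quatJ * quatI = - quatK].
Proof. by split; congr Quaternion => /=; ring. Qed.

Lemma quatE (x : Q) :
  x = qre x *: 1 + qi x *: quatI + qj x *: quatJ + qk x *: quatK.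
Proof. by case: x => *; congr Quaternion => /=; ring. Qed.

Lemma quat_basis : basis_of fullv [:: (1 : Q); quatI; quatJ; quatK].
Proof.
rewrite basisEdim dimvf andbT; apply/subvP=> x _; rewrite [x]quatE.
by rewrite !memvD // memvZ // memv_span // !inE eqxx ?orbT.
Qed.

End Quaternion.

Section Lipschitz.
Local Notation H := (quaternion (-1 : rat) (-1)).

Definition lipschitz_pred : {pred H} := fun x : H =>
  [&& qre x \is a Num.int, qi x \is a Num.int, qj x \is a Num.int
    & qk x \is a Num.int].

Lemma lipschitz_subring : subring_closed lipschitz_pred.
Proof.
split=> [|x y|x y].
- by apply/and4P; split; rewrite /= ?rpred1 ?rpred0.
- move=> /and4P[? ? ? ?] /and4P[? ? ? ?].
  by apply/and4P; split; apply: rpredB.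
- case: x y => ? ? ? ? [? ? ? ?] /and4P[/= ? ? ? ?] /and4P[/= ? ? ? ?].
  by apply/and4P; split; rewrite /= ?(rpredD, rpredB, rpredN, rpredM, rpred1).
Qed.

Lemma lipschitz_fg :
  exists B : seq H, forall x, x \in lipschitz_pred <-> zspan B x.
Proof.
exists [:: 1; quatI _ _; quatJ _ _; quatK _ _] => x; split.
  move=> /and4P[/intrP[a xa] /intrP[b xb] /intrP[c xc] /intrP[d xd]].
  exists (fun i => [:: a; b; c; d]`_i).
  rewrite {1}[x]quatE xa xb xc xd !scaler_int.
  by rewrite !big_ord_recl big_ord0 /= addr0 !addrA.
move=> [c ->].
have zc : zmod_closed lipschitz_pred.
  have [h1 hB _] := lipschitz_subring; split=> [|x' y']; last exact: hB.
  by have := hB _ _ h1 h1; rewrite subrr.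
pose P := GRing.isZmodClosed.Build H lipschitz_pred zc.
pose Z : zmodClosed H := HB.pack lipschitz_pred P.
apply: (@rpred_sum _ Z) => i _; apply: (@rpredMz _ Z).
by case: i => -[|[|[|[|//]]]] ilt; apply/and4P; split; rewrite /= ?rpred1 ?rpred0.
Qed.

Lemma lipschitz_full :
  exists2 B : seq H, basis_of fullv B & {subset B <= lipschitz_pred}.
Proof.
exists [:: 1; quatI _ _; quatJ _ _; quatK _ _]; first exact: quat_basis.
by move=> x; rewrite !inE => /or4P[] /eqP->; apply/and4P;
  split; rewrite /= ?rpred1 ?rpred0.
Qed.

Definition lipschitz : zorder H :=
  ZOrder lipschitz_subring lipschitz_fg lipschitz_full.

End Lipschitz.

(* Main.v *)
Require Import Defs.
From HB Require Import structures.
From mathcomp Require Import all_boot all_order all_algebra all_field.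
From mathcomp Require Import boolp classical_sets cardinality.
From mathcomp Require Import ring zify lra.

Set Implicit Arguments.
Unset Strict Implicit.
Unset Printing Implicit Defensive.

Import Order.TTheory GRing.Theory Num.Theory.

Local Open Scope classical_set_scope.
Local Open Scope ring_scope.

(** Finiteness of U(O) forces, by Dirichlet's pigeonhole argument applied to
    the norm forms of the orders Z[x], every element of A to generate Q or an
    imaginary quadratic field.  Hence A carries a conjugation and a positive
    definite multiplicative norm, has dimension 1, 2 or 4, and the units of O
    are its elements of norm 1.

    Rank.  Write S for the Z-span of the units.  Modulo the Z-span of at most
    four independent units, rounding coordinates brings a point of their
    rational span to norm at most 1, and below 1 unless there are four pairwise
    orthogonal ones; these can be exchanged for a non-orthogonal list or already
    generate the integral points.  So S is saturated in O and has a Z-basis of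
    units, of size inv_O.  The map phi sending x to
    the class of [[1, x], [0, 1]] is onto E_2(O)^ab, and 12 phi(u) = 0 for a unit u.
    Conversely E(a) |-> a mod S, where E(a) = [[a, 1], [-1, 0]], is well defined
    on E_2(O): in a word with trivial product the partial products of largest
    norm occur next to a letter of norm less than 4, where the word can be
    shortened or flattened.  Hence E_2(O)^ab has the rank of O / S.

    Classification.  If S = O, the same rounding shows that O is maximal unless
    it has four orthogonal unit generators, in which case it is the Lipschitz
    order; the algebra is found by choosing suitable units.  Conversely the
    listed algebras contain a Euclidean order H spanned by units, and any
    maximal order M lies in a conjugate of H because H M = H a. *)

(** * Words in the matrices E(a) *)

(** The obstacle is that no presentation of E_2(O) is at hand, so the class of a sum of letters has
    to be controlled along arbitrary words. Letters of norm 2 and 3 satisfy relations beyond those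
    of unit letters, and every simplification of a word is exact only up to a triangular factor. The
    inductive statement therefore concerns words whose product is upper triangular and reads the sum
    of the letters off the corner entry. It survives the simplifications because, modulo the span of
    the units, conjugation is negation: [a + cj a] is an integer multiple of the unit 1. On the
    geometric side, rounding along one unit raises the norm by at most 1/4. Up to three units stay
    below 1, and four reach exactly 1, a loss that is avoided as soon as two of them are not
    orthogonal. This borderline value is why the Lipschitz order is the one exception to maximality.
    Dirichlet's argument works in Z[x] alone: elements of bounded norm fall into finitely many
    classes up to units of O, while the box principle would produce infinitely many as soon as x has
    a real irrational conjugate or degree above 2. *)

Section WordSums.
Variables (R : nzRingType) (V : zmodType) (cj : R -> R) (nrm : R -> nat).
Variable lam : {additive R -> V}.
Hypothesis natr_inj : forall m n : nat, m%:R = n%:R :> R -> m = n.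
Hypothesis cjB : {morph cj : x y / x - y}.
Hypothesis cjM : forall x y, cj (x * y) = cj y * cj x.
Hypothesis cjK : involutive cj.
Hypothesis mul_cj : forall x, x * cj x = (nrm x)%:R.
Hypothesis mulcj : forall x, cj x * x = (nrm x)%:R.
Hypothesis nrm_eq0 : forall x, nrm x = 0%N -> x = 0.
Hypothesis lam_unit : forall x, nrm x = 1%N -> lam x = 0.
Hypothesis add_cj : forall x, exists t : int, x + cj x = t%:~R.

Implicit Types (s : R * R) (w : seq R) (x y z u al be : R).

(* Right action on row vectors of the matrix E(a) = [[a, 1], [-1, 0]]. *)
Definition wstep s a : R * R := (s.1 * a - s.2, s.1).
Definition wrun s w := foldl wstep s w.
Definition wsum w : V := \sum_(a <- w) lam a.

Fixpoint wtrace s w : seq nat :=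
  if w is a :: w' then nrm (wstep s a).1 :: wtrace (wstep s a) w' else [::].

(* Right action of the upper triangular matrix [[al, al * y], [0, be]]. *)
Definition tri al be y s : R * R := (s.1 * al, s.1 * al * y + s.2 * be).

(** A diagonal pair moved past a letter [a] turns it into [al * a * cj be], which a general pair of
    units would not let [lam] ignore. The pairs that arise are products of [(u, cj u)], left behind
    by a unit letter, and [(-1, -1)], left by the other replacements. Passing a letter swaps the two
    entries, hence the symmetric condition. *)
Definition lam_invariant al be := [/\ nrm al = 1%N, nrm be = 1%N
  & forall a, lam (al * a * cj be) = lam a /\ lam (be * a * cj al) = lam a].

Lemma anti_cj0 : cj 0 = 0. Proof. by have := cjB 0 0; rewrite !subrr. Qed.
Lemma anti_cjN x : cj (- x) = - cj x.
Proof. by rewrite -(sub0r x) cjB anti_cj0 sub0r. Qed.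
Lemma anti_cjD x y : cj (x + y) = cj x + cj y.
Proof. by rewrite -{1}(opprK y) cjB anti_cjN opprK. Qed.

Lemma nrm0 : nrm 0 = 0%N.
Proof. by apply: natr_inj; rewrite -mul_cj mul0r mulr0n. Qed.

Lemma nrmE x (n : nat) : x * cj x = n%:R -> nrm x = n.
Proof. by rewrite mul_cj => /natr_inj. Qed.

Lemma natr_comm (n : nat) x : n%:R * x = x * n%:R.
Proof. by rewrite mulr_natl mulr_natr. Qed.

Lemma nrmM x y : nrm (x * y) = (nrm x * nrm y)%N.
Proof.
apply: nrmE; rewrite cjM mulrA -(mulrA x) mul_cj -mulrA natr_comm mulrA.
by rewrite mul_cj natrM.
Qed.

Lemma nrmN x : nrm (- x) = nrm x.
Proof. by apply: nrmE; rewrite anti_cjN mulrNN mul_cj. Qed.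

Lemma anti_cj1 : cj 1 = 1.
Proof. by rewrite -[LHS]mul1r -{1}(cjK 1) -cjM mul1r cjK. Qed.

Lemma nrm1 : nrm 1 = 1%N.
Proof. by apply: nrmE; rewrite anti_cj1 mulr1. Qed.

Lemma nrm_cj x : nrm (cj x) = nrm x.
Proof. by apply: nrmE; rewrite cjK mulcj. Qed.

Lemma nrm_sub x y :
  (nrm (x - y))%:R + (x * cj y + y * cj x) = (nrm x)%:R + (nrm y)%:R :> R.
Proof.
rewrite -!mul_cj cjB mulrBl !mulrBr.
set p := x * cj x; set q := x * cj y; set r := y * cj x; set t := y * cj y.
by rewrite opprB addrACA !addrNK.
Qed.

Lemma nrm_parallelogram x y : (nrm (x + y) <= 2 * nrm x + 2 * nrm y)%N.
Proof.
have: (nrm (x + y) + nrm (x - y))%N = (nrm x + nrm y + (nrm x + nrm y))%N.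
  have := nrm_sub x (- y); rewrite opprK anti_cjN nrmN mulrN mulNr -opprD.
  move=> /(canRL (subrK _)) h1; have /(canRL (addrK _)) h2 := nrm_sub x y.
  apply: natr_inj; by rewrite !natrD h1 h2 addrACA subrr addr0.
lia.
Qed.

Lemma lam_int (t : int) : lam t%:~R = 0.
Proof. by rewrite raddfMz lam_unit ?nrm1 // mul0rz. Qed.

(** Traces are integer multiples of the unit 1, which [lam] kills. *)
Lemma lam_cj x : lam (cj x) = - lam x.
Proof.
by have [t] := add_cj x; move/(congr1 lam); rewrite lam_int raddfD /= addrC => /eqP; rewrite addr_eq0 => /eqP.
Qed.

(* u a + conj (u a) is an integer t, so u a u = t u - conj a. *)
Lemma lam_conj u a : nrm u = 1%N -> lam (u * a * u) = lam a.
Proof.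
move=> nu; have [t ht] := add_cj (u * a).
have -> : u * a * u = t%:~R * u - cj a.
  by rewrite -ht cjM mulrDl -(mulrA (cj a)) mulcj nu mulr1 addrK.
by rewrite raddfB /= lam_cj opprK mulrzl raddfMz (lam_unit nu) mul0rz add0r.
Qed.

Lemma lam_invariant_unit u : nrm u = 1%N -> lam_invariant u (cj u).
Proof.
move=> nu; split; rewrite ?nrm_cj // => a; rewrite cjK; split.
  exact: lam_conj.
by apply: lam_conj; rewrite nrm_cj.
Qed.

Lemma lam_invariant1 : lam_invariant 1 1.
Proof. by split; rewrite ?nrm1 // => a; rewrite anti_cj1 mul1r mulr1. Qed.

Lemma lam_invariantN1 : lam_invariant (-1) (-1).
Proof. by split; rewrite ?nrmN ?nrm1 // => a; rewrite anti_cjN anti_cj1 mulN1r mulrN1 opprK. Qed.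

Lemma lam_invariantC al be : lam_invariant al be -> lam_invariant be al.
Proof. by case=> ? ? h; split=> // a; have [] := h a. Qed.

Lemma lam_invariantM al be al' be' : lam_invariant al be -> lam_invariant al' be' -> lam_invariant (al' * al) (be' * be).
Proof.
move=> [na nb h] [na' nb' h']; split; rewrite ?nrmM ?na ?nb ?na' ?nb' // => a.
rewrite !cjM !mulrA; split.
  by rewrite -(mulrA al') -(mulrA al') (proj1 (h' _)) (proj1 (h _)).
by rewrite -(mulrA be') -(mulrA be') (proj2 (h' _)) (proj2 (h _)).
Qed.

Lemma unit_cj u : nrm u = 1%N -> (u * cj u = 1) * (cj u * u = 1).
Proof. by move=> nu; rewrite mul_cj mulcj nu. Qed.

Lemma tri_comp al be y al' be' y' : lam_invariant al be -> forall s,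
  tri al be y (tri al' be' y' s) = tri (al' * al) (be' * be) (y + cj al * y' * be) s.
Proof.
move=> [na nb _] s; rewrite /tri /= !mulrA; congr (_, _).
rewrite mulrDr mulrDl -!addrA; congr (_ + _); rewrite !mulrA; congr (_ + _).
by rewrite -(mulrA (_ * _) al) unit_cj // mulr1.
Qed.

Lemma lam_tri al be y : lam_invariant al be -> lam (cj al * y * be) = lam y.
Proof.
move=> [na nb h]; rewrite -(proj1 (h _)) !mulrA unit_cj // mul1r.
by rewrite -mulrA unit_cj // mulr1.
Qed.

Lemma wrun_cat s w1 w2 : wrun s (w1 ++ w2) = wrun (wrun s w1) w2.
Proof. exact: foldl_cat. Qed.

Lemma wsum_cat w1 w2 : wsum (w1 ++ w2) = wsum w1 + wsum w2.
Proof. by rewrite /wsum big_cat. Qed.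

Lemma wsum_cons a w : wsum (a :: w) = lam a + wsum w.
Proof. by rewrite /wsum big_cons. Qed.

Lemma wsum_nil : wsum [::] = 0.
Proof. by rewrite /wsum big_nil. Qed.

Lemma wtrace_cat s w1 w2 :
  wtrace s (w1 ++ w2) = wtrace s w1 ++ wtrace (wrun s w1) w2.
Proof. by elim: w1 s => //= a w1 ih s; rewrite ih. Qed.

(* An upper triangular matrix can be moved past a word: the letters change, but
   neither the norms met along the way nor the invariant wsum - lam do. *)
Lemma wrun_tri w al be y : lam_invariant al be -> exists w' al' be' y', [/\ lam_invariant al' be',
  forall s, wrun (tri al be y s) w = tri al' be' y' (wrun s w'),
  forall s, wtrace (tri al be y s) w = wtrace s w'
  & wsum w - lam y = wsum w' - lam y'].
Proof.
elim: w al be y => [|a w ih] al be y gab; first by exists [::], al, be, y.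
have gba := lam_invariantC gab; case: (gab) => na nb h.
have [w' [al' [be' [y' [g' hrun htr hsum]]]]] := ih be al 0 gba.
have hs s : wstep (tri al be y s) a =
    tri be al 0 (wstep s (al * (a - y) * cj be)).
  rewrite /wstep /tri /= mulr0 add0r; congr (_, _).
  rewrite mulrBl !mulrA -(mulrA _ (cj be)) unit_cj // mulr1.
  by rewrite mulrBr opprD addrA.
have hn s : nrm (wstep (tri al be y s) a).1 =
    nrm (wstep s (al * (a - y) * cj be)).1.
  by rewrite hs /tri /= nrmM nb muln1.
exists (al * (a - y) * cj be :: w'), al', be', y'; split=> // [s|s|].
- by rewrite -[LHS]/(wrun (wstep _ a) w) hs hrun.
- by rewrite -[LHS]/(_ :: wtrace (wstep _ a) w) hn hs htr.
rewrite !wsum_cons (proj1 (h _)) raddfB /=.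
by move: hsum; rewrite raddf0 subr0 => ->; rewrite -!addrA [- lam y + _]addrC !addrA.
Qed.

(** The start [(0, 1)] follows the bottom row of the product, so the premise says that the product
    is upper triangular. Asking only for this, rather than for the identity, makes the property
    stable under the triangular factors that the replacements create. *)
Definition wtriangular w := (wrun (0, 1) w).1 = 0 -> exists al be y,
  [/\ lam_invariant al be, forall s, wrun s w = tri al be y s & wsum w = - lam y].

(** Local surgery: [p] is traded for [m] at the price of a triangular factor, which [wrun_tri]
    carries to the right end. The letters of the suffix change, but the norms met along it do not,
    so an induction on the trace can continue. *)
Lemma wtriangular_replace w1 p w3 m al be y :
  (forall s, wrun s p = tri al be y (wrun s m)) -> lam_invariant al be ->
  wsum p = wsum m - lam y ->
  exists w3', (wtriangular (w1 ++ m ++ w3') -> wtriangular (w1 ++ p ++ w3)) /\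
    wtrace (0, 1) (w1 ++ m ++ w3') = wtrace (0, 1) w1 ++
      wtrace (wrun (0, 1) w1) m ++ wtrace (wrun (wrun (0, 1) w1) p) w3.
Proof.
move=> hp gab hsum.
have [w3' [al' [be' [y' [g' hrun htr hsum3]]]]] := wrun_tri w3 y gab.
exists w3'; split; last by rewrite !wtrace_cat hp htr.
have hE s : wrun s (w1 ++ p ++ w3) = tri al' be' y' (wrun s (w1 ++ m ++ w3')).
  by rewrite !wrun_cat hp hrun.
move=> cl hz; have h0 : (wrun (0, 1) (w1 ++ m ++ w3')).1 * al' = 0.
  by move: hz; rewrite hE.
have [na' _ _] := g'.
have /cl [al2 [be2 [y2 [g2 hr2 hs2]]]] : (wrun (0, 1) (w1 ++ m ++ w3')).1 = 0.
  by rewrite -[LHS]mulr1 -[X in _ * X](unit_cj na').1 mulrA h0 mul0r.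
exists (al2 * al'), (be2 * be'), (y' + cj al' * y2 * be'); split.
- exact: lam_invariantM.
- by move=> s; rewrite hE hr2 tri_comp.
- rewrite raddfD /= lam_tri // opprD -hs2 !wsum_cat hsum.
  rewrite -!addrA [- lam y + _]addrC hsum3 !addrA.
  by rewrite [LHS]addrC !addrA.
Qed.

Lemma first_max (l : seq nat) (M : nat) : M \in l ->
  exists l1 l2, l = l1 ++ M :: l2 /\ M \notin l1.
Proof.
move=> Ml; exists (take (index M l) l), (drop (index M l).+1 l).
split; first by rewrite -[X in X :: _](nth_index 0%N Ml) -drop_nth ?index_mem // cat_take_drop.
by rewrite in_take_leq ?index_size // ltnn.
Qed.

Lemma wtrace_split s w l1 n l2 : wtrace s w = l1 ++ n :: l2 ->
  exists w1 b w2, [/\ w = w1 ++ b :: w2, wtrace s w1 = l1,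
    nrm (wrun s (rcons w1 b)).1 = n & wtrace (wrun s (rcons w1 b)) w2 = l2].
Proof.
elim: l1 w s => [|n1 l1 ih] [|a w] //= s [].
  by move=> h1 h2; exists [::], a, w.
move=> h1 /ih [w1 [b [w2 [-> h2 h3 h4]]]].
by exists (a :: w1), b, w2; split; rewrite //= ?h1 ?h2.
Qed.

Lemma wrun_rcons s w a : wrun s (rcons w a) = wstep (wrun s w) a.
Proof. by rewrite /wrun foldl_rcons. Qed.

Lemma nrm_last s w (M : nat) : (nrm s.1 < M)%N -> all (fun n => (n < M)%N) (wtrace s w) ->
  (nrm (wrun s w).1 < M)%N.
Proof.
elim: w s => //= a w ih s hs /andP[h1 h2]; exact: ih.
Qed.

Section Cross.
Variables (x z a : R).
Let c := x * a * cj z + z * cj a * cj x.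

(** Equal cross terms cancel, which turns identities in [R] into equations between natural numbers.
    The relations [nrm_rel1] to [nrm_rel3] all have the cross term [c], doubled in the last two. *)
Lemma natr_cross (d : R) (m n m' n' : nat) :
  m%:R + d = n%:R -> m'%:R + d = n'%:R -> (m + n' = m' + n)%N.
Proof.
by move=> h h'; apply: natr_inj; rewrite !natrD -h -h' addrCA.
Qed.

Lemma nrm_double y : nrm (y *+ 2) = (4 * nrm y)%N.
Proof.
rewrite mulr2n -[y in y + _]mulr1 -[y in _ + y]mulr1 -mulrDr nrmM mulnC; congr (_ * _)%N.
by apply: nrmE; rewrite anti_cjD anti_cj1 -[1 + 1]/(2%:R : R) -natrM.
Qed.

Lemma cj_double y : cj (y *+ 2) = cj y *+ 2.
Proof. by rewrite !mulr2n anti_cjD. Qed.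

Lemma nrm_crossE : (nrm (x * a - z))%:R + c = (nrm x * nrm a + nrm z)%:R.
Proof. by have := nrm_sub (x * a) z; rewrite cjM mulrA -/c nrmM -natrD. Qed.

Lemma nrm_crossE2 : (2 * nrm (x * a - z))%:R + c *+ 2 =
  (2 * (nrm x * nrm a + nrm z))%:R.
Proof. by rewrite !(natrM _ 2) -nrm_crossE !mulr_natl [RHS]mulrnDl. Qed.

Lemma nrm_rel1 : (nrm (x - z * cj a) + nrm x * nrm a + nrm z =
  nrm (x * a - z) + nrm x + nrm z * nrm a)%N.
Proof.
have h := nrm_sub x (z * cj a); rewrite cjM cjK mulrA -/c nrmM nrm_cj -natrD in h.
have := natr_cross nrm_crossE h; lia.
Qed.

Lemma nrm_rel2 : (nrm (z *+ 2 - x * a) + nrm x * nrm a =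
  2 * nrm (x * a - z) + 2 * nrm z)%N.
Proof.
have h := nrm_sub (z *+ 2) (x * a).
rewrite cj_double cjM mulrnAl mulrnAr !mulrA -mulrnDl [z * _ * _ + _]addrC -/c in h.
rewrite nrm_double nrmM -natrD in h.
by move: (natr_cross nrm_crossE2 h); move: (nrm (z *+ 2 - _)); lia.
Qed.

Lemma nrm_rel3 : (nrm (x *+ 2 - z * cj a) + 2 * nrm x * nrm a + 2 * nrm z =
  2 * nrm (x * a - z) + 4 * nrm x + nrm z * nrm a)%N.
Proof.
have h := nrm_sub (x *+ 2) (z * cj a).
rewrite cj_double cjM cjK mulrnAl mulrnAr !mulrA -mulrnDl -/c in h.
rewrite nrm_double nrmM nrm_cj -natrD in h.
by move: (natr_cross nrm_crossE2 h); move: (nrm (x *+ 2 - _)); lia.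
Qed.

End Cross.

(* For nrm a = 2 or 3, replacing the letters b, a by b - cj a, - a, or by
   b - cj a, - a, - cj a, - a, changes the product by a triangular factor only;
   these are the intermediate entries met on the way. *)
Lemma turn2 x z a : nrm a = 2%N -> (x - z * cj a) * - a - z = z - x * a.
Proof.
move=> na; rewrite mulrN mulrBl opprB -(mulrA z) mulcj na.
by rewrite mulr_natr mulr2n addrAC addrK.
Qed.

Lemma turn3 x z a : nrm a = 3%N ->
  [/\ (x - z * cj a) * - a - z = z *+ 2 - x * a,
     (z *+ 2 - x * a) * - cj a - (x - z * cj a) = x *+ 2 - z * cj a
   & (x *+ 2 - z * cj a) * - a - (z *+ 2 - x * a) = z - x * a].
Proof.
move=> na; rewrite !mulrN !mulrBl !opprB -!(mulrA z) -!(mulrA x) mulcj mul_cj na.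
rewrite !mulr_natr !mulrnAl; split.
- by rewrite addrAC mulrSr addrK.
- by rewrite [z * _ - x]addrC addrACA mulrSr addrK [z * _ *+ 2]mulr2n opprD subrK.
- by rewrite [x * a - _]addrC addrACA mulrS addrK [x * a *+ 2]mulr2n opprD subrK.
Qed.

Lemma tri_turn2 x z a : nrm a = 2%N ->
  tri (-1) (-1) (cj a) (z - x * a, x - z * cj a) = (x * a - z, x).
Proof.
move=> na; rewrite /tri /= !mulrN !mulr1 !opprB mulrBl -(mulrA x) mul_cj na.
by rewrite addrA subrK mulr_natr mulr2n addrK.
Qed.

Lemma tri_turn3 x z a : nrm a = 3%N ->
  tri (-1) (-1) (cj a) (z - x * a, x *+ 2 - z * cj a) = (x * a - z, x).
Proof.
move=> na; rewrite /tri /= !mulrN !mulr1 !opprB mulrBl -(mulrA x) mul_cj na.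
by rewrite addrA subrK mulr_natr mulrS addrK.
Qed.

(* Induction on the largest norm M met along the word, then on how often it is
   met.  If x is the first entry of norm M, its neighbours being z before and
   x a - z after, the parallelogram law gives nrm a < 4. *)
Lemma wtriangular_bounded (M : nat) w :
  all (fun n => (n <= M)%N) (wtrace (0, 1) w) -> wtriangular w.
Proof.
elim: M w => [|M ihM] w.
  case: w => [_ _|a w] /=; last by rewrite mul0r sub0r nrmN nrm1.
  exists 1, 1, 0; split; rewrite ?wsum_nil ?raddf0 ?oppr0 //; first exact: lam_invariant1.
  by move=> [x y]; rewrite /tri /= !mulr1 mulr0 add0r.
move: {2}(count_mem M.+1 _) (leqnn (count_mem M.+1 (wtrace (0, 1) w))) => c.
elim: c w => [|c ihc] w hc hall.
  apply: ihM; apply/allP=> n hn; have := allP hall n hn.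
  rewrite leq_eqVlt => /orP[/eqP nM|]; last by rewrite ltnS.
  by move: hc; rewrite leqn0 -nM => /eqP/count_memPn; rewrite hn.
have [Min|Mnin] := boolP (M.+1 \in wtrace (0, 1) w); last first.
  by apply: ihc => //; rewrite (count_memPn Mnin).
have [l1 [l2 [htr Ml1]]] := first_max Min.
have [w1 [b [w2 [hw htr1 hx htr2]]]] := wtrace_split htr.
move: (hall) (hc); rewrite htr all_cat /= count_cat /= eqxx.
rewrite (count_memPn Ml1) add0n add1n ltnS => /and3P[hl1 _ hl2] hc2.
rewrite wrun_rcons in hx htr2.
set s1 := wrun (0, 1) w1 in hx htr2.
have hz : (nrm s1.1 < M.+1)%N.
  apply: nrm_last; rewrite ?nrm0 // htr1; apply/allP=> n hn.
  by rewrite ltn_neqAle (allP hl1) // andbT; apply: contra Ml1 => /eqP <-.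
set x := (wstep s1 b).1 in hx.
case: w2 hw htr2 => [|a w3] hw htr2.
  rewrite hw /wtriangular wrun_cat -/s1 -[wrun s1 [:: b]]/(wstep s1 b) -/x => h0.
  by move: hx; rewrite h0 nrm0.
move: hl2 hc2; rewrite -htr2 /= => /andP[hy hl3] hc3.
set z := s1.1 in hz.
rewrite -[s1.1 * b - s1.2]/x -/z in hy hc3.
(* A replacement [m] of the letters [b], [a] is good enough if its entries respect the bound and
   meet [M.+1] no more often than the single entry [x * a - z]: the occurrence at [x] is then gone
   and [ihc] applies. *)
have key m al be y : (forall s, wrun s [:: b; a] = tri al be y (wrun s m)) ->
    lam_invariant al be -> wsum [:: b; a] = wsum m - lam y ->
    all (fun n => (n <= M.+1)%N) (wtrace s1 m) ->
    (count_mem M.+1 (wtrace s1 m) <= (nrm (x * a - z) == M.+1))%N -> wtriangular w.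
  move=> h1 h2 h3 h4 h5.
  have [w3' [hcl htr']] := wtriangular_replace w1 w3 h1 h2 h3.
  rewrite hw -[_ :: _ :: _]/([:: b; a] ++ w3); apply/hcl/ihc; rewrite htr'.
    rewrite !count_cat htr1 (count_memPn Ml1) add0n -/s1.
    by rewrite -ltnS; apply: leq_ltn_trans hc3; rewrite leq_add2r.
  by rewrite !all_cat htr1 hl1 h4 hl3.
have na : (nrm a < 4)%N.
  (* [z] comes before the first maximum, so its norm is strictly below [M.+1]; this makes the bound
     4 strict. *)
  have := nrm_parallelogram (x * a - z) z; rewrite subrK nrmM hx => h.
  rewrite -(ltn_pmul2l (ltn0Sn M)); apply: leq_ltn_trans h _; lia.
have xE : x = s1.1 * b - s1.2 by [].
have q1E t : s1.1 * (b - t) - s1.2 = x - z * t by rewrite mulrBr addrAC.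
have r1 := nrm_rel1 x z a; have r2 := nrm_rel2 x z a; have r3 := nrm_rel3 x z a.
rewrite hx in r1 r2 r3.
have caseN : nrm a \in [:: 0; 1; 2; 3]%N by case: (nrm a) na => [|[|[|[|]]]].
move: caseN; rewrite !inE => /or4P[] /eqP nae; rewrite nae in r1 r2 r3.
(* E(b) E(0) is itself triangular, so both letters are deleted. *)
- have a0 := nrm_eq0 nae.
  apply: (key [::] (-1) (-1) (- b)) => //; first last.
  + by rewrite !wsum_cons wsum_nil a0 raddf0 raddfN /= opprK !addr0 add0r.
  + exact: lam_invariantN1.
  + by move=> s; rewrite a0 /tri /wrun /wstep /= mulr0 sub0r !mulrN !mulr1 mulNr opprK.
(* For a unit [a], E(b) E(a) is E(b - cj a) times a triangular matrix, and by [nrm_rel1] the new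
   entry has exactly the norm of [x * a - z]. *)
- apply: (key [:: b - cj a] a (cj a) (cj a)).
  + move=> s; rewrite /tri /wrun /wstep /=.
    have [ua ub] := unit_cj nae.
    rewrite mulrBr [_ - _ - s.2]addrAC; set v := _ - s.2; set u := s.1.
    by rewrite -[_ * a * cj a]mulrA ua mulr1 subrK [(v - _) * a]mulrBl -[_ * cj a * a]mulrA ub mulr1.
  + exact: lam_invariant_unit.
  + by rewrite !wsum_cons wsum_nil raddfB /= lam_cj (lam_unit nae) !(oppr0, subr0, addr0).
  + by rewrite /= q1E andbT; lia.
  + by rewrite /= q1E addn0; move: r1; rewrite !muln1 => /addIn/addIn ->.
- apply: (key [:: b - cj a; - a] (-1) (-1) (cj a)).
  + move=> s; rewrite /wrun /wstep /= mulrBr [_ - _ - s.2]addrAC turn2 //.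
    by rewrite tri_turn2.
  + exact: lam_invariantN1.
  + by rewrite !wsum_cons wsum_nil raddfB raddfN /= lam_cj !opprK !addr0 addrK.
  (* By [nrm_rel1] the new inner norm is [nrm (x * a - z) - nrm x + nrm z], at most [nrm z]. *)
  + rewrite /= q1E andbT turn2 // -[z - _]opprB nrmN hy andbT; lia.
  + by rewrite /= q1E turn2 // -[z - _]opprB nrmN addn0 (_ : (_ == M.+1) = false) //; lia.
- have [t1 t2 t3] := turn3 x z nae.
  apply: (key [:: b - cj a; - a; - cj a; - a] (-1) (-1) (cj a)).
  + move=> s; rewrite /wrun /wstep /= mulrBr [_ - _ - s.2]addrAC.
    by have [-> -> ->] := turn3 (s.1 * b - s.2) s.1 nae; rewrite tri_turn3.
  + exact: lam_invariantN1.
  + rewrite !wsum_cons wsum_nil raddfB !raddfN /= lam_cj !opprK !addr0.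
    by rewrite subrr addr0 subrK.
  (* Since [nrm (x * a - z) <= nrm x] and [nrm z < nrm x], the three relations bound the new inner
     norms by [2 nrm z - nrm x] for the first two and by [nrm z] for the third. *)
  + rewrite /= q1E t1 t2 t3 -[z - _]opprB nrmN hy andbT.
    move: r2 r3; move: (nrm (z *+ 2 - _)) (nrm (x *+ 2 - _)) => ? ?; lia.
  + rewrite /= q1E t1 t2 t3 -[z - _]opprB nrmN addn0.
    have l3 : (nrm (x *+ 2 - z * cj a) < M.+1)%N.
      by move: r3; move: (nrm (x *+ 2 - _)) => ?; lia.
    have l2' : (nrm (z *+ 2 - x * a) < M.+1)%N.
      by move: r2; move: (nrm (z *+ 2 - _)) => ?; lia.
    have l1' : (nrm (x - z * cj a) < M.+1)%N by clear r2 r3 l2' l3; lia.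
    by rewrite (ltn_eqF l1') (ltn_eqF l2') (ltn_eqF l3).
Qed.

Theorem wsum_id w : (forall s, wrun s w = s) -> wsum w = 0.
Proof.
move=> h.
have hb : all (fun n => n <= \max_(n <- wtrace (0%R, 1%R) w) n)%N (wtrace (0, 1) w).
  by apply/allP=> n hn; rewrite (big_rem n hn) /= leq_maxl.
have [|al [be [y [g hr ->]]]] := wtriangular_bounded hb; first by rewrite h.
have [na _ _] := g; have := hr (1, 0); rewrite h /tri /= !mul1r mul0r addr0 => -[_ h0].
suff -> : y = 0 by rewrite raddf0 oppr0.
by rewrite -[y]mul1r -(unit_cj na).2 -mulrA -h0 mulr0.
Qed.

End WordSums.

(** * Dirichlet's argument *)

Lemma algC_floor (x : algC) (n : nat) : 0 <= x -> x < n%:R -> {m : 'I_n | m%:R <= x < m.+1%:R}.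
Proof.
move=> x0 xn; have /andP[h1 h2] := truncn_itv x0.
have hm : (Num.truncn x < n)%N by rewrite -(ltr_nat algC); apply: le_lt_trans h1 xn.
by exists (Ordinal hm); rewrite /= h1 h2.
Qed.

(** There are (T^e + 1)^d integer vectors with entries in [0, T^e] and only (T^d)^e boxes for the
    values of the [e] linear forms; [w] is the difference of two vectors in one box. The gain T^e /
    T^d is useful when [e < d]. *)
Lemma box_principle (d e : nat) (d0 : (0 < d)%N) (a : 'I_e -> 'I_d -> algC) (K : nat) :
  (forall k j, a k j \is Num.real) -> (forall k, \sum_j `|a k j| <= K%:R) ->
  forall T : nat, (0 < T)%N -> exists w : 'I_d -> int,
  [/\ exists j, w j != 0, forall j, `|w j|%:~R <= (T ^ e)%:R :> algC
    & forall k, `|\sum_j (w j)%:~R * a k j| <= (2 * K + 1)%:R * ((T ^ e)%:R / (T ^ d)%:R)].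
Proof.
move=> ra aK T T0.
pose X := {ffun 'I_d -> 'I_(T ^ e).+1}; pose Y := {ffun 'I_e -> 'I_(T ^ d)}.
pose L (k : 'I_e) (v : X) : algC := \sum_j (v j)%:R * a k j.
have Te0 : 0 < (T ^ e)%:R :> algC by rewrite ltr0n expn_gt0 T0.
have Td0 : 0 < (T ^ d)%:R :> algC by rewrite ltr0n expn_gt0 T0.
have rL k v : L k v \is Num.real by apply: rpred_sum => j _; rewrite rpredM ?realn.
have bL k v : `|L k v| <= K%:R * (T ^ e)%:R.
  apply: le_trans (ler_norm_sum _ _ _) _; apply: le_trans (ler_wpM2r (ltW Te0) (aK k)).
  rewrite mulr_suml; apply: ler_sum => j _; rewrite normrM normr_nat mulrC.
  by apply: ler_wpM2l => //; rewrite ler_nat -ltnS.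
(* The forms take values in [- K T^e, K T^e]. After a shift by K T^e the factor [s] sends them into
   [0, T^d), the 1 in [2 * K + 1] making the upper bound strict and [s] well defined when [K] is
   0. *)
pose s : algC := (T ^ d)%:R / ((2 * K + 1)%:R * (T ^ e)%:R).
have K0 : 0 < (2 * K + 1)%:R :> algC by rewrite ltr0n addn1.
have s0 : 0 < s by rewrite divr_gt0 // mulr_gt0.
pose y k v := (L k v + K%:R * (T ^ e)%:R) * s.
have bLv k v := bL k v; have y0 k v : 0 <= y k v.
  apply: mulr_ge0; last exact: ltW.
  rewrite -lerBlDr sub0r lerNl; apply: le_trans (bL k v).
  by rewrite -normrN real_ler_norm ?realN.
have yT k v : y k v < (T ^ d)%:R.
  have -> : (T ^ d)%:R = ((2 * K + 1)%:R * (T ^ e)%:R) * s.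
    by rewrite mulrC divfK // mulf_neq0 ?gt_eqF.
  rewrite ltr_pM2r //; apply: (@le_lt_trans _ _ ((2 * K)%:R * (T ^ e)%:R)).
    rewrite mul2n -addnn natrD mulrDl lerD2r; apply: le_trans (bL k v).
    exact: real_ler_norm.
  by rewrite ltr_pM2r // ltr_nat addn1.
pose box v : Y := [ffun k => sval (algC_floor (y0 k v) (yT k v))].
have : ~~ injectiveb box.
  apply/negP=> /injectiveP/leq_card; rewrite !card_ffun !card_ord -expnM mulnC expnM.
  by rewrite leqNgt ltn_exp2r // ltnSn.
case/injectivePn => v [v' vv' bvv'].
pose w j : int := (v j)%:Z - (v' j)%:Z.
exists w; split.
- have [j jvv'] : exists j, v j != v' j.
    apply/existsP; rewrite -negb_forall; apply: contra vv' => /forallP h.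
    by apply/eqP/ffunP => j; apply/eqP.
  by exists j; rewrite subr_eq0 eqz_nat.
- move=> j; rewrite /w [leRHS]pmulrn ler_int.
  have := ltn_ord (v j); have := ltn_ord (v' j); lia.
move=> k; have -> : \sum_j (w j)%:~R * a k j = L k v - L k v'.
  by rewrite -sumrB; apply: eq_bigr => j _; rewrite intrB mulrBl.
have -> : (2 * K + 1)%:R * ((T ^ e)%:R / (T ^ d)%:R) = s^-1 by rewrite invf_div mulrA.
rewrite -[leRHS]div1r ler_pdivlMr // -[X in _ * X](gtr0_norm s0) -normrM mulrBl.
have -> : L k v * s - L k v' * s = y k v - y k v' by rewrite /y !mulrDl opprD addrACA subrr addr0.
have := congr1 (fun f : Y => f k) bvv'; rewrite !ffunE.
case: algC_floor => m /= hm; case: algC_floor => m' /= hm' mm'; rewrite -mm' in hm'.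
move: hm hm' => /andP[h1 h2] /andP[h3 h4].
have yr v0 : y k v0 \is Num.real by rewrite ger0_real.
rewrite real_ler_norml ?rpredB // lerBlDr lerBrDl.
rewrite -natr1 in h2 h4; apply/andP; split; apply: ltW.
  by rewrite ltrBlDr; apply: lt_le_trans h4 _; rewrite lerD2r.
by apply: lt_le_trans h2 _; rewrite addrC lerD2l.
Qed.

Section OrderBasics.
Variables (A : falgType rat) (O : zorder A).

Lemma zord1 : 1 \in O. Proof. by have [] := order_subring O. Qed.
Lemma zordB x y : x \in O -> y \in O -> x - y \in O.
Proof. by have [_ h _] := order_subring O; exact: h. Qed.
Lemma zordM x y : x \in O -> y \in O -> x * y \in O.
Proof. by have [_ _ h] := order_subring O; exact: h. Qed.
Lemma zord0 : 0 \in O. Proof. by rewrite -(subrr 1) zordB ?zord1. Qed.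
Lemma zordN x : x \in O -> - x \in O.
Proof. by move=> Ox; rewrite -sub0r zordB ?zord0. Qed.
Lemma zordD x y : x \in O -> y \in O -> x + y \in O.
Proof. by move=> Ox Oy; rewrite -[y]opprK zordB ?zordN. Qed.
Lemma zord_sum (I : Type) (r : seq I) (P : pred I) (F : I -> A) :
  (forall i, P i -> F i \in O) -> \sum_(i <- r | P i) F i \in O.
Proof. by move=> h; apply: (big_ind (fun x => x \in O)) => //; [exact: zord0|exact: zordD]. Qed.
Lemma zordMn x n : x \in O -> x *+ n \in O.
Proof. by move=> Ox; elim: n => [|n ih]; rewrite ?mulr0n ?zord0 // mulrS zordD. Qed.
Lemma zordMz x n : x \in O -> x *~ n \in O.
Proof. by move=> Ox; case: n => n; rewrite ?NegzE ?mulrNz -?pmulrn ?zordN ?zordMn. Qed.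
Lemma zordX x n : x \in O -> x ^+ n \in O.
Proof. by move=> Ox; elim: n => [|n ih]; rewrite ?expr0 ?zord1 // exprS zordM. Qed.
Lemma zordZz x (n : int) : x \in O -> n%:~R *: x \in O.
Proof. by rewrite scaler_int; exact: zordMz. Qed.

Lemma order_ring_valK (x : order_ring O) : order_val x \in O.
Proof. by case: x. Qed.

End OrderBasics.

Lemma common_denom (I : finType) (q : I -> rat) :
  exists k : nat, (0 < k)%N /\ forall i, q i * k%:R \is a Num.int.
Proof.
exists (\prod_i `|denq (q i)|%N)%N; split.
  by rewrite prodn_gt0 // => i; rewrite absz_gt0 denq_neq0.
move=> i; rewrite (bigD1 i) //= natrM mulrA rpredM ?natr_int //.
by rewrite pmulrn absz_denq -numqE intr_int.
Qed.

Lemma order_scale (A : falgType rat) (O : zorder A) (x : A) :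
  exists k : nat, (0 < k)%N /\ k%:R *: x \in O.
Proof.
have [B bB sB] := order_full O.
have xB : x \in <<in_tuple B>>%VS by rewrite (span_basis bB) memvf.
have [k [k0 hk]] := common_denom (fun i => coord (in_tuple B) i x).
exists k; split=> //; rewrite [in X in _ *: X](coord_span xB) scaler_sumr zord_sum // => i _.
rewrite scalerA mulrC; have /intrP [m ->] := hk i.
by rewrite zordZz // sB // mem_nth.
Qed.

Section Dirichlet.
Variables (A : falgType rat) (O : zorder A).
Hypothesis hA : forall x : A, x != 0 -> x \is a GRing.unit.
Hypothesis hO : finite_set (@ring_units O).

Lemma division_mulf_eq0 (x y : A) : x * y = 0 -> x = 0 \/ y = 0.
Proof.
move=> xy; have [->|/hA ux] := eqVneq x 0; [by left|right].
by rewrite -[y](mulKr ux) xy mulr0.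
Qed.

Variables (d' : nat) (x : A) (c : 'I_d'.+1 -> int).
Local Notation d := d'.+1.
Hypothesis xO : x \in O.
Hypothesis xfree : forall b : 'I_d -> rat, \sum_i b i *: x ^+ i = 0 -> forall i, b i = 0.
Hypothesis xpow : x ^+ d = \sum_i (c i)%:~R *: x ^+ i.

Implicit Types v w : 'rV[int]_d.

(* The companion matrix of x; dir_ev v is the element of Z[x] with coordinates
   v, and dir_mulmx v is the matrix of multiplication by it. *)
Definition dir_mx : 'M[int]_d :=
  \matrix_(i, j) if (i.+1 < d)%N then (j == i.+1 :> nat)%:R else c j.
Definition dir_ev v : A := \sum_i (v 0 i)%:~R *: x ^+ i.
Definition dir_mulmx v : 'M[int]_d := \sum_i v 0 i *: dir_mx ^+ i.

Lemma dir_evD v w : dir_ev (v + w) = dir_ev v + dir_ev w.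
Proof.
by rewrite -big_split; apply: eq_bigr => i _; rewrite mxE intrD scalerDl.
Qed.

Lemma dir_evZ n v : dir_ev (n *: v) = n%:~R *: dir_ev v.
Proof.
by rewrite scaler_sumr; apply: eq_bigr => i _; rewrite mxE intrM scalerA.
Qed.

Lemma dir_ev_sum (I : finType) (F : I -> 'rV[int]_d) :
  dir_ev (\sum_i F i) = \sum_i dir_ev (F i).
Proof.
apply: (big_morph dir_ev dir_evD); rewrite /dir_ev big1 // => i _.
by rewrite mxE scale0r.
Qed.

Lemma dir_ev_eq0 v : dir_ev v = 0 -> v = 0.
Proof.
move=> h; apply/rowP => i; rewrite mxE; apply/eqP; rewrite -(intr_eq0 rat).
by rewrite (xfree h i).
Qed.

Lemma dir_ev_inj : injective dir_ev.
Proof.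
move=> v w vw; apply/eqP; rewrite -subr_eq0; apply/eqP/dir_ev_eq0.
by rewrite -scaleN1r dir_evD dir_evZ vw rmorphN1 scaleN1r subrr.
Qed.

Lemma dir_ev_order v : dir_ev v \in O.
Proof. by apply: zord_sum => i _; rewrite zordZz ?zordX. Qed.

Lemma dir_ev_mx v : dir_ev (v *m dir_mx) = dir_ev v * x.
Proof.
have E i : dir_ev (row i dir_mx) = x ^+ i.+1.
  have [hi|hi] := ltnP i.+1 d.
    rewrite /dir_ev (bigD1 (Ordinal hi)) //= !mxE hi eqxx scale1r big1 ?addr0 // => j ji.
    rewrite !mxE hi; case: eqP => [h|]; last by rewrite scale0r.
    by case/eqP: ji; apply: val_inj.
  have -> : i.+1 = d by apply/eqP; rewrite eqn_leq hi ltn_ord.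
  by rewrite xpow; apply: eq_bigr => j _; rewrite !mxE ltnNge hi.
rewrite mulmx_sum_row dir_ev_sum mulr_suml; apply: eq_bigr => i _.
by rewrite dir_evZ E -scalerAl exprSr.
Qed.

Lemma dir_ev_mxX v n : dir_ev (v *m dir_mx ^+ n) = dir_ev v * x ^+ n.
Proof.
elim: n => [|n ih]; first by rewrite !expr0 mulmx1 mulr1.
by rewrite !exprSr mulmxA dir_ev_mx ih mulrA.
Qed.

Lemma dir_ev_mul v w : dir_ev (w *m dir_mulmx v) = dir_ev w * dir_ev v.
Proof.
rewrite mulmx_sumr dir_ev_sum mulr_sumr; apply: eq_bigr => i _.
by rewrite -scalemxAr dir_evZ dir_ev_mxX -scalerAr.
Qed.

Lemma dir_det_neq0 v : v != 0 -> \det (dir_mulmx v) != 0.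
Proof.
apply: contra => /det0P [w w0 wv]; have := dir_ev_mul v w; rewrite wv.
rewrite (_ : dir_ev 0 = 0); last by apply: big1 => i _; rewrite mxE scale0r.
case/esym/division_mulf_eq0 => /dir_ev_eq0 => [w0'|->//].
by rewrite w0' eqxx in w0.
Qed.

(** The adjugate of the multiplication matrix, applied to the coordinates of 1, supplies the
    cofactor [b]: the norm of an element of Z[x] is a multiple of that element. *)
Lemma dir_det_dvd v : exists2 b, b \in O & b * dir_ev v = (\det (dir_mulmx v))%:~R *: 1.
Proof.
pose e0 : 'rV[int]_d := delta_mx 0 0.
exists (dir_ev (e0 *m \adj (dir_mulmx v))); first exact: dir_ev_order.
rewrite -dir_ev_mul -mulmxA mul_adj_mx mul_mx_scalar dir_evZ; congr (_ *: _).
rewrite /dir_ev (bigD1 0) //= big1 ?mxE ?eqxx ?scale1r ?addr0 // => i i0.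
by rewrite mxE (negPf i0) andbF scale0r.
Qed.

Definition dir_nrm v : nat := `|\det (dir_mulmx v)|%N.

(** [dir_ev v] divides its norm by [dir_det_dvd], hence it divides the difference of two elements
    that are congruent modulo that norm. *)
Lemma dir_quotient v w : v != 0 ->
  (forall i, (w ord0 i = v ord0 i %[mod dir_nrm v])%Z) -> dir_ev w / dir_ev v \in O.
Proof.
move=> v0; rewrite /dir_nrm; set m := \det _ => hmod.
have [b bO hb] := dir_det_dvd v; rewrite -/m in hb.
have ev0 : dir_ev v != 0 by apply: contra v0 => /eqP/dir_ev_eq0 ->.
have uv := hA ev0.
pose g : 'rV[int]_d := \row_i ((w ord0 i - v ord0 i)%R %/ m)%Z.
have -> : dir_ev w = dir_ev v + dir_ev g * (b * dir_ev v).
  rewrite hb -scalerAr mulr1 -dir_evZ -dir_evD; congr dir_ev.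
  have dv i : (m %| w ord0 i - v ord0 i)%Z.
    by have /eqP := hmod i; rewrite eqz_mod_dvd !dvdzE absz_nat.
  by apply/rowP => i; rewrite !mxE [m * _]mulrC (divzK (dv i)) addrC subrK.
rewrite mulrDl divrr // -!mulrA divrr // mulr1.
by apply: zordD; [exact: (zord1 O)|apply: zordM => //; exact: dir_ev_order].
Qed.

(** Two elements of equal norm with the same residues modulo it divide each other, so they differ by
    a unit of [O]. There are finitely many norms, residues and units. *)
Lemma dir_nrm_finite (M : nat) :
  finite_set [set v | v != 0 /\ (dir_nrm v <= M)%N].
Proof.
set Z := [set v | _].
pose code v : 'I_M.+1 * {ffun 'I_d -> 'I_M.+1} :=
  (inord (dir_nrm v),
   [ffun i => inord `|(v ord0 i %% dir_nrm v)%Z|%N]).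
have codeP v w : Z v -> Z w -> code v = code w ->
    forall i, (w ord0 i = v ord0 i %[mod dir_nrm v])%Z.
  move=> [v0 vM] [w0 wM] [/(congr1 val)]; rewrite /= !inordK // => hd.
  move=> /ffunP h i; have := h i; rewrite !ffunE => /(congr1 val) /=.
  have m0 : (dir_nrm v)%:Z != 0 by rewrite eqz_nat absz_eq0 dir_det_neq0.
  have lt_mod (z : int) : (`|(z %% dir_nrm v)%Z| < M.+1)%N.
    rewrite ltnS (leq_trans _ vM) // ltnW // -ltz_nat (gez0_abs (modz_ge0 _ m0)).
    by rewrite ltz_pmod // lt_def m0.
  rewrite -hd !inordK //; move=> /(congr1 Posz); by rewrite !(gez0_abs (modz_ge0 _ m0)).
pose U := [set order_val u | u in (@ring_units O)].
have fU : finite_set U by apply: finite_image.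
have cover : Z `<=` \bigcup_(k in [set: 'I_M.+1 * {ffun 'I_d -> 'I_M.+1}]) (Z `&` [set v | code v = k]).
  by move=> v Zv; exists (code v).
apply: sub_finite_set cover _; apply: bigcup_finite => [|k _]; first exact: finite_finset.
have [[v [Zv hv]]|no] := pselect (exists v, (Z `&` [set v | code v = k]) v); last first.
  by rewrite (_ : _ `&` _ = set0) //; apply/seteqP; split=> v // hv; case: no; exists v.
have v0 : v != 0 by case: Zv.
have ev0 : dir_ev v != 0 by apply: contra v0 => /eqP/dir_ev_eq0 ->.
pose f w := dir_ev w / dir_ev v.
have injf : injective f.
  by move=> w w' /(mulIr _) h; apply: dir_ev_inj; apply: h; rewrite unitrV hA.
apply: (@sub_finite_set _ _ (f @^-1` U)); last first.
  by apply: finite_preimage fU => w w' _ _; exact: injf.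
move=> w [Zw hw].
have w0 : w != 0 by case: Zw.
have ew0 : dir_ev w != 0 by apply: contra w0 => /eqP/dir_ev_eq0 ->.
have h2 := codeP _ _ Zv Zw (etrans hv (esym hw)).
have h4 := codeP _ _ Zw Zv (etrans hw (esym hv)).
have a1 : dir_ev w / dir_ev v \in O by exact: dir_quotient.
have a2 : dir_ev v / dir_ev w \in O by exact: dir_quotient.
exists (OrderElt a1) => //; exists (OrderElt a2).
by split; apply: val_inj; rewrite /= mulrA mulrVK ?divrr ?hA.
Qed.

Definition dir_poly : {poly rat} := 'X^d - \sum_(i < d) (c i)%:~R *: 'X^i.

Lemma size_dir_tail : (size (\sum_(i < d) (c i)%:~R *: 'X^i : {poly rat})%R < size ('X^d : {poly rat})%R)%N.
Proof.
rewrite size_polyXn ltnS; apply: leq_trans (size_sum _ _ _) _; apply/bigmax_leqP => i _.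
by apply: leq_trans (size_scale_leq _ _) _; rewrite size_polyXn.
Qed.

Lemma size_dir_poly : size dir_poly = d.+1.
Proof. by rewrite size_polyDl ?size_polyN ?size_dir_tail // size_polyXn. Qed.

Lemma monic_dir_poly : dir_poly \is monic.
Proof. by rewrite monicE lead_coefDl ?size_polyN ?size_dir_tail // lead_coefXn. Qed.

Lemma horner_alg_scaleXn (a : rat) n : horner_alg x (a *: 'X^n) = a *: x ^+ n.
Proof. by rewrite -mul_polyC rmorphM /= horner_algC rmorphXn /= horner_algX mulr_algl. Qed.

Lemma horner_dir_poly : horner_alg x dir_poly = 0.
Proof.
rewrite rmorphB rmorph_sum rmorphXn /= horner_algX xpow.
rewrite [X in _ - X](eq_bigr (fun i : 'I_d => (c i)%:~R *: x ^+ i)) ?subrr // => i _.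
by rewrite horner_alg_scaleXn.
Qed.

Lemma horner_alg_small (q : {poly rat}) : q != 0 -> (size q <= d)%N -> horner_alg x q != 0.
Proof.
move=> q0 sq; apply: contra q0 => /eqP h; apply/eqP/polyP => i; rewrite coef0.
have [hi|hi] := ltnP i d; last by rewrite nth_default // (leq_trans sq).
have qE : \sum_(j < d) q`_j *: x ^+ j = 0.
  rewrite -[RHS]h -[q in RHS](take_poly_id sq) /take_poly poly_def rmorph_sum /=.
  by apply: eq_bigr => j _; rewrite horner_alg_scaleXn.
exact: (xfree qE (Ordinal hi)).
Qed.

(** If [g] is the gcd with the derivative, [p = (p / g) g] vanishes at [x], so in a division algebra
    one factor does. No nonzero polynomial of degree below [d] vanishes at [x], which leaves only a
    constant [g]. *)
Lemma separable_dir_poly : separable_poly dir_poly.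
Proof.
have P0 : dir_poly != 0 by rewrite monic_neq0 ?monic_dir_poly.
set p := dir_poly in P0 *; rewrite separable_poly.unlock /coprimep.
set g := gcdp p p^`().
have gp : g %| p by exact: dvdp_gcdl.
have p'0 : p^`() != 0.
  have: p^`()`_d' != 0.
    rewrite coef_deriv.
    have -> : p`_d = 1 by move/monicP: monic_dir_poly; rewrite /lead_coef size_dir_poly.
    by rewrite pnatr_eq0.
  by apply: contraNneq => ->; rewrite coef0.
have sg : (size g <= d)%N.
  apply: leq_trans (dvdp_leq p'0 (dvdp_gcdr _ _)) _.
  by rewrite -ltnS -size_dir_poly lt_size_deriv.
have pE : p = p %/ g * g by rewrite divpK.
have g0 : g != 0 by apply: contraNneq P0 => g0; rewrite pE g0 mulr0.
have q0 : p %/ g != 0 by apply: contraNneq P0 => q0; rewrite pE q0 mul0r.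
have hz : horner_alg x (p %/ g) * horner_alg x g = 0.
  by rewrite -rmorphM /= -pE horner_dir_poly.
have [hq|hg] := division_mulf_eq0 hz; last by have := horner_alg_small g0 sg; rewrite hg eqxx.
have sq : (size (p %/ g)%R <= d)%N -> False.
  by move=> sq; have := horner_alg_small q0 sq; rewrite hq eqxx.
move: sq; rewrite size_divp // size_dir_poly; have := size_poly_gt0 g; rewrite g0.
by case: (size g) => [|[|n]] // _ sq; case: sq; rewrite subSS leq_subr.
Qed.

Lemma dir_roots : exists th : 'I_d -> algC, injective th /\
  map_poly ratr dir_poly = \prod_i ('X - (th i)%:P).
Proof.
have [r hr] := closed_field_poly_normal (map_poly ratr dir_poly : {poly algC}).
have lP : lead_coef (map_poly ratr dir_poly : {poly algC}) = 1.
  by rewrite lead_coef_map /= (monicP monic_dir_poly) rmorph1.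
rewrite lP scale1r in hr.
have sr : size r = d.
  have := congr1 (fun q : {poly algC} => size q) hr.
  by rewrite size_map_poly size_dir_poly size_prod_XsubC => -[].
have ur : uniq r by rewrite -separable_prod_XsubC -hr separable_map separable_dir_poly.
exists (fun i => r`_i); split.
  move=> i j /eqP; rewrite nth_uniq ?sr ?ltn_ord // => /eqP; exact: val_inj.
by rewrite hr (big_nth 0) big_mkord sr.
Qed.

Section Roots.
Variable th : 'I_d -> algC.
Hypothesis th_inj : injective th.
Hypothesis th_poly : map_poly ratr dir_poly = \prod_i ('X - (th i)%:P).

Definition dir_val v (z : algC) : algC := \sum_i (v 0 i)%:~R * z ^+ i.

Lemma dir_rootE (z : algC) : (z ^+ d == \sum_i (c i)%:~R * z ^+ i) = [exists j, z == th j].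
Proof.
have -> : (z ^+ d == \sum_i (c i)%:~R * z ^+ i) = root (map_poly ratr dir_poly) z.
  rewrite /root rmorphB rmorphXn /= map_polyX rmorph_sum hornerD hornerN hornerXn horner_sum.
  rewrite subr_eq0; congr (_ == _); apply: eq_bigr => i _.
  by rewrite /= map_polyZ /= map_polyXn hornerZ hornerXn rmorph_int.
rewrite th_poly /root horner_prod; apply/prodf_eq0/existsP => [[j _]|[j hj]].
  by rewrite hornerXsubC subr_eq0; exists j.
by exists j => //; rewrite hornerXsubC subr_eq0.
Qed.

Lemma dir_th j : th j ^+ d = \sum_i (c i)%:~R * th j ^+ i.
Proof. by apply/eqP; rewrite dir_rootE; apply/existsP; exists j. Qed.

(** The Vandermonde matrix of the distinct roots is invertible and diagonalises the companion
    matrix, hence every polynomial in it. *)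
Lemma dir_detE v : (\det (dir_mulmx v))%:~R = \prod_j dir_val v (th j).
Proof.
pose W := Vandermonde d (\row_j th j).
have W0 : \det W != 0.
  rewrite det_Vandermonde; apply/prodf_neq0 => i _; apply/prodf_neq0 => j ij.
  by rewrite !mxE subr_eq0; apply: contraTneq ij => /th_inj ->; rewrite ltnn.
pose D := diag_mx (\row_j th j).
have CW : map_mx intr dir_mx *m W = W *m D.
  apply/matrixP => i j; rewrite mul_mx_diag mxE !mxE -exprSr.
  have [hi|hi] := ltnP i.+1 d.
    rewrite (bigD1 (Ordinal hi)) //= !mxE hi eqxx mul1r big1 ?addr0 // => k ki.
    rewrite !mxE hi; case: eqP => [h|]; last by rewrite mul0r.
    by case/eqP: ki; apply: val_inj.
  have -> : i.+1 = d by apply/eqP; rewrite eqn_leq hi ltn_ord.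
  by rewrite dir_th; apply: eq_bigr => k _; rewrite !mxE ltnNge hi.
have CWn n : map_mx intr (dir_mx ^+ n) *m W = W *m diag_mx (\row_j th j ^+ n).
  elim: n => [|n ih].
    rewrite expr0 map_mx1 mul1mx (_ : diag_mx _ = 1%:M) ?mulmx1 //.
    by apply/matrixP => i j; rewrite !mxE expr0.
  rewrite exprS map_mxM -mulmxA ih mulmxA CW -mulmxA mulmx_diag; congr (_ *m diag_mx _).
  by apply/rowP => j; rewrite !mxE exprS.
have FW : map_mx intr (dir_mulmx v) *m W = W *m diag_mx (\row_j dir_val v (th j)).
  rewrite /dir_mulmx rmorph_sum /= mulmx_suml.
  transitivity (\sum_i (v 0 i)%:~R *: (W *m diag_mx (\row_j th j ^+ i))).
    by apply: eq_bigr => i _; rewrite map_mxZ -scalemxAl CWn.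
  apply/matrixP => i j; rewrite summxE mul_mx_diag !mxE mulr_sumr.
  by apply: eq_bigr => k _; rewrite mxE mul_mx_diag !mxE mulrCA.
have := congr1 determinant FW; rewrite !det_mulmx det_diag mulrC => /(mulfI W0).
rewrite det_map_mx => ->; apply: eq_bigr => j _; by rewrite mxE.
Qed.

(* The box principle yields v of bounded norm with all the values at J as small
   as we like, against the finiteness of the set of such v.  J will be a real
   root, or a pair of conjugate roots among at least three. *)
Lemma dir_core (e : nat) (a : 'I_e -> 'I_d -> algC) (J : {set 'I_d}) :
  (0 < e)%N -> (e < d)%N -> #|J| = e -> (forall k j, a k j \is Num.real) ->
  (forall j v, j \in J ->
     `|dir_val v (th j)| <= \sum_k `|\sum_i (v 0 i)%:~R * a k i|) -> False.
Proof.
move=> e0 ed cJ ra hJ.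
pose boundn (I : finType) (q : I -> algC) : nat := (\sum_i (Num.truncn `|q i|).+1)%N.
have boundnP (I : finType) (q : I -> algC) i : `|q i| <= (boundn I q)%:R.
  have /andP[_ h] := truncn_itv (normr_ge0 (q i)); apply: le_trans (ltW h) _.
  by rewrite ler_nat /boundn (bigD1 i) //= leq_addr.
pose K := boundn _ (fun k => \sum_j `|a k j|).
have aK k : \sum_j `|a k j| <= K%:R.
  apply: le_trans (boundnP _ _ k); rewrite ger0_norm // sumr_ge0 // => j _; exact: normr_ge0.
pose Kt := boundn _ (fun j => \sum_(i < d) `|th j| ^+ i).
pose K2 := (e * (2 * K + 1) + Kt)%N.
have box := box_principle (ltn0Sn d') ra aK.
have key (T : nat) : (0 < T)%N -> exists2 v, v != 0 /\ (dir_nrm v <= K2 ^ d)%N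
    & forall j, j \in J -> `|dir_val v (th j)| <= K2%:R / T%:R.
  move=> T0; have [w [[j0 wj0] wT wL]] := box T T0.
  have Tn0 n : 0 < (T ^ n)%:R :> algC by rewrite ltr0n expn_gt0 T0.
  pose v : 'rV[int]_d := \row_j w j.
  have v0 : v != 0 by apply: contra wj0 => /eqP/rowP/(_ j0); rewrite !mxE => ->.
  have vJ j : j \in J -> `|dir_val v (th j)| <= K2%:R * ((T ^ e)%:R / (T ^ d)%:R).
    move=> jJ; apply: le_trans (hJ j v jJ) _.
    apply: (@le_trans _ _ (\sum_(k < e) (2 * K + 1)%:R * ((T ^ e)%:R / (T ^ d)%:R))).
      apply: ler_sum => k _; under eq_bigr do rewrite mxE; exact: wL.
    rewrite sumr_const card_ord -[_ *+ e]mulr_natl mulrA -natrM ler_wpM2r //.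
      by rewrite divr_ge0 // ltW.
    by rewrite ler_nat leq_addr.
  have vN j : `|dir_val v (th j)| <= K2%:R * (T ^ e)%:R.
    apply: le_trans (ler_norm_sum _ _ _) _.
    apply: (@le_trans _ _ (\sum_(i < d) (T ^ e)%:R * `|th j| ^+ i)).
      apply: ler_sum => i _; rewrite normrM normrX mxE ler_wpM2r ?exprn_ge0 //.
      by rewrite -intr_norm; exact: wT.
    rewrite -mulr_sumr mulrC; apply: ler_wpM2r; first exact: ltW.
    have := boundnP _ (fun j => \sum_(i < d) `|th j| ^+ i) j.
    rewrite ger0_norm; last by apply: sumr_ge0 => i _; rewrite exprn_ge0.
    by move=> h; apply: le_trans h _; rewrite ler_nat leq_addl.
  exists v; last first.
    move=> j jJ; apply: le_trans (vJ j jJ) _; rewrite ler_wpM2l //.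
    rewrite ler_pdivrMr // mulrC ler_pdivlMr ?ltr0n //.
    by rewrite -natrM ler_nat -expnSr leq_pexp2l.
  (* The [e] factors at [J] contribute (T^e / T^d)^e and the other [d - e] factors (T^e)^(d - e), up
     to constants. The powers of [T] cancel, so the bound on the norm does not depend on [T]. *)
  split=> //; rewrite -(ler_nat algC) /dir_nrm pmulrn abszE intr_norm dir_detE normr_prod.
  rewrite (bigID (mem J)) /=.
  apply: (@le_trans _ _ ((\prod_(i in J) (K2%:R * ((T ^ e)%:R / (T ^ d)%:R))) *
    (\prod_(i | i \notin J) (K2%:R * (T ^ e)%:R)))).
    apply: ler_pM; rewrite ?prodr_ge0 //.
      by apply: ler_prod => j jJ; rewrite normr_ge0 vJ.
    by apply: ler_prod => j jJ; rewrite normr_ge0 vN.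
  rewrite !prodr_const cJ.
  have -> : #|[pred i | i \notin J]| = (d - e)%N.
    by rewrite -[in RHS](card_ord d) -cJ -(cardC (mem J)) addKn.
  rewrite !exprMn mulrACA -exprD subnKC ?(ltnW ed) // (natrX _ K2) -[leRHS]mulr1.
  rewrite ler_wpM2l ?exprn_ge0 // mulrAC -exprD subnKC ?(ltnW ed) // exprVn.
  by rewrite -!natrX -!expnM (mulnC d) divff // gt_eqF.
have [j0 j0J] : exists j0, j0 \in J by apply/card_gt0P; rewrite cJ.
have /finite_seqP [s hs] := dir_nrm_finite (K2 ^ d).
(* [T] is chosen above [K2 / |dir_val v (th j0)|] for every [v] in the finite list, so no member of
   the list can have a value at [j0] as small as [key] promises. *)
have [v [v0 vM] hv] := key (\sum_(v <- s) (Num.truncn (K2%:R / `|dir_val v (th j0)|)).+1).+1 (ltn0Sn _).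
have vs : v \in s by have : [set` s] v by rewrite -hs.
have nz : dir_val v (th j0) != 0.
  have : (\det (dir_mulmx v))%:~R != 0 :> algC by rewrite intr_eq0 dir_det_neq0.
  by rewrite dir_detE => /prodf_neq0/(_ j0 isT).
have nz' : 0 < `|dir_val v (th j0)| by rewrite normr_gt0.
have := hv j0 j0J; rewrite ler_pdivlMr ?ltr0n // mulrC -ler_pdivlMr //.
have /andP[_ h] : _ := truncn_itv (divr_ge0 (ler0n algC K2) (ltW nz')).
move/le_lt_trans/(_ h); rewrite ltr_nat ltnNge => /negP; apply.
by rewrite (big_rem v vs) /= -addSn leqW // leq_addr.
Qed.

Lemma dir_core_real j : (1 < d)%N -> th j \is Num.real -> False.
Proof.
move=> d1 rj; apply: (@dir_core 1 (fun _ i => th j ^+ i) [set j]) => //.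
- by rewrite cards1.
- by move=> _ i; rewrite rpredX.
- by move=> k v /set1P ->; rewrite big_ord1.
Qed.

Lemma dir_val_conj v z : dir_val v (z^*) = (dir_val v z)^*.
Proof.
by rewrite rmorph_sum; apply: eq_bigr => i _; rewrite rmorphM rmorph_int rmorphXn.
Qed.

Lemma dir_core_degree : (d <= 2)%N.
Proof.
rewrite leqNgt; apply/negP => d2.
have [r0|nr0] := boolP (th 0 \is Num.real); first by apply: dir_core_real r0; apply: ltnW.
have : [exists j, (th 0)^* == th j].
  rewrite -dir_rootE -rmorphXn /= dir_th rmorph_sum; apply/eqP; apply: eq_bigr => i _.
  by rewrite rmorphM rmorph_int rmorphXn.
case/existsP => j1 /eqP hj1.
pose a (k : 'I_2) (i : 'I_d) : algC := if k == 0 then 'Re (th 0 ^+ i) else 'Im (th 0 ^+ i).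
apply: (@dir_core 2 a [set 0; j1]) => //.
- rewrite cards2; case: eqP => // j10; case/negP: nr0.
  by rewrite CrealE hj1 -j10.
- by move=> k i; rewrite /a; case: ifP => _; rewrite ?Creal_Re ?Creal_Im.
have h0 v : `|dir_val v (th 0)| <= \sum_(k < 2) `|\sum_i (v 0 i)%:~R * a k i|.
  rewrite big_ord_recl big_ord1 /a /=.
  have -> : dir_val v (th 0) = \sum_i (v 0 i)%:~R * 'Re (th 0 ^+ i) +
      'i * \sum_i (v 0 i)%:~R * 'Im (th 0 ^+ i).
    rewrite mulr_sumr -big_split; apply: eq_bigr => i _ /=.
    by rewrite mulrCA -mulrDr -algCrect.
  by apply: le_trans (ler_normD _ _) _; rewrite normrM normCi mul1r.
move=> j v /set2P [->|->] //.
by rewrite -hj1 dir_val_conj norm_conjC.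
Qed.

End Roots.

Lemma dir_degree : (d <= 2)%N.
Proof. by have [th [th_inj th_poly]] := dir_roots; exact: dir_core_degree th_inj th_poly. Qed.

Lemma dir_not_real (z : algC) : (1 < d)%N -> z \is Num.real ->
  z ^+ d != \sum_i (c i)%:~R * z ^+ i.
Proof.
have [th [th_inj th_poly]] := dir_roots => d1 rz; apply/negP.
rewrite (dir_rootE th_poly) => /existsP [j /eqP zj].
by apply: (dir_core_real th_inj th_poly d1 (j := j)); rewrite -zj.
Qed.

End Dirichlet.

(* Every element generates Q or an imaginary quadratic field. *)
Definition imquad (A : falgType rat) := forall x : A, exists t n : rat,
  x * x = t *: x - n *: 1 /\ (t ^+ 2 < 4 * n \/ x = (t / 2) *: 1).

Lemma minimal_power (A : falgType rat) (x : A) : exists (d : nat) (c : 'I_d.+1 -> rat),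
  (forall b : 'I_d.+1 -> rat, \sum_i b i *: x ^+ i = 0 -> forall i, b i = 0) /\
  x ^+ d.+1 = \sum_i c i *: x ^+ i.
Proof.
pose X n := [tuple of mkseq (fun i => x ^+ i) n].
have exn : exists n, ~~ free (X n).
  exists (\dim {:A}).+1; apply/negP => /eqP h; have := dimvS (subvf <<X (\dim {:A}).+1>>%VS).
  by rewrite h size_tuple ltnn.
case: (ex_minnP exn) => n nfr nmin.
have fr m : (m < n)%N -> free (X m).
  by move=> mn; apply/negPn/negP => /nmin; rewrite leqNgt mn.
have xE m (b : 'I_m -> rat) : \sum_i b i *: (X m)`_i = \sum_i b i *: x ^+ i.
  by apply: eq_bigr => i _; rewrite nth_mkseq.
have n1 : (1 < n)%N.
  case: n nfr {nmin fr} => [|[|//]]; first by rewrite /X /= nil_free.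
  have -> : tval (X 1%N) = [:: 1] by rewrite /= /mkseq /= expr0.
  by rewrite seq1_free oner_eq0.
case: n n1 nfr fr {nmin} => [|[|d]] // _ nfr fr; exists d.
have frd : free (X d.+1) by apply: fr.
have Xn : x ^+ d.+1 \in <<X d.+1>>%VS.
  apply: contraNT nfr => nin; have : free (x ^+ d.+1 :: X d.+1) by rewrite free_cons nin.
  apply: etrans; apply: perm_free; rewrite /X /= -/(mkseq _ d.+2) mkseqS perm_rcons.
  exact: perm_refl.
exists (fun i => coord (X d.+1) i (x ^+ d.+1)); split.
  by move=> b; rewrite -xE; move/freeP: frd => /(_ b).
by rewrite [LHS](coord_span Xn) xE.
Qed.

Lemma imquad_of_finite_units (A : falgType rat) (O : zorder A) :
  (forall x : A, x != 0 -> x \is a GRing.unit) -> finite_set (@ring_units O) -> imquad A.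
Proof.
move=> hA hO x; have [d [c [xfree xpow]]] := minimal_power x.
have [k1 [k10 hk1]] := common_denom c; have [k2 [k20 hk2]] := order_scale O x.
(* [k2] brings [x] into [O]. Scaling by [k] multiplies the coefficient [c i] by [k] to the power
   [d.+1 - i], which is positive, so [k1] clears its denominator. *)
pose k := (k1 * k2)%N; have k0 : (k%:R : rat) != 0 by rewrite pnatr_eq0 -lt0n muln_gt0 k10 k20.
pose y := k%:R *: x.
have yX n : y ^+ n = k%:R ^+ n *: x ^+ n by rewrite exprZn.
have yO : y \in O by rewrite /y natrM -scalerA scaler_nat zordMn.
have yfree (b : 'I_d.+1 -> rat) : \sum_i b i *: y ^+ i = 0 -> forall i, b i = 0.
  under eq_bigr do rewrite yX scalerA.
  move/xfree => h i; apply/eqP; have /eqP := h i.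
  by rewrite mulf_eq0 expf_eq0 (negPf k0) andbF orbF.
have cint i : exists m : int, m%:~R = c i * k%:R ^+ (d.+1 - i).
  have /intrP [m hm] := hk1 i; rewrite subSn ?leq_ord // exprS mulrA natrM mulrA hm.
  have : m%:~R * k2%:R * (k1%:R * k2%:R) ^+ (d - i) \is a @Num.int rat.
    by rewrite rpredM ?rpredX ?rpredM ?natr_int ?intr_int.
  by case/intrP => m' ->; exists m'.
pose C i : int := sval (cid (cint i)).
have CE i : (C i)%:~R = c i * k%:R ^+ (d.+1 - i) by rewrite /C; case: cid.
have ypow : y ^+ d.+1 = \sum_i (C i)%:~R *: y ^+ i.
  rewrite yX xpow scaler_sumr; apply: eq_bigr => i _.
  by rewrite CE yX !scalerA -mulrA -exprD subnK 1?mulrC // ltnW.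
have := dir_degree hA hO yO yfree ypow.
have xy : x = k%:R^-1 *: y by rewrite /y scalerA mulVf // scale1r.
case: d c xfree xpow hk1 yfree cint C CE ypow => [|[|//]] c xfree xpow hk1 yfree cint C CE ypow _.
  move: xpow; rewrite big_ord1 expr0 expr1 => xc.
  exists (2 * c 0), (c 0 ^+ 2); split; last by right; rewrite mulrAC divff // mul1r.
  rewrite {1 2 3}xc -scalerAr mulr1 !scalerA -scalerBl; congr (_ *: _); ring.
have nr := dir_not_real hA hO yO yfree ypow.
move: ypow; rewrite !big_ord_recl big_ord0 addr0 expr0 /= expr1 expr2 => ypow.
set c0 := C 0 in ypow nr; set c1 := C (lift 0 0) in ypow nr.
exists (c1%:~R / k%:R), (- c0%:~R / k%:R ^+ 2); split.
  rewrite {1 2 3}xy -scalerAl -scalerAr ypow !scalerDr !scalerA addrC.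
  rewrite !mulNr scaleNr opprK; congr (_ *: _ + _ *: _); field => //.
left; rewrite expr_div_n mulrA ltr_pM2r; last by rewrite invr_gt0 exprn_gt0 // lt_def k0 ler0n.
rewrite ltNge; apply/negP => hd.
(* A nonnegative discriminant would give the quadratic equation of [y] a real root, which
   [dir_not_real] excludes. *)
pose D : algC := ratr (c1%:~R ^+ 2 + 4 * c0%:~R).
have D0 : 0 <= D by rewrite ler0q; move: hd; rewrite mulrN; lra.
pose z : algC := (c1%:~R + sqrtC D) / 2.
have rz : z \is Num.real.
  by rewrite rpredM ?rpredD ?realV ?realz ?realn // ger0_real // sqrtC_ge0.
case/negP: (nr z isT rz); apply/eqP.
rewrite !big_ord_recl big_ord0 addr0 expr0 /= expr1 mulr1 -/c0 -/c1.
have : sqrtC D ^+ 2 = c1%:~R ^+ 2 + 4 * c0%:~R.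
  by rewrite sqrtCK /D !(rmorphD, rmorphM, rmorphXn) /= !(rmorph_int, rmorph_nat, rmorph1).
rewrite /z; move: (sqrtC D) (c1%:~R : algC) (c0%:~R : algC) => s a b hs.
rewrite expr_div_n sqrrD hs.
by field.
Qed.

(** * Trace, conjugation and norm *)

Section ImQuad.
Variables (A : falgType rat) (hq : imquad A).
Implicit Types (x y z : A) (a b r s t : rat).

(** The choice is harmless. For a scalar [x] the quadratic equation alone has many solutions, but
    all have nonnegative discriminant, so the second clause of [imquad] holds and forces the trace
    to be twice the scalar. *)
Definition qtr x : rat := sval (cid (hq x)).
Definition qnm x : rat := sval (cid (svalP (cid (hq x)))).

Lemma trP x : x * x = qtr x *: x - (qnm x)%:A /\
  (qtr x ^+ 2 < 4 * qnm x \/ x = (qtr x / 2)%:A).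
Proof. exact: (svalP (cid (svalP (cid (hq x))))). Qed.

Lemma scalar_inj a b : a%:A = b%:A :> A -> a = b.
Proof.
move=> h; apply/eqP; rewrite -subr_eq0; apply/eqP; have : (a - b)%:A = 0 :> A.
  by rewrite scalerBl h subrr.
by move/eqP; rewrite scaler_eq0 oner_eq0 orbF => /eqP.
Qed.

Lemma mul_scalar a b : a%:A * b%:A = (a * b)%:A :> A.
Proof. by rewrite -scalerAl mul1r scalerA. Qed.

Lemma nm_scalar x : x = (qtr x / 2)%:A -> qnm x = qtr x ^+ 2 / 4.
Proof.
move=> xE; have [h _] := trP x; move: h; rewrite {1 2 4}xE mul_scalar scalerA -scalerBl.
by move/scalar_inj; move: (qtr x) (qnm x) => t n h; have : n = t * (t / 2) - t / 2 * (t / 2);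
  [rewrite h; ring | move=> ->; field].
Qed.

Lemma tr_le_nm x : qtr x ^+ 2 <= 4 * qnm x.
Proof.
have [_ [/ltW //|/nm_scalar ->]] := trP x.
by rewrite mulrCA divff // mulr1.
Qed.

Lemma nm_ge0 x : 0 <= qnm x.
Proof. have := tr_le_nm x; have := sqr_ge0 (qtr x); lra. Qed.

Definition qcj x := (qtr x)%:A - x.

Lemma mul_cj x : x * qcj x = (qnm x)%:A.
Proof.
by have [h _] := trP x; rewrite mulrBr -scalerAr mulr1 h opprB addrC subrK.
Qed.

Lemma mulcj x : qcj x * x = (qnm x)%:A.
Proof.
by have [h _] := trP x; rewrite mulrBl -scalerAl mul1r h opprB addrC subrK.
Qed.

Lemma add_cj x : x + qcj x = (qtr x)%:A.
Proof. by rewrite addrC subrK. Qed.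

Lemma nm_gt0 x : x != 0 -> 0 < qnm x.
Proof.
move=> x0; rewrite lt_def nm_ge0 andbT; have [_ [h|xE]] := trP x.
  have := sqr_ge0 (qtr x); apply: contraTneq => n0; rewrite n0 in h; lra.
rewrite nm_scalar // mulf_neq0 // expf_neq0 //; apply: contraNneq x0 => t0.
by rewrite xE t0 mul0r scale0r.
Qed.

Lemma nm0 : qnm 0 = 0.
Proof. by apply: scalar_inj; rewrite -mul_cj mul0r scale0r. Qed.

Lemma nm_eq0 x : (qnm x == 0) = (x == 0).
Proof.
apply/eqP/eqP => [|->]; last exact: nm0.
by move=> n0; apply/eqP/negPn/negP => /nm_gt0; rewrite n0 ltxx.
Qed.

Lemma imquad_unit x : x != 0 -> x \is a GRing.unit.
Proof.
move=> x0; have n0 : qnm x != 0 by rewrite nm_eq0.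
apply/unitrP; exists ((qnm x)^-1 *: qcj x); split.
  by rewrite -scalerAl mulcj scalerA mulVf // scale1r.
by rewrite -scalerAr mul_cj scalerA mulVf // scale1r.
Qed.

Lemma imquad_mulf_eq0 x y : x * y = 0 -> x = 0 \/ y = 0.
Proof. exact: division_mulf_eq0 imquad_unit _ _. Qed.

(** These are the elements of trace 0, described without the trace. Every element is a scalar plus a
    pure one, uniquely by [pure_shift], so additivity of [qtr] reduces to [pureD]. *)
Definition pure y := exists2 m, 0 <= m & y * y = (- m)%:A.

Lemma pure_scalar s : pure s%:A -> s = 0.
Proof.
move=> [m m0]; rewrite mul_scalar => /scalar_inj h; apply/eqP; rewrite -sqrf_eq0 expr2 h.
have := sqr_ge0 s; rewrite expr2 h => h2; apply/eqP; lra.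
Qed.

Lemma pureZ a y : pure y -> pure (a *: y).
Proof.
move=> [m m0 h]; exists (a ^+ 2 * m); first by rewrite mulr_ge0 ?sqr_ge0.
by rewrite -scalerAl -scalerAr h !scalerA -expr2 mulrN.
Qed.

Lemma sqr_addl a y : (a%:A + y) * (a%:A + y) = (a ^+ 2)%:A + (2 * a) *: y + y * y.
Proof.
rewrite mulrDl !mulrDr mul_scalar -scalerAl -scalerAr mul1r mulr1 addrA.
by rewrite -[X in X + _]addrA -scalerDl -mulr2n -expr2 mulr_natl.
Qed.

Lemma pure_part x : pure (x - (qtr x / 2)%:A).
Proof.
have [h _] := trP x; exists (qnm x - qtr x ^+ 2 / 4).
  by have := tr_le_nm x; rewrite subr_ge0; lra.
rewrite addrC -scaleNr sqr_addl h addrA -addrA -(scaleNr (qnm x)).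
have -> : 2 * - (qtr x / 2) = - qtr x by field.
rewrite (scaleNr (qtr x)) addrA addrNK -scalerDl; congr (_ *: _); by field.
Qed.

Lemma scalar_rel a b y : a != 0 -> a *: y = b%:A -> y = (b / a)%:A.
Proof.
by move=> a0 /(congr1 ( *:%R a^-1)); rewrite !scalerA mulVf // scale1r mulrC.
Qed.

Lemma pure_shift a y : pure y -> pure (a%:A + y) -> a = 0.
Proof.
move=> py py'; have [m m0 hy] := py; have [m' m'0] := py'; rewrite sqr_addl hy => h.
apply/eqP/negPn/negP => a0; have aa0 : 2 * a != 0 by rewrite mulf_neq0.
have yE : (2 * a) *: y = (- m' - a ^+ 2 + m)%:A.
  by rewrite !scalerDl -h !scaleNr addrAC subrK addrAC subrr add0r.
have yS := scalar_rel aa0 yE; set q := _ / _ in yS.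
rewrite yS in py py'; have q0 := pure_scalar py; rewrite q0 -scalerDl addr0 in py'.
by rewrite (pure_scalar py') eqxx in a0.
Qed.

Lemma tr_uniq r y : pure y -> qtr (r%:A + y) = 2 * r.
Proof.
move=> py; have := pure_part (r%:A + y); set t := qtr _.
rewrite addrAC -scalerBl => /(pure_shift py)/eqP; rewrite subr_eq0 => /eqP ->.
by rewrite mulrC divfK.
Qed.

Lemma pure0 : pure 0.
Proof. by exists 0; rewrite // mul0r oppr0 scale0r. Qed.

Lemma tr_scalar a : qtr a%:A = 2 * a.
Proof. by rewrite -[_%:A]addr0 tr_uniq //; exact: pure0. Qed.

Lemma pureD_rel y z r a : pure y -> pure z -> z = r%:A + a *: y -> pure (y + z).
Proof.
move=> py pz zE; have r0 : r = 0 by apply: (pure_shift (pureZ a py)); rewrite -zE.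
by rewrite zE r0 scale0r add0r -{1}(scale1r y) -scalerDl; exact: pureZ.
Qed.

(** The squares of [y + z] and [y - z] add up to a scalar. Replacing them by means of their
    quadratic equations, with traces [t] and [t'], leaves the linear relation [rel] between [y], [z]
    and 1. Either [t = 0], as wanted, or [y] vanishes, or [z] is a scalar plus a multiple of [y]. *)
Lemma pureD y z : pure y -> pure z -> pure (y + z).
Proof.
move=> py pz; have [m m0 hy] := py; have [m' m'0 hz] := pz.
have [hs hs2] := trP (y + z); have [hd _] := trP (y - z).
have E : (y + z) * (y + z) + (y - z) * (y - z) = (- 2 * (m + m'))%:A.
  rewrite !mulrDl !mulrDr !mulrN !mulNr opprK hy hz.
  rewrite addrACA [X in X + _ = _]addrACA [X in _ + X = _]addrACA !subrr addr0 add0r.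
  by rewrite -!scalerDl; congr (_ *: _); ring.
rewrite hs hd in E.
set t := qtr (y + z) in hs hs2 E; set t' := qtr (y - z) in hd E.
have rel : (t + t') *: y + (t - t') *: z = (- 2 * (m + m') + qnm (y + z) + qnm (y - z))%:A.
  rewrite !scalerDl -E [in RHS]addrACA -opprD -[RHS]addrA subrK scalerDr scalerBr.
  by rewrite [RHS]addrACA scaleNr.
have [t0|t0] := eqVneq t 0.
  exists (qnm (y + z)); first exact: nm_ge0.
  by rewrite hs t0 scale0r add0r scaleNr.
set q := _ + qnm (y - z) in rel.
have [tt'|tt'] := eqVneq (t - t') 0.
  have tt'' : t + t' != 0 by move/eqP: tt'; rewrite subr_eq0 => /eqP <-; rewrite -mulr2n mulrn_eq0.
  rewrite tt' scale0r addr0 in rel; have yS := scalar_rel tt'' rel.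
  by have := pz; rewrite {1}yS in py *; rewrite yS (pure_scalar py) scale0r add0r.
have zE : z = (q / (t - t'))%:A + (- (t + t') / (t - t')) *: y.
  have : (t - t') *: z = q%:A - (t + t') *: y by rewrite -rel addrAC subrr add0r.
  move/(congr1 ( *:%R (t - t')^-1)); rewrite scalerA mulVf // scale1r => ->.
  by rewrite scalerBr !scalerA mulNr scaleNr ![(t - t')^-1 * _]mulrC.
exact: pureD_rel py pz zE.
Qed.

Lemma trD x y : qtr (x + y) = qtr x + qtr y.
Proof.
have -> : x + y = (qtr x / 2 + qtr y / 2)%:A + ((x - (qtr x / 2)%:A) + (y - (qtr y / 2)%:A)).
  by rewrite [in RHS]addrACA -opprD -scalerDl [RHS]addrC subrK.
by rewrite tr_uniq; [rewrite -mulrDl mulrC divfK|apply: pureD; exact: pure_part].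
Qed.

Lemma trZ a x : qtr (a *: x) = a * qtr x.
Proof.
have -> : a *: x = (a * (qtr x / 2))%:A + a *: (x - (qtr x / 2)%:A).
  by rewrite scalerBr scalerA [RHS]addrC subrK.
by rewrite tr_uniq; [by field|apply: pureZ; exact: pure_part].
Qed.

Lemma trN x : qtr (- x) = - qtr x.
Proof. by rewrite -scaleN1r trZ mulN1r. Qed.

Lemma trB x y : qtr (x - y) = qtr x - qtr y.
Proof. by rewrite trD trN. Qed.

Lemma tr1 : qtr 1 = 2. Proof. by rewrite -(scale1r 1) tr_scalar mulr1. Qed.

Lemma cjD x y : qcj (x + y) = qcj x + qcj y.
Proof. by rewrite /qcj trD scalerDl opprD addrACA. Qed.

Lemma cjZ a x : qcj (a *: x) = a *: qcj x.
Proof. by rewrite /qcj trZ scalerBr scalerA. Qed.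

Lemma cjN x : qcj (- x) = - qcj x.
Proof. by rewrite -scaleN1r cjZ scaleN1r. Qed.

Lemma cjB x y : qcj (x - y) = qcj x - qcj y.
Proof. by rewrite cjD cjN. Qed.

Lemma cj_scalar a : qcj a%:A = a%:A.
Proof. by rewrite /qcj tr_scalar -scalerBl mulr_natl mulr2n addrK. Qed.

Lemma tr_cj x : qtr (qcj x) = qtr x.
Proof. by rewrite /qcj trB tr_scalar mulr_natl mulr2n addrK. Qed.

Lemma cjK : involutive qcj.
Proof. by move=> x; rewrite {1}/qcj tr_cj opprB addrC subrK. Qed.

Lemma cj1 : qcj 1 = 1. Proof. by rewrite -(scale1r 1) cj_scalar. Qed.

Lemma nm_cj x : qnm (qcj x) = qnm x.
Proof. by apply: scalar_inj; rewrite -mul_cj cjK mulcj. Qed.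

Lemma nmZ a x : qnm (a *: x) = a ^+ 2 * qnm x.
Proof.
by apply: scalar_inj; rewrite -mul_cj cjZ -scalerAl -scalerAr mul_cj !scalerA expr2.
Qed.

Lemma nmN x : qnm (- x) = qnm x.
Proof. by rewrite -scaleN1r nmZ sqrrN expr1n mul1r. Qed.

Lemma nm1 : qnm 1 = 1.
Proof. by apply: scalar_inj; rewrite -mul_cj cj1 mulr1 scale1r. Qed.

Lemma nmD_cj x y : x * qcj y + y * qcj x = (qnm (x + y) - qnm x - qnm y)%:A.
Proof.
rewrite !scalerBl -!mul_cj cjD; move: (qcj x) (qcj y) => u v.
by rewrite mulrDl !mulrDr [x * u + _]addrC addrACA -[RHS]addrA -opprD addrK.
Qed.

(* z = x * cj y and y * cj x have a scalar sum q and a scalar product, so z is a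
   root of X^2 - q X + nm x nm y: either q = tr z, or z is a scalar. *)
Lemma cj_mul_cj x y : qcj (x * qcj y) = y * qcj x.
Proof.
set z := x * qcj y.
have [q zq] : exists q, z + y * qcj x = q%:A by eexists; exact: nmD_cj.
have z'E : y * qcj x = q%:A - z by rewrite -zq addrAC subrr add0r.
have [y0|y0] := eqVneq y 0.
  by rewrite /z y0 mul0r -(scale0r 1) cj_scalar scale0r mulr0 -(scale0r 1) cj_scalar.
have zz : z * (y * qcj x) = (qnm x * qnm y)%:A.
  rewrite /z mulrA -(mulrA x) mulcj -scalerAr mulr1 -scalerAl mul_cj scalerA mulrC //.
have zsq : z * z = q *: z - (qnm x * qnm y)%:A.
  by rewrite -zz z'E mulrBr -scalerAr mulr1 opprB addrC subrK.
rewrite z'E; congr (_ - _).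
have [h _] := trP z.
have [tq|tq] := eqVneq (qtr z) q; first by rewrite tq.
have zS : z = ((qnm z - qnm x * qnm y) / (qtr z - q))%:A.
  apply: scalar_rel; first by rewrite subr_eq0.
  rewrite !scalerBl; move: zsq; rewrite h => /(canRL (subrK _)) ->.
  by rewrite addrAC [q *: z - _]addrC addrK addrC.
set s := _ / _ in zS.
have xE : x = (s / qnm y) *: y.
  have : z * y = s *: y by rewrite zS -scalerAl mul1r.
  rewrite /z -mulrA mulcj -scalerAr mulr1 => /(congr1 ( *:%R (qnm y)^-1)).
  by rewrite !scalerA mulVf ?nm_eq0 // scale1r mulrC.
have : y * qcj x = z.
  by rewrite /z xE cjZ -scalerAr -scalerAl.
move: zq => /[swap] ->; rewrite zS -scalerDl => /scalar_inj <-.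
by rewrite tr_scalar mulr_natl mulr2n.
Qed.

Lemma cjM x y : qcj (x * y) = qcj y * qcj x.
Proof. by rewrite -{1}(cjK y) cj_mul_cj. Qed.

Lemma nmM x y : qnm (x * y) = qnm x * qnm y.
Proof.
apply: scalar_inj; rewrite -mul_cj cjM mulrA -(mulrA x) mul_cj -scalerAr mulr1.
by rewrite -scalerAl mul_cj scalerA mulrC.
Qed.

Lemma nmX x n : qnm (x ^+ n) = qnm x ^+ n.
Proof. by elim: n => [|n ih]; rewrite ?expr0 ?nm1 // !exprS nmM ih. Qed.

Lemma tr_nm1D x : qtr x = qnm (1 + x) - 1 - qnm x.
Proof.
apply: scalar_inj; rewrite -add_cj addrC; have := nmD_cj 1 x.
by rewrite cj1 mul1r mulr1 nm1.
Qed.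

Definition qbil x y := qtr (x * qcj y).

Lemma bilC x y : qbil x y = qbil y x.
Proof. by rewrite /qbil -tr_cj cj_mul_cj. Qed.

Lemma bilDl x y z : qbil (x + y) z = qbil x z + qbil y z.
Proof. by rewrite /qbil mulrDl trD. Qed.
Lemma bilZl a x z : qbil (a *: x) z = a * qbil x z.
Proof. by rewrite /qbil -scalerAl trZ. Qed.
Lemma bilBl x y z : qbil (x - y) z = qbil x z - qbil y z.
Proof. by rewrite /qbil mulrBl trB. Qed.
Lemma bilZr a x z : qbil x (a *: z) = a * qbil x z.
Proof. by rewrite bilC bilZl bilC. Qed.
Lemma bilDr x y z : qbil x (y + z) = qbil x y + qbil x z.
Proof. by rewrite bilC bilDl !(bilC x). Qed.
Lemma bilNl x z : qbil (- x) z = - qbil x z.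
Proof. by rewrite -scaleN1r bilZl mulN1r. Qed.
Lemma bilxx x : qbil x x = 2 * qnm x.
Proof. by rewrite /qbil mul_cj tr_scalar. Qed.

Lemma nmD x y : qnm (x + y) = qnm x + qnm y + qbil x y.
Proof.
apply: scalar_inj; have := nmD_cj x y; rewrite -(cj_mul_cj x y) add_cj.
by move/scalar_inj; rewrite -/(qbil x y) => ->; congr (_ *: _); ring.
Qed.

Lemma bil_anti x y : x * qcj y + y * qcj x = (qbil x y)%:A.
Proof. by rewrite -(cj_mul_cj x y) add_cj. Qed.

End ImQuad.

(** * Lattices and rounding *)

Section ZSpan.
Variable V : zmodType.
Implicit Types (B C : seq V) (x y : V).

Lemma zspan0 B : zspan B 0.
Proof. by exists (fun _ => 0); rewrite big1. Qed.

Lemma zspanD B x y : zspan B x -> zspan B y -> zspan B (x + y).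
Proof.
move=> [c ->] [c' ->]; exists (fun i => c i + c' i).
by rewrite -big_split; apply: eq_bigr => i _; rewrite mulrzDr.
Qed.

Lemma zspanMz B x n : zspan B x -> zspan B (x *~ n).
Proof.
move=> [c ->]; exists (fun i => c i * n).
by rewrite mulrz_suml; apply: eq_bigr => i _; rewrite mulrzA.
Qed.

Lemma zspanN B x : zspan B x -> zspan B (- x).
Proof. by move/(zspanMz (-1)); rewrite mulrN1z. Qed.

Lemma zspanB B x y : zspan B x -> zspan B y -> zspan B (x - y).
Proof. by move=> ? ?; apply: zspanD => //; apply: zspanN. Qed.

Lemma zspan_mem B x : x \in B -> zspan B x.
Proof.
move=> xB; have hi : (index x B < size B)%N by rewrite index_mem.
exists (fun i => (i == Ordinal hi)%:R); rewrite (bigD1 (Ordinal hi)) //= eqxx nth_index //.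
by rewrite mulr1z big1 ?addr0 // => i /negPf ->; rewrite mulr0z.
Qed.

Lemma zspan_sub (P : V -> Prop) B x : P 0 -> (forall y z, P y -> P z -> P (y - z)) ->
  (forall b, b \in B -> P b) -> zspan B x -> P x.
Proof.
move=> P0 PB hB [c ->]; have PN y : P y -> P (- y) by move/(PB _ _ P0); rewrite sub0r.
have PD y z : P y -> P z -> P (y + z) by move=> Py /PN; rewrite -{2}(opprK z); exact: PB.
apply: (big_ind P) => // i _; have Pn n : P (B`_i *+ n).
  by elim: n => [|n ih]; rewrite ?mulr0n // mulrS; apply: PD => //; apply/hB/mem_nth.
by case: (c i) => n; rewrite ?NegzE ?mulrNz -?pmulrn //; apply: PN.
Qed.

Lemma zspan_trans B C x : (forall b, b \in B -> zspan C b) -> zspan B x -> zspan C x.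
Proof. by apply: zspan_sub; [exact: zspan0|exact: zspanB]. Qed.

Lemma zspan_subset B C x : {subset B <= C} -> zspan B x -> zspan C x.
Proof. by move=> BC; apply: zspan_trans => b /BC; exact: zspan_mem. Qed.

End ZSpan.

Section ZSpanVect.
Variable V : vectType rat.
Implicit Types (B : seq V) (x : V).

Lemma zspan_span B x : zspan B x -> x \in <<B>>%VS.
Proof.
apply: (zspan_sub (P := fun x => x \in <<B>>%VS)); [exact: mem0v|exact: memvB|].
by move=> b; exact: memv_span.
Qed.

Lemma free_zfree B : free B -> zfree B.
Proof.
move=> /(@freeP _ _ _ (in_tuple B)) fB c hc i.
have h : \sum_(i < size B) (c i)%:~R *: (in_tuple B)`_i = 0.
  by rewrite -[RHS]hc; apply: eq_bigr => j _; rewrite scaler_int.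
by have /eqP := fB _ h i; rewrite intr_eq0 => /eqP.
Qed.

Lemma zfree_free B : zfree B -> free B.
Proof.
move=> fB; apply/(@freeP _ _ _ (in_tuple B)) => q hq i.
have [k [k0 hk]] := common_denom q.
pose c j : int := sval (cid (elimT intrP (hk j))).
have cE j : q j * k%:R = (c j)%:~R by rewrite /c; case: cid.
have h : \sum_(i < size B) B`_i *~ c i = 0.
  transitivity (k%:R *: \sum_(i < size B) q i *: (in_tuple B)`_i); last by rewrite hq scaler0.
  by rewrite scaler_sumr; apply: eq_bigr => j _; rewrite scalerA mulrC cE scaler_int.
have /eqP := cE i; rewrite (fB c h i) mulf_eq0 pnatr_eq0 -(negbK (k == 0)%N) -lt0n k0 orbF.
by move/eqP.
Qed.

End ZSpanVect.

(* Powers of an element of a finitely generated ring have bounded denominators. *)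
Lemma rat_pow_int (q : rat) (D : nat) : (0 < D)%N ->
  (forall k, q ^+ k * D%:R \is a Num.int) -> q \is a Num.int.
Proof.
move=> D0 h; pose b := `|denq q|%N; pose a := `|numq q|%N.
have b0 : (0 < b)%N by rewrite absz_gt0 denq_neq0.
have dv k : (b ^ k %| D)%N.
  have cop : coprime (b ^ k) (a ^ k) by rewrite coprimeXl // coprimeXr // coprime_sym coprime_num_den.
  rewrite -(Gauss_dvdl _ cop); have /intrP [m hm] := h k.
  have : (numq q)%:~R ^+ k * D%:R = m%:~R * (denq q)%:~R ^+ k :> rat.
    by rewrite -hm numqE exprMn mulrAC.
  have intE (a' b' : int) : a'%:~R ^+ k * D%:R = m%:~R * b'%:~R ^+ k :> rat ->
      a' ^+ k * D%:Z = m * b' ^+ k.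
    move=> e; apply/eqP; rewrite -(eqr_int rat) !intrM; apply/eqP.
    by rewrite [in LHS]rmorphXn [in RHS]rmorphXn -e.
  move/intE/(congr1 absz); rewrite !abszM !abszX absz_nat -/a -/b => e.
  by rewrite mulnC e dvdn_mull.
have : (b ^ D <= D)%N by apply: dvdn_leq.
have [b1|b1|b1 _] := ltngtP 1%N b; first by rewrite leqNgt ltn_expl.
  by rewrite ltnNge b0 in b1.
by rewrite Qint_def -absz_denq -/b -b1.
Qed.

Section ImQuadLattice.
Variables (A : falgType rat) (hq : imquad A).
Local Notation nm := (qnm hq).
Local Notation bil := (qbil hq).
Implicit Types (x y z u v w : A) (us L : seq A).

Lemma round_rat (c : rat) : exists (m : int) (r : rat), [/\ c = m%:~R + r, 0 <= r & r < 1].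
Proof.
have /andP[h1 h2] := floor_itv c; exists (Num.floor c), (c - (Num.floor c)%:~R).
rewrite intrD in h2; split; [by rewrite addrC subrK|by rewrite subr_ge0|by rewrite ltrBlDl].
Qed.

(* The average of the norms at the two neighbouring integers, weighted by the
   distances to the opposite one, is nm z + r (1 - r). *)
Lemma round_line z u c : nm u = 1 -> exists m : int, nm (z + c *: u - u *~ m) <= nm z + 1 / 4.
Proof.
move=> nu; have [m [r [-> r0 r1]]] := round_rat c.
have E k : nm (z + (m%:~R + r) *: u - u *~ (m + k)) =
    nm z + (r - k%:~R) ^+ 2 + (r - k%:~R) * bil z u.
  have -> : z + (m%:~R + r) *: u - u *~ (m + k) = z + (r - k%:~R) *: u.
    by rewrite -scaler_int -addrA -scalerBl; congr (_ + _ *: _); rewrite intrD; ring.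
  by rewrite nmD nmZ nu mulr1 bilZr.
have [h|h] := lerP (r ^+ 2 + r * bil z u) (1 / 4).
  by exists (m + 0); rewrite E subr0 -addrA lerD2l.
exists (m + 1); rewrite E -addrA lerD2l mulr1z leNgt; apply/negP => h'.
set b := bil z u in h h'.
have r1' : 0 < 1 - r by rewrite subr_gt0.
have p1 : 0 < (1 - r) * (r ^+ 2 + r * b - 1 / 4) by rewrite mulr_gt0 // subr_gt0.
have p2 : 0 <= r * ((r - 1) ^+ 2 + (r - 1) * b - 1 / 4) by rewrite mulr_ge0 // subr_ge0 ltW.
have : (1 - r) * (r ^+ 2 + r * b - 1 / 4) + r * ((r - 1) ^+ 2 + (r - 1) * b - 1 / 4) =
    - (r - 1 / 2) ^+ 2 by field.
have := sqr_ge0 (r - 1 / 2); lra.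
Qed.

Lemma round_span us z x : (forall u, u \in us -> nm u = 1) -> x \in <<us>>%VS ->
  exists2 t, zspan us t & nm (z + x - t) <= nm z + (size us)%:R / 4.
Proof.
elim: us x => [|u us ih] x hus.
  rewrite span_nil memv0 => /eqP ->; exists 0; first exact: zspan0.
  by rewrite addr0 subr0 mul0r addr0.
rewrite span_cons => /memv_addP [x1 /vlineP [c ->] [x2 x2us ->]].
have [|t ht hn] := ih x2 _ x2us.
  by move=> v vus; apply: hus; rewrite inE vus orbT.
have [m hm] := round_line (z + x2 - t) c (hus u (mem_head _ _)).
exists (t + u *~ m).
  apply: zspanD; last by apply/zspanMz/zspan_mem/mem_head.
  by apply: zspan_subset ht => v; rewrite inE => ->; rewrite orbT.
have -> : z + (c *: u + x2) - (t + u *~ m) = z + x2 - t + c *: u - u *~ m.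
  by rewrite opprD !addrA [z + c *: u + x2]addrAC [_ + c *: u - t]addrAC.
apply: le_trans hm _.
by have -> : (size (u :: us))%:R = (size us)%:R + 1 :> rat; [rewrite /= natr1|lra].
Qed.

(** Weight the four lattice points around the target bilinearly: the cross terms cancel and the mean
    norm is [r * (1 - r) + s * (1 - s)], at most 1/2. If no corner is below 1/2, then [r] and [s]
    are both 1/2; there the corner norms are 1/2 plus or minus a quarter of [bil u v], so one of
    them is smaller after all. *)
Lemma round_plane u v c d : nm u = 1 -> nm v = 1 -> bil u v != 0 ->
  exists2 t, zspan [:: u; v] t & nm (c *: u + d *: v - t) < 2 / 4.
Proof.
move=> nu nv b0; have [m [r [-> r0 r1]]] := round_rat c; have [n [s [-> s0 s1]]] := round_rat d.
have E k l : nm ((m%:~R + r) *: u + (n%:~R + s) *: v - (u *~ (m + k) + v *~ (n + l))) =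
    (r - k%:~R) ^+ 2 + (s - l%:~R) ^+ 2 + (r - k%:~R) * (s - l%:~R) * bil u v.
  have -> : (m%:~R + r) *: u + (n%:~R + s) *: v - (u *~ (m + k) + v *~ (n + l)) =
      (r - k%:~R) *: u + (s - l%:~R) *: v.
    by rewrite opprD addrACA -!scaler_int -!scalerBl; congr (_ *: _ + _ *: _); rewrite intrD; ring.
  by rewrite nmD !nmZ nu nv !mulr1 bilZr bilZl; ring.
have S k l : zspan [:: u; v] (u *~ (m + k) + v *~ (n + l)).
  by apply: zspanD; apply/zspanMz/zspan_mem; rewrite !inE eqxx ?orbT.
set b := bil u v in b0 E.
have [h1|h1] := ltrP (r ^+ 2 + s ^+ 2 + r * s * b) (2 / 4).
  by exists (u *~ (m + 0) + v *~ (n + 0)) => //; rewrite E !subr0.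
have [h2|h2] := ltrP ((r - 1) ^+ 2 + s ^+ 2 + (r - 1) * s * b) (2 / 4).
  by exists (u *~ (m + 1) + v *~ (n + 0)) => //; rewrite E !subr0.
have [h3|h3] := ltrP (r ^+ 2 + (s - 1) ^+ 2 + r * (s - 1) * b) (2 / 4).
  by exists (u *~ (m + 0) + v *~ (n + 1)) => //; rewrite E !subr0.
exists (u *~ (m + 1) + v *~ (n + 1)) => //; rewrite E !mulr1z ltNge; apply/negP => h4.
have rs0 : 0 <= r * s by exact: mulr_ge0.
have rs1 : 0 <= (1 - r) * (1 - s) by apply: mulr_ge0; rewrite subr_ge0 ltW.
have rs2 : 0 <= r * (1 - s) by apply: mulr_ge0; rewrite // subr_ge0 ltW.
have rs3 : 0 <= (1 - r) * s by apply: mulr_ge0; rewrite // subr_ge0 ltW.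
have avg : 2 / 4 <= r * (1 - r) + s * (1 - s).
  have := lerD (lerD (ler_wpM2l rs1 h1) (ler_wpM2l rs2 h2)) (lerD (ler_wpM2l rs3 h3) (ler_wpM2l rs0 h4)).
  have -> : (1 - r) * (1 - s) * (2 / 4) + r * (1 - s) * (2 / 4) +
      ((1 - r) * s * (2 / 4) + r * s * (2 / 4)) = 2 / 4 by field.
  by move=> h; apply: le_trans h _; rewrite le_eqVlt; apply/orP; left; apply/eqP; ring.
have hr : r = 1 / 2.
  apply/eqP; rewrite -subr_eq0 -sqrf_eq0; apply/eqP.
  have := sqr_ge0 (r - 1 / 2); have := sqr_ge0 (s - 1 / 2); nra.
have hs : s = 1 / 2.
  apply/eqP; rewrite -subr_eq0 -sqrf_eq0; apply/eqP.
  have := sqr_ge0 (r - 1 / 2); have := sqr_ge0 (s - 1 / 2); nra.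
rewrite hr hs in h1 h2; case/eqP: b0; lra.
Qed.

End ImQuadLattice.

Section Ortho.
Variables (A : falgType rat) (hq : imquad A).
Local Notation nm := (qnm hq).
Local Notation tr := (qtr hq).
Local Notation cj := (qcj hq).
Local Notation bil := (qbil hq).
Implicit Types (x y z u v w : A) (L us : seq A).

Lemma bil_span L e u : (forall f, f \in L -> bil e f = 0) -> u \in <<L>>%VS -> bil e u = 0.
Proof.
elim: L u => [|f L ih] u h.
  by rewrite span_nil memv0 => /eqP ->; rewrite -(scale0r 1) bilZr mul0r.
rewrite span_cons => /memv_addP [x1 /vlineP [c ->] [x2 x2L ->]].
rewrite bilDr bilZr h ?mem_head // mulr0 add0r ih // => g gL.
by rewrite h // inE gL orbT.
Qed.

Definition ortho L := all (fun e => e != 0) L && pairwise (fun x y => bil x y == 0) L.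

Lemma ortho_cons e L : ortho (e :: L) =
  [&& e != 0, all (fun f => bil e f == 0) L & ortho L].
Proof. by rewrite /ortho /= -!andbA; congr (_ && _); exact: andbCA. Qed.

Lemma ortho_proj L x : ortho L ->
  exists2 v, v \in <<L>>%VS & forall e, e \in L -> bil (x - v) e = 0.
Proof.
elim: L => [|e L ih]; first by exists 0; rewrite ?mem0v.
rewrite ortho_cons => /and3P [e0 /allP eL /ih [v vL hv]].
pose c := bil (x - v) e / (2 * nm e).
exists (v + c *: e).
  rewrite span_cons addrC; apply: memv_add => //; exact: memvZ (memv_line e).
move=> f; rewrite inE opprD addrA bilBl bilZl => /predU1P [->|fL].
  by rewrite bilxx /c divfK ?subrr // mulf_neq0 // nm_eq0.
by rewrite hv // (eqP (eL f fL)) mulr0 subr0.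
Qed.

Lemma ortho_free L : ortho L -> free L.
Proof.
elim: L => [|e L ih]; first by rewrite nil_free.
rewrite ortho_cons free_cons => /and3P [e0 /allP eL /ih ->]; rewrite andbT.
apply: contra e0 => eL'; have := bilxx hq e; rewrite (bil_span _ eL').
  by move/esym/eqP; rewrite mulf_eq0 /= nm_eq0.
by move=> f fL; apply/eqP/eL.
Qed.

Lemma ortho_extend L : ortho L -> (\dim {:A} == size L) \/
  exists2 v, v != 0 & forall e, e \in L -> bil v e = 0.
Proof.
move=> oL; have [/eqP h|] := boolP (<<L>>%VS == fullv).
  by left; rewrite -h; move: (ortho_free oL); rewrite /free.
rewrite eqEsubv subvf /= => /subvPn [x _ xL]; right.
have [v vL hv] := ortho_proj x oL; exists (x - v) => //.
by apply: contra xL; rewrite subr_eq0 => /eqP ->.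
Qed.

Lemma bil_anticomm x y : tr x = 0 -> tr y = 0 -> bil x y = 0 -> y * x = - (x * y).
Proof.
move=> tx ty; have cjE z : tr z = 0 -> cj z = - z by move=> tz; rewrite /qcj tz scale0r sub0r.
have := bil_anti hq x y; rewrite !cjE // !mulrN -opprD => h b0; move: h; rewrite b0 scale0r.
by move/eqP; rewrite oppr_eq0 addrC addr_eq0 => /eqP.
Qed.

Lemma bil1 x : bil x 1 = tr x.
Proof. by rewrite /qbil cj1 mulr1. Qed.

(** Orthogonalising gives 1, [i], [j], [k = i * j]. A further vector [l] orthogonal to these would
    anticommute with [i], [j] and [k], yet anticommuting with [i] and [j] makes it commute with
    their product, so [k * l = 0]. Dimension 3 cannot occur because [k] is orthogonal to 1, [i] and
    [j]. *)
Lemma imquad_dim : [\/ \dim {:A} = 1%N, \dim {:A} = 2%N | \dim {:A} = 4%N].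
Proof.
have cjE z : tr z = 0 -> cj z = - z by move=> tz; rewrite /qcj tz scale0r sub0r.
have o1 : ortho [:: 1] by rewrite ortho_cons oner_eq0.
have [/eqP|[i i0 hi]] := ortho_extend o1; first by constructor 1.
have ti : tr i = 0 by rewrite -bil1 hi ?mem_head.
have o2 : ortho [:: i; 1] by rewrite ortho_cons i0 o1 /= bil1 ti eqxx.
have [/eqP|[j j0 hj]] := ortho_extend o2; first by constructor 2.
have tj : tr j = 0 by rewrite -bil1 hj // !inE eqxx orbT.
have bij : bil i j = 0 by rewrite bilC hj // mem_head.
have ji := bil_anticomm ti tj bij.
pose k := i * j.
have ck : cj k = - k by rewrite /k cjM !cjE // mulrNN ji.
have tk : tr k = 0.
  by apply: (scalar_inj (A := A)); rewrite -add_cj ck subrr scale0r.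
have k0 : k != 0 by rewrite -(nm_eq0 hq) nmM mulf_neq0 ?nm_eq0.
have bki : bil k i = 0.
  rewrite /qbil /k cjE // mulrN trN -mulrA ji mulrN trN opprK mulrA.
  have -> : i * i = - (nm i)%:A by rewrite -(mul_cj hq i) cjE // mulrN opprK.
  by rewrite mulNr -scalerAl mul1r trN trZ tj mulr0 oppr0.
have bkj : bil k j = 0.
  by rewrite /qbil /k -mulrA mul_cj -scalerAr mulr1 trZ ti mulr0.
have o4 : ortho [:: k; j; i; 1].
  by rewrite ortho_cons ortho_cons k0 j0 o2 /= !bil1 tk tj bki bkj (hj i) ?mem_head // !eqxx.
have [/eqP|[l l0 hl]] := ortho_extend o4; first by constructor 3.
have tl : tr l = 0 by rewrite -bil1 hl // !inE eqxx !orbT.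
have il : l * i = - (i * l) by apply: bil_anticomm => //; rewrite bilC hl // !inE eqxx !orbT.
have jl : l * j = - (j * l) by apply: bil_anticomm => //; rewrite bilC hl // !inE eqxx !orbT.
have kl : l * k = - (k * l) by apply: bil_anticomm => //; rewrite bilC hl // !inE eqxx.
have lk : l * k = k * l by rewrite /k mulrA il mulNr -(mulrA i l j) jl mulrN opprK mulrA.
have : (2 : rat) *: (k * l) = 0 by rewrite scaler_nat mulr2n -{1}lk kl addNr.
move/eqP; rewrite scaler_eq0 /= => /eqP/(imquad_mulf_eq0 hq) [k0'|l0'].
  by rewrite k0' eqxx in k0.
by rewrite l0' eqxx in l0.
Qed.

Lemma zspan_bil_denom L : exists D : nat, (0 < D)%N /\
  forall x y, zspan L x -> zspan L y -> bil x y * D%:R \is a Num.int.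
Proof.
have [D [D0 hD]] := common_denom (fun p : 'I_(size L) * 'I_(size L) => bil L`_p.1 L`_p.2).
exists D; split=> // x y hx hy.
apply: (zspan_sub (P := fun x => bil x y * D%:R \is a Num.int)) hx.
- by rewrite -(scale0r 1) bilZl !mul0r.
- by move=> u v hu hv; rewrite bilBl mulrBl rpredB.
move=> b bL; apply: (zspan_sub (P := fun y => bil b y * D%:R \is a Num.int)) hy.
- by rewrite -(scale0r 1) bilZr !mul0r.
- by move=> u v hu hv; rewrite bilC bilBl !(bilC _ _ b) mulrBl rpredB.
move=> b' bL'; have ib : (index b L < size L)%N by rewrite index_mem.
have ib' : (index b' L < size L)%N by rewrite index_mem.
by have := hD (Ordinal ib, Ordinal ib'); rewrite /= !nth_index.
Qed.

Lemma zspan_nm_denom L : exists D : nat, (0 < D)%N /\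
  forall x, zspan L x -> nm x * D%:R \is a Num.int.
Proof.
have [D [D0 hD]] := zspan_bil_denom L; exists (2 * D)%N; rewrite muln_gt0 D0; split=> // x hx.
by rewrite natrM mulrA [nm x * 2]mulrC -bilxx hD.
Qed.

Section InOrder.
Variable O : zorder A.

Lemma order_nm_int x : x \in O -> nm x \is a Num.int.
Proof.
move=> xO; have [B hB] := order_fg O; have [D [D0 hD]] := zspan_nm_denom B.
by apply: (rat_pow_int D0) => k; rewrite -nmX; apply/hD/hB/zordX.
Qed.

Lemma order_tr_int x : x \in O -> tr x \is a Num.int.
Proof.
move=> xO; rewrite tr_nm1D !rpredB ?order_nm_int ?rpred1 //.
by apply: zordD => //; exact: zord1.
Qed.

Lemma order_cj x : x \in O -> cj x \in O.
Proof.
move=> xO; apply: zordB => //; have /intrP [m ->] := order_tr_int xO.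
by apply/zordZz/zord1.
Qed.

Lemma order_nm_lt1 x : x \in O -> nm x < 1 -> x = 0.
Proof.
move=> /order_nm_int /intrP [m hm] h1; apply/eqP; rewrite -(nm_eq0 hq) hm.
have := nm_ge0 hq x; rewrite hm ler0z => m0; rewrite hm ltrz1 in h1.
by rewrite intr_eq0; apply/eqP; lia.
Qed.

Lemma order_nm_le1 x : x \in O -> nm x <= 1 -> x = 0 \/ nm x = 1.
Proof. by move=> xO; rewrite le_eqVlt => /orP [/eqP|/(order_nm_lt1 xO)]; [right|left]. Qed.

Lemma order_unitP x : x \in O -> (exists y, [/\ y \in O, y * x = 1 & x * y = 1]) <-> nm x = 1.
Proof.
move=> xO; split=> [[y [yO yx xy]]|n1]; last first.
  by exists (cj x); rewrite order_cj // mulcj mul_cj n1 scale1r.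
have := congr1 nm xy; rewrite nmM nm1; have /intrP [m hm] := order_nm_int xO.
have /intrP [n hn] := order_nm_int yO; have := nm_ge0 hq x; have := nm_ge0 hq y.
rewrite hm hn !ler0z -intrM => n0 m0 mn.
have {}mn : m * n = 1 by apply/eqP; rewrite -(eqr_int rat) mn.
have := congr1 absz mn; rewrite abszM absz1 => /eqP; rewrite muln_eq1 => /andP [/eqP m1 _].
by rewrite -(gez0_abs m0) m1.
Qed.

Lemma mem_ring_units (x : order_ring O) : (x \in @ring_units O) = (nm (order_val x) == 1).
Proof.
apply/idP/eqP => [|/(order_unitP (order_ring_valK x)) [y [yO yx xy]]]; rewrite in_setE.
  move=> [y [yx xy]]; apply/(order_unitP (order_ring_valK x)); exists (order_val y).
  by split; [exact: order_ring_valK|exact: (congr1 (@order_val _ _) yx)|exact: (congr1 (@order_val _ _) xy)].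
by exists (OrderElt yO); split; apply: val_inj.
Qed.

Definition saturated L := forall x, x \in O -> x \in <<L>>%VS -> zspan L x.

(** Let [f] be the coordinate along [e]. Its values on [O] have a common denominator, so some [w] in
    [O] and in the span attains the least positive value. Euclidean division by that value reduces
    any other element to one with [f = 0], where [L] is already saturated. *)
Lemma saturated_extend L e : free (e :: L) -> saturated L ->
  exists w, [/\ w \in O, free (w :: L), <<w :: L>>%VS = <<e :: L>>%VS & saturated (w :: L)].
Proof.
move=> fr sat; have [f [fe fL]] : exists f : {linear A -> rat^o},
    f e = 1 /\ forall y, y \in <<L>>%VS -> f y = 0.
  pose X := in_tuple (e :: L); exists (coord X ord0); split.
    by have := coord_free ord0 ord0 (fr : free X); rewrite eqxx.
  move=> y yL; rewrite (coord_span (yL : y \in <<in_tuple L>>%VS)) linear_sum big1 // => i _.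
  rewrite linearZ /= (_ : (in_tuple L)`_i = X`_(lift ord0 i)) //.
  by rewrite (coord_free (lift ord0 i) ord0 (fr : free X)) /= scaler0.
have fZ c x : f (c *: x) = c * f x :> rat by rewrite linearZ.
have fB x y : f (x - y) = f x - f y by rewrite linearB.
have f0 : f 0 = 0 by rewrite linear0.
have xE x : x \in <<e :: L>>%VS -> x - f x *: e \in <<L>>%VS.
  rewrite span_cons => /memv_addP [_ /vlineP [c ->] [y yL ->]].
  have -> : f (c *: e + y) = c by rewrite linearD (fL y yL) addr0 fZ fe mulr1.
  by rewrite addrAC subrr add0r.
have [B hB] := order_fg O.
have [D [D0 hD]] := common_denom (fun i : 'I_(size B) => f B`_i).
have fD x : x \in O -> f x * D%:R \is a Num.int.
  move/hB; apply: (zspan_sub (P := fun x => f x * D%:R \is a Num.int)).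
  - by rewrite f0 mul0r.
  - by move=> y z hy hz; rewrite fB mulrBl rpredB.
  move=> b bB; have ib : (index b B < size B)%N by rewrite index_mem.
  by have := hD (Ordinal ib); rewrite /= nth_index.
have Dn0 : D%:R != 0 :> rat by rewrite pnatr_eq0 -lt0n.
pose P (n : nat) := `[< (0 < n)%N /\ exists x, [/\ x \in O, x \in <<e :: L>>%VS & f x * D%:R = n%:R] >].
have exP : exists n, P n.
  have [k [k0 hk]] := order_scale O e; exists (k * D)%N; apply/asboolP; rewrite muln_gt0 k0 D0.
  split=> //; exists (k%:R *: e); split=> //; first by rewrite memvZ // memv_span // mem_head.
  by rewrite fZ fe mulr1 natrM.
have [n /asboolP [n0 [w [wO weL hw]]] nmin] := ex_minnP exP.
have fw0 : f w != 0.
  by apply: contraTneq n0 => fw; move: hw; rewrite fw mul0r => /esym/eqP; rewrite pnatr_eq0 => /eqP ->.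
have wL : w \notin <<L>>%VS by apply: contra fw0 => /fL ->.
have frw : free (w :: L) by rewrite free_cons wL; move: fr; rewrite free_cons => /andP [].
have spw : <<w :: L>>%VS = <<e :: L>>%VS.
  apply/eqP; rewrite eqEdim; apply/andP; split.
    rewrite span_cons subv_add; apply/andP; split; first by rewrite -memvE.
    by rewrite span_cons addvSr.
  by move: frw fr; rewrite /free => /eqP -> /eqP ->.
exists w; split=> // x xO; rewrite spw => xeL.
have /intrP [m hm] := fD x xO.
pose q := (m %/ n)%Z; pose r := (m %% n)%Z; pose x' := x - w *~ q.
have mE : m = q * n + r by exact: divz_eq.
have x'O : x' \in O by apply: zordB => //; apply: zordMz.
have x'eL : x' \in <<e :: L>>%VS by rewrite memvB // -scaler_int memvZ.
have fx' : f x' * D%:R = r%:~R.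
  rewrite /x' -scaler_int fB fZ mulrBl -mulrA hw hm mE intrD intrM addrC addrA.
  by rewrite -pmulrn addNr add0r.
have n0' : (n : int) != 0 by rewrite eqz_nat -lt0n.
have r0 : 0 <= r by apply: modz_ge0.
have rn : r < n by apply: ltz_pmod; rewrite ltz_nat.
have rz : r = 0.
  case: (r =P 0) => // /eqP rn0; have rg0 : (0 < `|r|)%N by rewrite absz_gt0.
  have /nmin : P `|r|%N.
    apply/asboolP; split=> //; exists x'; split=> //.
    by rewrite fx' -{1}(gez0_abs r0) -pmulrn.
  by rewrite -lez_nat (gez0_abs r0) leNgt rn.
have x'L : x' \in <<L>>%VS.
  have := xE _ x'eL; suff -> : f x' = 0 by rewrite scale0r subr0.
  by move/eqP: fx'; rewrite rz mulf_eq0 (negPf Dn0) orbF => /eqP.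
have -> : x = x' + w *~ q by rewrite subrK.
apply: zspanD; last by apply/zspanMz/zspan_mem/mem_head.
by apply: zspan_subset (sat _ x'O x'L) => b; rewrite inE => ->; rewrite orbT.
Qed.

Lemma extend_basis us : free us -> {subset us <= O} -> saturated us ->
  exists ws, [/\ {subset ws <= O}, basis_of fullv (ws ++ us) & saturated (ws ++ us)].
Proof.
move: {2}(\dim {:A} - size us)%N (erefl (\dim {:A} - size us)%N) => n.
elim: n us => [|n ih] us hn fr usO sat.
  exists [::]; split=> //; rewrite basisEfree fr subvf /= -subn_eq0; exact/eqP.
have [h|] := boolP (<<us>>%VS == fullv).
  by move: fr hn; rewrite /free (eqP h) => /eqP <-; rewrite subnn.
rewrite eqEsubv subvf /= => /subvPn [e _ eL].
have fre : free (e :: us) by rewrite free_cons eL.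
have [w [wO frw _ satw]] := saturated_extend fre sat.
have [||v|//|ws [wsO bas satws]] := ih (w :: us).
- by rewrite /= subnS hn.
- exact: frw.
- by rewrite inE => /predU1P [->|/usO].
exists (rcons ws w); rewrite cat_rcons; split=> // v.
by rewrite mem_rcons inE => /predU1P [->|/wsO].
Qed.

Lemma saturated_full L : {subset L <= O} -> basis_of fullv L -> saturated L ->
  forall x, x \in O <-> zspan L x.
Proof.
move=> LO bas sat x; split=> [xO|]; first by apply: sat => //; rewrite (span_basis bas) memvf.
apply: (zspan_sub (P := fun x => x \in O)); [exact: zord0|by move=> y z; exact: zordB|exact: LO].
Qed.

End InOrder.

End Ortho.

(** * A basis of the span of the units *)

Section UnitBasis.
Variables (A : falgType rat) (hq : imquad A).
Local Notation nm := (qnm hq).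
Local Notation bil := (qbil hq).
Implicit Types (x y z u v w : A) (L us : seq A).

Definition nonortho us := exists u v, [/\ u \in us, v \in us, u != v & bil u v != 0].

(** Three units cost at most 3/4. With four, a non-orthogonal pair costs strictly less than 2/4 by
    [round_plane] and the other two at most 2/4. *)
Lemma cover_strict us x : (forall u, u \in us -> nm u = 1) -> (size us <= 4)%N ->
  (size us < 4)%N \/ nonortho us -> x \in <<us>>%VS ->
  exists2 t, zspan us t & nm (x - t) < 1.
Proof.
move=> us1 s4 [s3|[u [v [uus vus uv b0]]]] xus.
  have [t ht hn] := round_span (hq := hq) 0 us1 xus; exists t => //.
  rewrite add0r nm0 add0r in hn; apply: le_lt_trans hn _.
  have : (size us)%:R <= 3 :> rat by rewrite ler_nat.
  lra.
pose r := rem v (rem u us).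
have p1 : perm_eq us (u :: rem u us) by apply: perm_to_rem.
have vr : v \in rem u us.
  by have := perm_mem p1 v; rewrite vus inE eq_sym (negPf uv).
have p2 : perm_eq us [:: u, v & r].
  by apply: perm_trans p1 _; rewrite perm_cons; apply: perm_to_rem.
have sr : size us = (size r).+2 by rewrite (perm_size p2).
move: xus; rewrite (eq_span (perm_mem p2)) !span_cons.
move=> /memv_addP [_ /vlineP [c ->] [_ /memv_addP [_ /vlineP [d ->] [y yr ->]] ->]].
have [t0 ht0 hn0] := round_plane c d (us1 u uus) (us1 v vus) b0.
have r1 w : w \in r -> nm w = 1.
  by move=> wr; apply: us1; rewrite (perm_mem p2) !inE wr !orbT.
have [t1 ht1 hn1] := round_span (hq := hq) (c *: u + d *: v - t0) r1 yr.
exists (t0 + t1).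
  apply: zspanD.
    apply: zspan_subset ht0 => w; rewrite (perm_mem p2) !inE.
    by case/orP => ->; rewrite ?orbT.
  by apply: zspan_subset ht1 => w wr; rewrite (perm_mem p2) !inE wr !orbT.
have -> : c *: u + (d *: v + y) - (t0 + t1) = c *: u + d *: v - t0 + y - t1.
  by rewrite opprD !addrA [_ + y - t0]addrAC.
apply: le_lt_trans hn1 _.
have : (size r)%:R <= 2 :> rat by rewrite ler_nat; rewrite sr in s4.
lra.
Qed.

Variable O : zorder A.

Definition unit_list us := free us /\ forall u, u \in us -> u \in O /\ nm u = 1.

Lemma cover_saturated us : unit_list us -> (size us < 4)%N \/ nonortho us ->
  (size us <= 4)%N -> saturated O us.
Proof.
move=> [fr us1] h s4 x xO xus.
have [t ht hn] := cover_strict (fun u uu => (us1 u uu).2) s4 h xus.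
have tO : t \in O.
  apply: (zspan_sub (P := fun x => x \in O)) ht; [exact: zord0|by move=> y z; exact: zordB|].
  by move=> b /us1 [].
have := order_nm_lt1 (zordB xO tO) hn; move/eqP; rewrite subr_eq0 => /eqP ->.
exact: ht.
Qed.

(* If the chosen units are pairwise orthogonal but do not generate the
   integral points of their span, rounding produces a further unit with a
   non-integral coordinate; exchanging it for the unit at that coordinate
   yields a non-orthogonal list. *)
Lemma unit_list_exchange us : unit_list us -> (size us <= 4)%N -> ~ saturated O us ->
  exists us', [/\ unit_list us', size us' = size us & nonortho us'].
Proof.
move=> ul s4 nsat; have [fr us1] := ul.
have north : ~ nonortho us by move=> h; apply: nsat; apply: cover_saturated => //; right.
have s3 : ~ (size us < 4)%N by move=> h; apply: nsat; apply: cover_saturated => //; left.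
have orth u v : u \in us -> v \in us -> u != v -> bil u v = 0.
  by move=> uu vu uv; apply/eqP/negPn/negP => b0; apply: north; exists u, v.
have [x [xO xus nx]] : exists x, [/\ x \in O, x \in <<us>>%VS & ~ zspan us x].
  apply: contrapT => h; apply: nsat => x xO xus; apply: contrapT => nx.
  by apply: h; exists x.
have [t ht hn] := round_span (hq := hq) 0 (fun u uu => (us1 u uu).2) xus.
rewrite add0r nm0 add0r in hn.
have n1 : nm (x - t) <= 1.
  apply: le_trans hn _; have : (size us)%:R <= 4 :> rat by rewrite ler_nat.
  lra.
have tO : t \in O.
  apply: (zspan_sub (P := fun x => x \in O)) ht; [exact: zord0|by move=> y z; exact: zordB|].
  by move=> b /us1 [].
pose w := x - t; have wO : w \in O by apply: zordB.
have nw : ~ zspan us w by move=> h; apply: nx; rewrite -(subrK t x); apply: zspanD.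
have w1 : nm w = 1.
  by case: (order_nm_le1 wO n1) => // w0; case: nw; rewrite w0; exact: zspan0.
have wus : w \in <<us>>%VS by rewrite memvB // zspan_span.
have bu u : u \in us -> bil u u = 2 by move=> /us1 [_ nu]; rewrite bilxx nu mulr1.
have [u uus hu] : exists2 u, u \in us & ~~ (bil w u / 2 \is a Num.int).
  apply: contrapT => h; apply: nw.
  rewrite (coord_span (wus : w \in <<in_tuple us>>%VS)).
  apply: (big_ind (zspan us)); [exact: zspan0|exact: zspanD|move=> i _].
  have iu : us`_i \in us by apply: mem_nth.
  have ci : coord (in_tuple us) i w = bil w us`_i / 2.
    rewrite {2}(coord_span (wus : w \in <<in_tuple us>>%VS)) (bigD1 i) //= bilDl bilZl bu //.
    rewrite (_ : bil (\sum_(j < _ | _) _) _ = 0) ?addr0 ?mulfK //.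
    apply: (big_ind (fun x => bil x us`_i = 0)).
    - by rewrite -(scale0r 1) bilZl mul0r.
    - by move=> a b ha hb; rewrite bilDl ha hb addr0.
    move=> j ji; rewrite bilZl orth ?mulr0 ?mem_nth //.
    by rewrite nth_uniq ?free_uniq.
  have /intrP [m hm] : bil w us`_i / 2 \is a Num.int.
    by apply/negPn/negP => hn'; apply: h; exists us`_i.
  by rewrite /= ci hm scaler_int; apply/zspanMz/zspan_mem.
have p1 : perm_eq us (u :: rem u us) by apply: perm_to_rem.
pose r := rem u us.
have uu := free_uniq fr.
have ru v : v \in r -> (v \in us) /\ u != v.
  by rewrite mem_rem_uniq // !inE eq_sym => /andP [].
have fru : free (u :: r) by rewrite -(perm_free p1).
have unr : u \notin <<r>>%VS by move: fru; rewrite free_cons => /andP [].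
have frr : free r by move: fru; rewrite free_cons => /andP [].
have [c [y [yr wE]]] : exists c y, y \in <<r>>%VS /\ w = c *: u + y.
  move: wus; rewrite (eq_span (perm_mem p1)) span_cons.
  by move=> /memv_addP [_ /vlineP [c ->] [y yr ->]]; exists c, y.
have buy : bil u y = 0.
  by apply: bil_span yr => v /ru [vus uv]; exact: orth.
have bwu : bil w u / 2 = c by rewrite wE bilDl bilZl bu // [bil y u]bilC buy addr0 mulfK.
rewrite bwu in hu.
have nwE : c ^+ 2 + nm y = 1.
  by rewrite -w1 wE nmD nmZ (us1 u uus).2 mulr1 bilZl buy mulr0 addr0.
have y0 : y != 0.
  apply: contra hu => /eqP y0; move: nwE; rewrite y0 nm0 addr0 => /eqP.
  by rewrite sqrf_eq1 => /orP [] /eqP ->; rewrite ?rpredN rpred1.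
(* [y] is nonzero and lies in the span of [r], so it cannot be orthogonal to all of [r]. As [u] is
   orthogonal to [v], the values of [bil w v] and [bil y v] agree. *)
have [v vr bv] : exists2 v, v \in r & bil y v != 0.
  apply: contrapT => h; case/negP: y0; rewrite -(nm_eq0 hq).
  have := bilxx hq y; rewrite (bil_span _ yr) => [/esym/eqP|v vr].
    by rewrite mulf_eq0.
  by apply/eqP/negPn/negP => bv; apply: h; exists v.
have c0 : c != 0 by apply: contraNneq hu => ->; rewrite rpred0.
have wr : w \notin <<r>>%VS.
  apply: contra unr => wr; have -> : u = c^-1 *: (w - y).
    by rewrite wE addrK scalerA mulVf // scale1r.
  by rewrite memvZ // memvB.
exists (w :: r); split.
- split; first by rewrite free_cons wr.
  by move=> z; rewrite inE => /predU1P [->|/ru [/us1]].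
- by rewrite (perm_size p1).
have [vus uv] := ru v vr.
exists w, v; rewrite !inE eqxx vr orbT; split=> //.
  by apply: contraNneq wr => ->; exact: memv_span.
by rewrite wE bilDl bilZl orth // mulr0 add0r.
Qed.

Lemma unit_list_size us : unit_list us -> (size us <= 4)%N.
Proof.
move=> [fr _]; have := dimvS (subvf <<us>>%VS); move: fr; rewrite /free => /eqP ->.
by case: (imquad_dim hq) => -> /leq_trans; apply.
Qed.

(** A longest independent list of units has every unit in its rational span; saturation turns the
    rational span into the integral one. The exchange keeps the length, so it preserves
    maximality. *)
Theorem unit_basis : exists us, [/\ unit_list us, saturated O us &
  forall u, u \in O -> nm u = 1 -> zspan us u].
Proof.
pose P n := `[< exists us, unit_list us /\ size us = n >].
have exP : exists n, P n by exists 0%N; apply/asboolP; exists [::]; split=> //; split; rewrite ?nil_free.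
have [|n /asboolP [us [ul sn]] nmax] := ex_maxnP exP (m := 4%N).
  by move=> n /asboolP [us [ul <-]]; exact: unit_list_size.
suff [us' [ul' sn' sat']] : exists us', [/\ unit_list us', size us' = n & saturated O us'].
  exists us'; split=> // u uO u1; apply: sat' => //; apply: contraT => nu.
  have : P n.+1.
    apply/asboolP; exists (u :: us'); rewrite /= sn'; split=> //; have [fr us1] := ul'.
    split; first by rewrite free_cons nu.
    by move=> v; rewrite inE => /predU1P [->|/us1].
  by move/nmax; rewrite ltnn.
have s4 := unit_list_size ul.
have [sat|nsat] := pselect (saturated O us); first by exists us.
have [us' [ul' sn' no']] := unit_list_exchange ul s4 nsat.
exists us'; split=> //; first by rewrite sn'.
by apply: cover_saturated => //; [right|rewrite sn'].
Qed.

End UnitBasis.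

(** * Isomorphisms of algebras and of their orders *)

Lemma zspan_map (V W : zmodType) (f : V -> W) (L : seq V) x :
  {morph f : y z / y - z} -> zspan L x -> zspan (map f L) (f x).
Proof.
move=> fB; have f0 : f 0 = 0 by have := fB 0 0; rewrite !subrr.
apply: (zspan_sub (P := fun x => zspan (map f L) (f x))).
- by rewrite f0; exact: zspan0.
- by move=> y z hy hz; rewrite fB; apply: zspanB.
- by move=> b bL; apply/zspan_mem/map_f.
Qed.

Lemma basis_of_scale (B : falgType rat) (P : {pred B}) :
  (forall y : B, exists k : nat, (0 < k)%N /\ k%:R *: y \in P) ->
  exists2 L : seq B, basis_of fullv L & {subset L <= P}.
Proof.
move=> hP; pose X := vbasis {:B}.
pose k (i : 'I_(\dim {:B})) : nat := sval (cid (hP X`_i)).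
have kP i : (0 < k i)%N /\ (k i)%:R *: X`_i \in P by rewrite /k; case: cid.
pose Y := [tuple (k i)%:R *: X`_i | i < \dim {:B}].
exists Y.
  rewrite basisEfree subvf size_tuple leqnn !andbT.
  have /(@freeP _ _ _ X) frX : free X := basis_free (vbasisP _).
  apply/(@freeP _ _ _ Y) => q hq i.
  have h : \sum_(j < \dim {:B}) (q j * (k j)%:R) *: X`_j = 0.
    by rewrite -[RHS]hq; apply: eq_bigr => j _; rewrite -[Y`_j]tnth_nth tnth_mktuple scalerA.
  have /eqP := frX _ h i; rewrite mulf_eq0 pnatr_eq0 => /orP [/eqP //|/eqP k0].
  by have [] := kP i; rewrite k0.
by move=> y /mapP [i _ ->]; have [] := kP i.
Qed.

Definition alg_iso (B A : falgType rat) (g : B -> A) :=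
  [/\ bijective g, {morph g : x y / x - y}, {morph g : x y / x * y}, g 1 = 1
    & forall a, {morph g : x / a *: x}].

Lemma alg_iso_inv (B A : falgType rat) (g : B -> A) : alg_iso g ->
  exists f : A -> B, [/\ cancel f g, cancel g f & alg_iso f].
Proof.
move=> [[f gK fK] gB gM g1 gZ]; exists f; split=> //; split.
- by exists g.
- by move=> x y; apply: (can_inj gK); rewrite gB !fK.
- by move=> x y; apply: (can_inj gK); rewrite gM !fK.
- by apply: (can_inj gK); rewrite fK.
- by move=> a x; apply: (can_inj gK); rewrite gZ !fK.
Qed.

Section Pull.
Variables (B A : falgType rat) (g : B -> A) (gP : alg_iso g) (O : zorder A).

Definition pull_pred : {pred B} := fun y => g y \in O.

Lemma pull_subring : subring_closed pull_pred.
Proof.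
have [_ gB gM g1 _] := gP; split=> [|x y hx hy|x y hx hy]; rewrite unfold_in.
- by rewrite g1 zord1.
- by rewrite gB zordB.
- by rewrite gM zordM.
Qed.

Lemma pull_fg : exists L : seq B, forall x, x \in pull_pred <-> zspan L x.
Proof.
have [f [gK fK [_ fB _ _ _]]] := alg_iso_inv gP; have [_ gB _ _ _] := gP.
have [L hL] := order_fg O; exists (map f L) => x; rewrite unfold_in; split.
  by move/hL/(zspan_map fB); rewrite fK.
move=> /(zspan_map gB) h; apply/hL; move: h; rewrite -map_comp (eq_map (g := id)) ?map_id //.
Qed.

Lemma pull_full : exists2 L : seq B, basis_of fullv L & {subset L <= pull_pred}.
Proof.
apply: basis_of_scale => y; have [k [k0 hk]] := order_scale O (g y); exists k; split=> //.
by have [_ _ _ _ gZ] := gP; rewrite unfold_in gZ.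
Qed.

Definition pull : zorder B := ZOrder pull_subring pull_fg pull_full.

Lemma mem_pull y : (y \in pull) = (g y \in O).
Proof. by []. Qed.

End Pull.

Lemma pull_maximal (B A : falgType rat) (g : B -> A) (gP : alg_iso g) (O : zorder A) :
  maximal_order O -> maximal_order (pull gP O).
Proof.
move=> maxO M sM; have [f [gK fK fP]] := alg_iso_inv gP.
have := maxO (pull fP M) _ => h y yM.
rewrite mem_pull; apply: h; last by rewrite mem_pull fK.
by move=> x xO; rewrite mem_pull; apply: sM; rewrite mem_pull gK.
Qed.

Lemma order_ring_iso (B A : falgType rat) (g : B -> A) (gP : alg_iso g)
    (O : zorder A) (M : zorder B) : (forall y, (y \in M) = (g y \in O)) ->
  ring_iso (O : nzRingType) (M : nzRingType).
Proof.
move=> hM; have [f [gK fK [_ fB fM f1 _]]] := alg_iso_inv gP.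
have fO (x : order_ring O) : f (order_val x) \in M by rewrite hM gK order_ring_valK.
have gM (y : order_ring M) : g (order_val y) \in O by rewrite -hM order_ring_valK.
pose F (x : order_ring O) : order_ring M := OrderElt (fO x).
have FB : zmod_morphism F by move=> x y; apply: val_inj; rewrite /= fB.
have FM : monoid_morphism F by split=> [|x y]; apply: val_inj; rewrite /= ?f1 ?fM.
pose a := GRing.isZmodMorphism.Build _ _ F FB.
pose m := GRing.isMonoidMorphism.Build _ _ F FM.
pose F' : {rmorphism order_ring O -> order_ring M} := HB.pack F a m.
exists F'; exists (fun y => OrderElt (gM y)) => x; apply: val_inj => /=.
  by rewrite gK.
by rewrite fK.
Qed.

Section LinearIso.
Variables (A : falgType rat).

Lemma free_coord2 (a b : A) (c d : rat) : free [:: a; b] -> c *: a + d *: b = 0 -> c = 0 /\ d = 0.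
Proof.
move=> /(@freeP _ _ _ [tuple a; b]) fr h.
have E : \sum_(i < 2) (fun i : 'I_2 => [:: c; d]`_i) i *: [tuple a; b]`_i = 0.
  by rewrite !big_ord_recl big_ord0 addr0.
by split; [exact: (fr _ E ord0)|exact: (fr _ E (lift ord0 ord0))].
Qed.

Lemma free_coord4 (x y z t : A) (a b c d : rat) : free [:: x; y; z; t] ->
  a *: x + b *: y + c *: z + d *: t = 0 -> [/\ a = 0, b = 0, c = 0 & d = 0].
Proof.
move=> /(@freeP _ _ _ [tuple x; y; z; t]) fr h.
have E : \sum_(i < 4) (fun i : 'I_4 => [:: a; b; c; d]`_i) i *: [tuple x; y; z; t]`_i = 0.
  by rewrite !big_ord_recl big_ord0 addr0 !addrA.
by split; [exact: (fr _ E (@Ordinal 4 0 isT))|exact: (fr _ E (@Ordinal 4 1 isT))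
  |exact: (fr _ E (@Ordinal 4 2 isT))|exact: (fr _ E (@Ordinal 4 3 isT))].
Qed.

Lemma free_span_full (L : seq A) : free L -> \dim {:A} = size L -> <<L>>%VS = fullv.
Proof.
by rewrite /free => /eqP fr d; apply/eqP; rewrite eqEdim subvf d fr leqnn.
Qed.

Lemma span_coord2 (a b x : A) : x \in <<[:: a; b]>>%VS -> exists c d, x = c *: a + d *: b.
Proof.
rewrite span_cons span_seq1 => /memv_addP [_ /vlineP [c ->] [_ /vlineP [d ->] ->]].
by exists c, d.
Qed.

Lemma span_coord4 (x y z t v : A) : v \in <<[:: x; y; z; t]>>%VS ->
  exists a b c d, v = a *: x + b *: y + c *: z + d *: t.
Proof.
rewrite !span_cons span_nil addv0 => /memv_addP [_ /vlineP [a ->] [v1]].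
move=> /memv_addP [_ /vlineP [b ->] [v2]].
move=> /memv_addP [_ /vlineP [c ->] [_ /vlineP [d ->] ->] -> ->].
by exists a, b, c, d; rewrite !addrA.
Qed.

Lemma mul_quadratic (r : A) (D a b c d : rat) : r * r = D%:A ->
  (a%:A + b *: r) * (c%:A + d *: r) = (a * c + b * d * D)%:A + (a * d + b * c) *: r.
Proof.
move=> rr; rewrite mulrDl !mulrDr mul_scalar -!scalerAl -!scalerAr mul1r mulr1 rr !scalerA.
by rewrite [X in _ + X = _]addrC addrACA -!scalerDl.
Qed.

Lemma rat_alg_iso : \dim {:A} = 1%N -> alg_iso (fun a : rat^o => a%:A : A).
Proof.
move=> d1; have sp : <<[:: 1%R : A]>>%VS = fullv.
  apply/eqP; rewrite eqEdim subvf d1 /=.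
  by have := seq1_free (1 : A); rewrite oner_eq0 /free => /eqP ->.
have ex (x : A) : exists a : rat, x = a%:A.
  have : x \in <<[:: 1%R : A]>>%VS by rewrite sp memvf.
  by rewrite span_seq1 => /vlineP [a ->]; exists a.
split.
- exists (fun x => sval (cid (ex x))) => [a|x]; case: cid => b /=.
    by move/(@scalar_inj A).
  by move->.
- by move=> a b; rewrite scalerBl.
- by move=> a b; rewrite mul_scalar.
- by rewrite scale1r.
- by move=> a b; rewrite scalerA.
Qed.

End LinearIso.

Lemma quadratic_alg_iso (B A : falgType rat) (rB : B) (rA : A) (D : rat) :
  \dim {:B} = 2%N -> \dim {:A} = 2%N -> free [:: 1; rB] -> free [:: 1; rA] ->
  rB * rB = D%:A -> rA * rA = D%:A -> exists g : B -> A, alg_iso g.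
Proof.
move=> dB dA frB frA sB sA.
have exB x : exists p : rat * rat, x = p.1%:A + p.2 *: rB.
  have : x \in <<[:: 1%R; rB]>>%VS by rewrite free_span_full // memvf.
  by move/span_coord2 => [c [d ->]]; exists (c, d).
have exA x : exists p : rat * rat, x = p.1%:A + p.2 *: rA.
  have : x \in <<[:: 1%R; rA]>>%VS by rewrite free_span_full // memvf.
  by move/span_coord2 => [c [d ->]]; exists (c, d).
have uniq2 (C : falgType rat) (r : C) a b c d : free [:: 1; r] ->
    a%:A + b *: r = c%:A + d *: r -> (a, b) = (c, d).
  move=> fr h; have : (a - c)%:A + (b - d) *: r = 0.
    by rewrite !scalerBl addrACA -opprD h subrr.
  by move/(free_coord2 fr) => [/eqP + /eqP]; rewrite !subr_eq0 => /eqP -> /eqP ->.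
pose cB x := sval (cid (exB x)); pose cA x := sval (cid (exA x)).
have cBE x : x = (cB x).1%:A + (cB x).2 *: rB by rewrite /cB; case: cid.
have cAE x : x = (cA x).1%:A + (cA x).2 *: rA by rewrite /cA; case: cid.
have cBK a b : cB (a%:A + b *: rB) = (a, b).
  by rewrite [cB _]surjective_pairing; apply: (uniq2 B rB) => //; rewrite -cBE.
have cAK a b : cA (a%:A + b *: rA) = (a, b).
  by rewrite [cA _]surjective_pairing; apply: (uniq2 A rA) => //; rewrite -cAE.
pose g x := (cB x).1%:A + (cB x).2 *: rA.
have gE a b : g (a%:A + b *: rB) = a%:A + b *: rA by rewrite /g cBK.
exists g; split.
- exists (fun x => (cA x).1%:A + (cA x).2 *: rB) => x.
    by rewrite /g cAK -cBE.
  by rewrite gE -cAE.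
- move=> x y; rewrite [x]cBE [y]cBE !gE opprD addrACA -!scalerBl gE.
  by rewrite opprD addrACA -!scalerBl.
- by move=> x y; rewrite [x]cBE [y]cBE (mul_quadratic _ _ _ _ sB) !gE (mul_quadratic _ _ _ _ sA).
- by have := gE 1 0; rewrite !scale0r !addr0 !scale1r.
- move=> a x; rewrite [x]cBE scalerDr !scalerA !gE.
  by rewrite scalerDr !scalerA.
Qed.

(** Multiplicativity is checked for left multiplication by the two generators only and extended by
    linearity, since the fourth basis vector is their product. *)
Lemma quaternion_alg_iso (A : falgType rat) (u v : rat) (i j : A) :
  \dim {:A} = 4%N -> free [:: 1; i; j; i * j] -> i * i = u%:A -> j * j = v%:A ->
  j * i = - (i * j) ->
  alg_iso (fun q : quaternion u v => qre q *: 1 + qi q *: i + qj q *: j + qk q *: (i * j)).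
Proof.
move=> dA fr ii jj ji; set g := fun q : quaternion u v => _.
have gD : {morph g : x y / x + y}.
  by move=> x y; rewrite /g /= !scalerDl [RHS]addrACA [X in _ = X + _]addrACA [X in _ = X + _ + _]addrACA.
have gZ a : {morph g : x / a *: x}.
  by move=> x; rewrite /g /= !scalerDr !scalerA.
have gB : {morph g : x y / x - y}.
  by move=> x y; rewrite gD -scaleN1r gZ scaleN1r.
have gi x : g (quatI u v * x) = i * g x.
  case: x => a b c d; rewrite /g /= !mulrDr -!scalerAr mulr1 mulrA ii -scalerAl mul1r.
  rewrite !scalerA; rewrite !(mul0r, mulr0, mul1r, mulr1, add0r, addr0, subr0, sub0r, oppr0).
  rewrite (mulrC u b) (mulrC u d) [_%:A + a *: i]addrC -!addrA.
  by congr (_ + (_ + _)); exact: addrC.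
have jij : j * (i * j) = - (v *: i) by rewrite mulrA ji mulNr -mulrA jj -scalerAr mulr1.
have gj x : g (quatJ u v * x) = j * g x.
  case: x => a b c d; rewrite /g /= !mulrDr -!scalerAr mulr1 ji jij jj !scalerN !scalerA.
  rewrite !(mul0r, mulr0, mul1r, mulr1, add0r, addr0, subr0, sub0r, oppr0).
  by rewrite !scaleNr (mulrC v c) (mulrC v d) -[LHS]addrA [LHS]addrC addrA.
have g1 : g 1 = 1 by rewrite /g /= scale1r !scale0r !addr0.
have gM : {morph g : x y / x * y}.
  move=> x y; have xE : x = qre x *: 1 + qi x *: quatI u v + qj x *: quatJ u v + qk x *: (quatI u v * quatJ u v).
    by have [_ _ -> _] := quat_relations u v; exact: quatE.
  rewrite {1}xE !mulrDl -!scalerAl mul1r !gD !gZ gi gj -mulrA gi gj.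
  by rewrite mul1r mulrA.
have g_inj x y : g x = g y -> x = y.
  move=> h; have : g (x - y) = 0 by rewrite gB h subrr.
  move/(free_coord4 fr) => [/eqP h1 /eqP h2 /eqP h3 /eqP h4].
  move: h1 h2 h3 h4; case: x {h} => a b c d; case: y => a' b' c' d' /=.
  by rewrite !subr_eq0 => /eqP -> /eqP -> /eqP -> /eqP ->.
have ex x : exists q, x = g q.
  have : x \in <<[:: 1; i; j; i * j]%R>>%VS by rewrite free_span_full // memvf.
  by move/span_coord4 => [a [b [c [d ->]]]]; exists (Quaternion u v a b c d).
split=> //; exists (fun x => sval (cid (ex x))) => x; last by case: cid.
by case: cid => q /= /g_inj.
Qed.

(** * Classification of the orders spanned by units *)

Section Quadratic.
Variable d : rat.
Let h : {poly rat} := 'X^2 - d%:P.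

Lemma size_mk_quadratic : size (mk_monic h) = 3%N.
Proof. by rewrite mk_monic_quadratic size_XnsubC. Qed.

Lemma quadratic_dim : \dim {: quadratic d} = 2%N.
Proof. by rewrite dim_polyn size_mk_quadratic. Qed.

Definition quadraticX : quadratic d := in_qpoly h 'X.

Lemma quadraticX_sqr : quadraticX * quadraticX = d%:A.
Proof.
rewrite -[LHS](in_qpolyM h).
have -> : 'X * 'X = h + d *: 1 :> {poly rat} by rewrite alg_polyC subrK -expr2.
rewrite in_qpolyD in_qpolyZ in_qpoly1; suff -> : in_qpoly h h = 0 by rewrite add0r.
by apply: val_inj; rewrite /= mk_monic_quadratic Pdiv.RingMonic.rmodpp // monicXnsubC.
Qed.

Lemma quadratic_free : free [:: 1; quadraticX].
Proof.
apply/(@freeP _ _ _ [tuple 1; quadraticX]) => k; rewrite !big_ord_recl big_ord0 addr0 /=.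
move=> /(congr1 (fun q : quadratic d => (val q : {poly rat}))) /=.
rewrite Pdiv.CommonRing.rmodp_small ?size_mk_quadratic ?size_polyX // => E.
have E0 := congr1 (fun p : {poly rat} => p`_0) E; have E1 := congr1 (fun p : {poly rat} => p`_1) E.
move: E0 E1; rewrite /= !coefD !coefZ !coefC !coefX /= !mulr0 !mulr1 addr0 add0r => E0 E1.
by case=> -[|[|//]] hi; [rewrite -[RHS]E0|rewrite -[RHS]E1]; congr (k _); apply: val_inj.
Qed.

End Quadratic.

Section Classify.
Variables (A : falgType rat) (hq : imquad A) (O : zorder A) (us : seq A).
Local Notation nm := (qnm hq).
Local Notation tr := (qtr hq).
Local Notation cj := (qcj hq).
Local Notation bil := (qbil hq).
Hypotheses (ul : unit_list hq O us) (ub : basis_of fullv us).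
Hypothesis uspan : forall x, x \in O <-> zspan us x.
Implicit Types x y z u v w : A.

Lemma basis_size : size us = \dim {:A}.
Proof. by rewrite -(span_basis ub); move: (basis_free ub); rewrite /free => /eqP ->. Qed.

(** Rounding is applied to an element of the larger order: what remains still lies in that order,
    has norm below 1, and norms are integral there too. *)
Lemma class_maximal : (size us < 4)%N \/ nonortho hq us -> maximal_order O.
Proof.
move=> h O' sO x xO'; have [_ us1] := ul.
have xus : x \in <<us>>%VS by rewrite (span_basis ub) memvf.
have [t ht hn] := cover_strict (fun u uu => (us1 u uu).2) (unit_list_size ul) h xus.
have tO : t \in O by apply/uspan.
have := order_nm_lt1 (zordB xO' (sO _ tO)) hn.
by move/eqP; rewrite subr_eq0 => /eqP ->.
Qed.

Lemma class_iso (B : falgType rat) (g : B -> A) : alg_iso g -> maximal_order O ->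
  iso_maximal_order_in O B.
Proof.
move=> gP maxO; exists (pull gP O); first exact: pull_maximal.
by apply: (order_ring_iso gP) => y; exact: mem_pull.
Qed.

Lemma tr_mulC x y : tr (x * y) = tr (y * x).
Proof.
have h z w : bil (cj z) (cj w) = bil z w.
  have := nmD hq (cj z) (cj w); rewrite -cjD !nm_cj nmD; move/addrI => ->.
  by [].
have := h (cj x) y; rewrite /qbil !cjK => ->.
by rewrite -cj_mul_cj cjK tr_cj.
Qed.

Lemma tr_unit_values x : x \in O -> nm x = 1 -> (forall a, x <> a%:A) ->
  [\/ tr x = -1, tr x = 0 | tr x = 1].
Proof.
move=> xO n1 ns; have /intrP [m hm] := order_tr_int hq xO.
have [_ [|/ns //]] := trP hq x; rewrite n1 hm mulr1 => h.
have {}h : m ^+ 2 < 4 by rewrite -(ltr_int rat) rmorphXn.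
have [m1|m1|m1] : [\/ m = -1, m = 0 | m = 1].
- have : -2 < m < 2 by apply/andP; split; nia.
  case/andP => h1 h2; have [?|[?|?]] : m = -1 \/ m = 0 \/ m = 1 by lia.
  + by constructor 1.
  + by constructor 2.
  by constructor 3.
- by constructor 1; rewrite m1.
- by constructor 2; rewrite m1.
- by constructor 3; rewrite m1.
Qed.

Lemma unit_sqr x : nm x = 1 -> x * x = tr x *: x - 1.
Proof. by move=> n1; have [-> _] := trP hq x; rewrite n1 scale1r. Qed.

Lemma class_dim1 : \dim {:A} = 1%N -> iso_maximal_order_in O rat^o.
Proof.
move=> d1; apply: (class_iso (rat_alg_iso d1)); apply: class_maximal; left.
by rewrite basis_size d1.
Qed.

Lemma free_scalar x : (forall a, x <> a%:A) -> free [:: 1; x].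
Proof.
move=> ns; have p : perm_eq [:: 1; x] [:: x; 1] by apply/permPl/(perm_catC [:: 1] [:: x]).
rewrite (perm_free p) free_cons seq1_free oner_eq0 andbT.
by rewrite span_seq1; apply/negP => /vlineP [a xa]; apply: (ns a).
Qed.

Lemma class_dim2 : \dim {:A} = 2%N -> iso_maximal_order_in O (quadratic (-1)) \/
  iso_maximal_order_in O (quadratic (-3)).
Proof.
move=> d2; have su : size us = 2%N by rewrite basis_size.
have maxO : maximal_order O by apply: class_maximal; left; rewrite su.
have fr := basis_free ub; have [_ us1] := ul.
case: us su fr us1 => [|u [|v [|]]] // _ fr us1.
have [uO nu] := us1 u (mem_head _ _); have [vO nv] : v \in O /\ nm v = 1.
  by apply: us1; rewrite !inE eqxx orbT.
(* Dividing the basis by [u] replaces it by 1 and a non-scalar unit [w], whose trace is 0 or 1 up to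
   sign: [w] squares to -1 in the first case and [2 w - tr w] squares to -3 in the second. *)
pose w := cj u * v; have wO : w \in O by apply/zordM => //; apply: order_cj.
have nw : nm w = 1 by rewrite nmM nm_cj nu nv mulr1.
have ns a : w <> a%:A.
  move=> wa; have := fr; rewrite free_cons => /andP [/negP]; case.
  have vE : v = a *: u.
    have : u * w = v by rewrite /w mulrA mul_cj nu scale1r mul1r.
    by rewrite wa -scalerAr mulr1 => <-.
  have a0 : a != 0.
    by apply: contra_eq_neq nv => a0; rewrite vE a0 scale0r nm0 eq_sym oner_eq0.
  have -> : u = a^-1 *: v by rewrite vE scalerA mulVf // scale1r.
  by rewrite span_seq1 memvZ // memv_line.
have ww := unit_sqr nw.
have quad (d : rat) (r : A) : (forall a, r <> a%:A) -> r * r = d%:A -> iso_maximal_order_in O (quadratic d).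
  move=> nr rr; have [g gP] := quadratic_alg_iso (quadratic_dim d) d2 (quadratic_free d)
    (free_scalar nr) (quadraticX_sqr d) rr.
  exact: class_iso gP maxO.
have nr t a : 2 *: w - t%:A <> a%:A :> A.
  move=> /eqP; rewrite subr_eq -scalerDl => /eqP /(@scalar_rel A 2 _ _ isT).
  exact: ns.
have r2 t : tr w = t -> t ^+ 2 = 1 -> (2 *: w - t%:A) * (2 *: w - t%:A) = (-3)%:A.
  move=> tw t2; rewrite addrC -scaleNr sqr_addl -scalerAl -scalerAr ww tw sqrrN t2.
  rewrite !scalerBr !scalerA -addrA [X in _ + X](_ : _ = (-4)%:A).
    by rewrite -scalerDl.
  rewrite addrA -scalerDl (_ : 2 * - t * 2 + 2 * 2 * t = 0); last by ring.
  by rewrite scale0r sub0r -scaleNr; congr (_ *: _); ring.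
have [t1|t0|t1] := tr_unit_values wO nw ns.
- right; apply: (quad _ (2 *: w - (-1)%:A)); first exact: nr.
  by apply: r2; rewrite // sqrrN expr1n.
- left; apply: (quad _ w) => //; by rewrite ww t0 scale0r sub0r scaleN1r.
right; apply: (quad _ (2 *: w - 1%:A)); first exact: nr.
by apply: r2; rewrite // expr1n.
Qed.

Lemma pure_sqr x : tr x = 0 -> x * x = (- nm x)%:A.
Proof. by move=> tx; have [-> _] := trP hq x; rewrite tx scale0r sub0r scaleNr. Qed.

Lemma quaternion_basis (i j : A) : i != 0 -> j != 0 -> tr i = 0 -> tr j = 0 ->
  bil i j = 0 -> free [:: 1; i; j; i * j].
Proof.
move=> i0 j0 ti tj bij; have p : perm_eq [:: 1; i; j; i * j] [:: i * j; j; i; 1].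
  by rewrite perm_sym; apply/permPl/(perm_rev [:: 1; i; j; i * j]).
rewrite (perm_free p).
  apply: (ortho_free (hq := hq)).
  have cjE z : tr z = 0 -> cj z = - z by move=> tz; rewrite /qcj tz scale0r sub0r.
  have k0 : i * j != 0 by rewrite -(nm_eq0 hq) nmM mulf_neq0 ?nm_eq0.
  have bk1 : bil (i * j) 1 = 0.
    by rewrite -[i * j]opprK -mulrN -(cjE _ tj) bilNl bil1 -/(bil i j) bij oppr0.
  have bki : bil (i * j) i = 0.
    by rewrite /qbil tr_mulC mulrA mulcj -scalerAl mul1r trZ tj mulr0.
  have bkj : bil (i * j) j = 0.
    by rewrite /qbil -mulrA mul_cj -scalerAr mulr1 trZ ti mulr0.
  by rewrite !ortho_cons /= k0 i0 j0 oner_neq0 bk1 bki bkj [bil j i]bilC bij !bil1 ti tj !eqxx.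
Qed.

Lemma class_quaternion (u v : rat) (i j : A) : \dim {:A} = 4%N -> tr i = 0 -> tr j = 0 ->
  bil i j = 0 -> nm i = - u -> nm j = - v -> u != 0 -> v != 0 ->
  alg_iso (fun q : quaternion u v => qre q *: 1 + qi q *: i + qj q *: j + qk q *: (i * j)).
Proof.
move=> d4 ti tj bij ni nj u0 v0; apply: quaternion_alg_iso => //.
- by apply: quaternion_basis => //; rewrite -(nm_eq0 hq) ?ni ?nj oppr_eq0.
- by rewrite pure_sqr // ni opprK.
- by rewrite pure_sqr // nj opprK.
- exact: (bil_anticomm ti tj bij).
Qed.

(** A non-orthogonal pair gives, up to sign, a unit [w] of trace 1, a sixth root of unity. A unit
    [i] of trace 0 outside its field is then found, and the trace of [w * i] decides between the two
    algebras. *)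
Lemma class_dim4_maximal : \dim {:A} = 4%N -> nonortho hq us ->
  iso_maximal_order_in O (quaternion (-1 : rat) (-1)) \/
  iso_maximal_order_in O (quaternion (-1 : rat) (-3)).
Proof.
move=> d4 no; have maxO : maximal_order O by apply: class_maximal; right.
have fr := basis_free ub; have [_ us1] := ul.
have [u [v [uus vus uv b0]]] := no.
have [uO nu] := us1 u uus; have [vO nv] := us1 v vus.
pose w0 := u * cj v.
have w0O : w0 \in O by apply/zordM => //; apply: order_cj.
have nw0 : nm w0 = 1 by rewrite nmM nm_cj nu nv mulr1.
have ns a : w0 <> a%:A.
  move=> wa; have uE : u = a *: v.
    have : w0 * v = u by rewrite /w0 -mulrA mulcj nv scale1r mulr1.
    by rewrite wa -scalerAl mul1r => <-.
  have p1 : perm_eq us (u :: rem u us) by apply: perm_to_rem.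
  have vr : v \in rem u us by move: vus; rewrite (perm_mem p1) inE eq_sym (negPf uv).
  move: fr; rewrite (perm_free p1) free_cons => /andP [/negP]; case.
  by rewrite {1}uE memvZ // memv_span.
have [w [wO nw tw]] : exists w, [/\ w \in O, nm w = 1 & tr w = 1].
  have [t1|t0|t1] := tr_unit_values w0O nw0 ns.
  - by exists (- w0); rewrite zordN // nmN trN t1 opprK.
  - by case/eqP: b0.
  - by exists w0.
have ww : w * w = w - 1 by rewrite unit_sqr // tw scale1r.
have cw : cj w = 1 - w by rewrite /qcj tw scale1r.
have [z zus zsp] : exists2 z, z \in us & z \notin <<[:: 1%R; w]>>%VS.
  apply: contrapT => h; have : (<<us>> <= <<[:: 1%R; w]>>)%VS.
    by apply/span_subvP => z zus; apply: contraT => nz; case: h; exists z.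
  rewrite (span_basis ub) => /dimvS; rewrite d4 => /leq_trans/(_ (dim_span _)).
  by [].
have [zO nz] := us1 z zus.
have sp1 : 1 \in <<[:: 1%R; w]>>%VS by rewrite memv_span // mem_head.
have spw : w \in <<[:: 1%R; w]>>%VS by rewrite memv_span // !inE eqxx orbT.
have vals y : y \in O -> nm y = 1 -> cj y \in <<[:: 1%R; w]>>%VS ->
    [\/ tr (y * z) = -1, tr (y * z) = 0 | tr (y * z) = 1].
  move=> yO ny cy; apply: tr_unit_values; rewrite ?zordM ?nmM ?ny ?nz ?mulr1 // => a yz.
  case/negP: zsp; have -> : z = a *: cj y; last by rewrite memvZ.
  have : cj y * (y * z) = z by rewrite mulrA mulcj ny scale1r mul1r.
  by rewrite yz -scalerAr mulr1.
have v0 := vals 1 (zord1 O) (nm1 hq); rewrite cj1 mul1r in v0; have {}v0 := v0 sp1.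
have v1 := vals w wO nw; rewrite cw in v1; have {}v1 := v1 (memvB sp1 spw).
have v2 : [\/ tr (w * (w * z)) = -1, tr (w * (w * z)) = 0 | tr (w * (w * z)) = 1].
  rewrite mulrA; apply: vals; rewrite ?zordM ?nmM ?nw ?mulr1 // ww cjB cw cj1.
  by rewrite memvB // memvB.
have t2 y : tr (w * (w * y)) = tr (w * y) - tr y.
  by rewrite mulrA ww mulrBl mul1r trB.
(* By [t2], the traces of [z], [w * z] and [w * (w * z)] satisfy a linear relation, and each is -1,
   0 or 1. If the first two are nonzero, their difference is even, so the third is 0. *)
have [i [iO ni ti hi]] : exists i, [/\ i \in O, nm i = 1, tr i = 0 &
    [\/ tr (w * i) = -1, tr (w * i) = 0 | tr (w * i) = 1]].
  have [tz|tz] := eqVneq (tr z) 0; first by exists z.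
  have [twz|twz] := eqVneq (tr (w * z)) 0.
    by exists (w * z); rewrite zordM // nmM nw nz mulr1 twz; split.
  exists (w * (w * z)); rewrite !zordM // !nmM nw nz !mulr1.
  have twwz : tr (w * (w * z)) = 0.
    move: v2; rewrite t2; move: tz twz.
    case: v0 => ->; case: v1 => ->; rewrite ?eqxx // => _ _; first [by rewrite subrr|by case=> /eqP].
  split=> //; rewrite t2 twwz sub0r.
  by case: v1 => ->; [constructor 3; rewrite opprK|constructor 2; rewrite oppr0|constructor 1].
have [{}i [{}iO {}ni {}ti {}hi]] : exists i, [/\ i \in O, nm i = 1, tr i = 0 &
    tr (w * i) = 0 \/ tr (w * i) = 1].
  case: hi => hi; last by exists i; split=> //; right.
    by exists (- i); rewrite zordN // nmN trN mulrN trN ti hi oppr0 opprK; split=> //; right.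
  by exists i; split=> //; left.
have cjE y : tr y = 0 -> cj y = - y by move=> ty; rewrite /qcj ty scale0r sub0r.
(* If the trace of [w * i] is 0, then [2 w - 1], of square -3, is already orthogonal to [i]. *)
case: hi => hi.
  right; pose j := 2 *: w - 1.
  have tj : tr j = 0 by rewrite trB trZ tw tr1 mulr1 subrr.
  have nj : nm j = 3 by rewrite nmD nmN nm1 nmZ nw bilC bilNl bilZr bilC bil1 tw; ring.
  have bij : bil i j = 0.
    by rewrite /qbil (cjE j tj) mulrN trN tr_mulC mulrBl mul1r trB -scalerAl trZ hi ti mulr0 subrr oppr0.
  by apply: class_iso maxO; apply: (@class_quaternion (-1) (-3) i j) => //; rewrite ?ni ?nj opprK.
(* b is the projection of w orthogonal to 1 and i, with norm 1/2; multiplying it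
   by 1 + i, of norm 2, gives a unit still orthogonal to 1 and i. *)
left; pose b := w - (1 / 2)%:A + (1 / 2) *: i; pose j := b + i * b.
have bwi : bil w i = -1 by rewrite /qbil cjE // mulrN trN hi.
have b1i : bil 1 i = 0 by rewrite bilC bil1.
have tb : tr b = 0 by rewrite trD trB tw tr_scalar trZ ti; field.
have bbi : bil b i = 0 by rewrite bilDl bilBl !bilZl bwi b1i bilxx ni; field.
have nb : nm b = 1 / 2.
  have e1 : bil w (- (1 / 2)%:A) = - (1 / 2).
    by rewrite bilC bilNl bilZl bilC bil1 tw mulr1.
  have e2 : bil (w - (1 / 2)%:A) ((1 / 2) *: i) = - (1 / 2).
    by rewrite bilZr bilBl bwi bilZl b1i; field.
  by rewrite /b nmD e2 nmD e1 nmN !nmZ nm1 nw ni; field.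
have tib : tr (i * b) = 0.
  by rewrite tr_mulC -[i]opprK -(cjE i ti) mulrN trN -/(bil b i) bbi oppr0.
have tj : tr j = 0 by rewrite trD tb tib addr0.
have nj : nm j = 1.
  have -> : j = (1 + i) * b by rewrite mulrDl mul1r.
  by rewrite nmM nb nmD nm1 ni b1i; field.
have bij : bil i j = 0.
  rewrite bilC bilDl bbi add0r /qbil -mulrA tr_mulC -mulrA cjE // mulNr.
  by rewrite pure_sqr // ni scaleNr opprK scale1r mulr1.
by apply: class_iso maxO; apply: (@class_quaternion (-1) (-1) i j) => //; rewrite ?ni ?nj opprK.
Qed.
End Classify.

(** * Integral bases of orders and their transport *)

Lemma sum_map_mulrz (V W : zmodType) (f : V -> W) (L : seq V) (c : 'I_(size (map f L)) -> int) :
  {morph f : x y / x - y} ->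
  \sum_(i < size (map f L)) (map f L)`_i *~ c i =
    f (\sum_(j < size L) L`_j *~ c (cast_ord (esym (size_map f L)) j)).
Proof.
move=> fB; have f0 : f 0 = 0 by have := fB 0 0; rewrite !subrr.
have fN x : f (- x) = - f x by rewrite -(sub0r x) fB f0 sub0r.
have fD x y : f (x + y) = f x + f y by rewrite -{1}(opprK y) fB fN opprK.
have fz x n : f (x *~ n) = f x *~ n.
  have fn m : f (x *+ m) = f x *+ m by elim: m => [|m ih]; rewrite ?mulr0n // !mulrS fD ih.
  by case: n => n; rewrite ?NegzE ?mulrNz ?fN -!pmulrn fn.
rewrite (big_morph f fD f0) (reindex (cast_ord (esym (size_map f L)))) /=; last first.
  by exists (cast_ord (size_map f L)) => i _; rewrite ?cast_ordK ?cast_ordKV.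
by apply: eq_bigr => j _; rewrite fz (nth_map 0).
Qed.

Lemma zspan_map_inv (V W : zmodType) (f : V -> W) (L : seq V) x : injective f ->
  {morph f : y z / y - z} -> zspan (map f L) (f x) -> zspan L x.
Proof.
move=> fI fB [c hc]; exists (fun j => c (cast_ord (esym (size_map f L)) j)).
by apply: fI; rewrite hc sum_map_mulrz.
Qed.

Lemma zfree_map (V W : zmodType) (f : V -> W) (L : seq V) : injective f ->
  {morph f : y z / y - z} -> zfree (map f L) <-> zfree L.
Proof.
move=> fI fB; have f0 : f 0 = 0 by have := fB 0 0; rewrite !subrr.
split=> fr c hc i.
  pose c' i := c (cast_ord (size_map f L) i).
  have h : \sum_(i < size (map f L)) (map f L)`_i *~ c' i = 0.
    rewrite sum_map_mulrz // -[RHS]f0; congr f; rewrite -[RHS]hc; apply: eq_bigr => j _.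
    by rewrite /c' cast_ordKV.
  by have := fr _ h (cast_ord (esym (size_map f L)) i); rewrite /c' cast_ordKV.
have h : \sum_(j < size L) L`_j *~ c (cast_ord (esym (size_map f L)) j) = 0.
  by apply: fI; rewrite -sum_map_mulrz // hc f0.
by have := fr _ h (cast_ord (size_map f L) i); rewrite cast_ordK.
Qed.

Definition unit_zbasis (R : nzRingType) :=
  exists2 B : seq R, zbasis B & {subset B <= @ring_units R}.

Lemma unit_zbasis_iso (R S : nzRingType) : ring_iso R S -> unit_zbasis S -> unit_zbasis R.
Proof.
move=> [f [g fK gK]] [B [fB sB] uB].
have gB : {morph g : x y / x - y} by move=> x y; apply: (can_inj fK); rewrite rmorphB !gK.
have gM : {morph g : x y / x * y} by move=> x y; apply: (can_inj fK); rewrite rmorphM !gK.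
have g1 : g 1 = 1 by apply: (can_inj fK); rewrite rmorph1 gK.
exists (map g B).
  split; first by apply/(zfree_map _ (can_inj gK) gB).
  apply/seteqP; split=> // x _; rewrite -(fK x); apply: zspan_map gB _.
  by rewrite sB.
move=> _ /mapP [b bB ->]; have := uB b bB; rewrite !in_setE => -[c [cb bc]].
by exists (g c); rewrite -!gM cb bc g1.
Qed.

Section LiftOrder.
Variables (A : falgType rat) (O : zorder A).
Local Notation ov := (@order_val A O).

Lemma order_valB : {morph ov : x y / x - y}. Proof. by []. Qed.
Lemma order_val_inj : injective ov. Proof. exact: val_inj. Qed.

Lemma order_lift (L : seq A) : {subset L <= O} -> exists L' : seq (order_ring O), map ov L' = L.
Proof.
elim: L => [|x L ih] h; first by exists [::].
have [|L' <-] := ih; first by move=> y yL; apply: h; rewrite inE yL orbT.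
by exists (OrderElt (h x (mem_head _ _)) :: L').
Qed.

Lemma zbasis_lift (L' : seq (order_ring O)) : free (map ov L') ->
  (forall x, x \in O -> zspan (map ov L') x) -> zbasis L'.
Proof.
move=> fr sp; split; first by apply/(zfree_map L' order_val_inj order_valB)/free_zfree.
apply/seteqP; split=> // x _; apply: (zspan_map_inv order_val_inj order_valB).
by apply: sp; exact: order_ring_valK.
Qed.

Lemma zbasis_val (L' : seq (order_ring O)) : zbasis L' ->
  [/\ basis_of fullv (map ov L'), {subset map ov L' <= O} & forall x, x \in O <-> zspan (map ov L') x].
Proof.
move=> [fr sp].
have sub : {subset map ov L' <= O} by move=> _ /mapP [x _ ->]; exact: order_ring_valK.
have OE x : x \in O -> zspan (map ov L') x.
  move=> xO; rewrite -[x]/(ov (OrderElt xO)); apply: zspan_map order_valB _.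
  by rewrite sp.
split=> //; last first.
  move=> x; split; first exact: OE.
  by apply: (zspan_sub (P := fun x => x \in O)); [exact: zord0|move=> y z; exact: zordB|exact: sub].
have fr' : free (map ov L') by apply/zfree_free/(zfree_map L' order_val_inj order_valB).
rewrite /basis_of fr' andbT; apply/eqP/vspaceP => x; rewrite memvf.
have [k [k0 hk]] := order_scale O x.
have -> : x = k%:R^-1 *: (k%:R *: x) by rewrite scalerA mulVf ?scale1r // pnatr_eq0 -lt0n.
by apply: memvZ; apply/zspan_span/OE.
Qed.

(** Units spanning only over the rationals suffice, because [unit_basis] replaces them by a
    saturated list of units. *)
Lemma unit_zbasis_of_span (hq : imquad A) (L : seq A) :
  (forall u, u \in L -> u \in O /\ qnm hq u = 1) -> <<L>>%VS = fullv -> unit_zbasis (O : nzRingType).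
Proof.
move=> L1 Lf; have [us [[fr us1] sat uu]] := unit_basis hq O.
have usO : {subset us <= O} by move=> u /us1 [].
have full : <<us>>%VS = fullv.
  apply/eqP; rewrite eqEsubv subvf -Lf; apply/span_subvP => u /L1 [uO u1].
  exact/zspan_span/uu.
have bas : basis_of fullv us by rewrite /basis_of full eqxx fr.
have [L' hL'] := order_lift usO; exists L'.
  by apply: zbasis_lift; rewrite hL' // => x /(saturated_full usO bas sat).
move=> u uL'; rewrite (mem_ring_units hq); apply/eqP.
by have [] := us1 (order_val u) _; rewrite // -hL' map_f.
Qed.

End LiftOrder.

Lemma zspan_scale (A : falgType rat) (us : seq A) : basis_of fullv us ->
  forall x, exists k : nat, (0 < k)%N /\ zspan us (k%:R *: x).
Proof.
move=> ub x; have xus : x \in <<in_tuple us>>%VS by rewrite (span_basis ub) memvf.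
have [k [k0 hk]] := common_denom (fun i => coord (in_tuple us) i x).
exists k; split=> //; rewrite [in X in _ *: X](coord_span xus) scaler_sumr.
apply: (big_ind (zspan us)); [exact: zspan0|exact: zspanD|move=> i _].
rewrite scalerA mulrC; have /intrP [m ->] := hk i.
by rewrite scaler_int; apply/zspanMz/zspan_mem/mem_nth.
Qed.

Lemma span_map_fun (A B : falgType rat) (g : A -> B) (L : seq A) x :
  {morph g : x y / x + y} -> (forall a, {morph g : x / a *: x}) ->
  x \in <<L>>%VS -> g x \in <<map g L>>%VS.
Proof.
move=> gD gZ; elim: L x => [|y L ih] x.
  by rewrite !span_nil !memv0 => /eqP ->; rewrite -(scale0r 0) gZ scale0r.
rewrite /= !span_cons => /memv_addP [_ /vlineP [c ->] [z zL ->]].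
by rewrite gD gZ memv_add ?ih // memvZ // memv_line.
Qed.

Lemma zspan_mul (A : falgType rat) (us : seq A) :
  (forall u v, u \in us -> v \in us -> zspan us (u * v)) ->
  forall x y, zspan us x -> zspan us y -> zspan us (x * y).
Proof.
move=> h x y hx hy; apply: (zspan_sub (P := fun x => zspan us (x * y))) hx.
- by rewrite mul0r; exact: zspan0.
- by move=> a b ha hb; rewrite mulrBl; apply: zspanB.
move=> u uus; apply: (zspan_sub (P := fun y => zspan us (u * y))) hy.
- by rewrite mulr0; exact: zspan0.
- by move=> a b ha hb; rewrite mulrBr; apply: zspanB.
by move=> v vus; exact: h.
Qed.

(** * Maximal orders in the listed algebras *)

Section Euclid.
Variables (B : falgType rat) (hq : imquad B) (us : seq B) (M : zorder B).
Local Notation nm := (qnm hq).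
Hypothesis us1 : forall u, u \in us -> nm u = 1.
Hypothesis ub : basis_of fullv us.
Hypothesis cov : (size us < 4)%N \/ nonortho hq us.
Hypothesis H1 : zspan us 1.
Hypothesis HM : forall u v, u \in us -> v \in us -> zspan us (u * v).
Hypothesis maxM : maximal_order M.

Lemma euclid_size : (size us <= 4)%N.
Proof.
have -> : size us = \dim {:B}.
  by rewrite -(span_basis ub); move: (basis_free ub); rewrite /free => /eqP ->.
by case: (imquad_dim hq) => ->.
Qed.

(* M generates a left ideal over the Euclidean order spanned by us, hence a
   principal one, and M is contained in a conjugate of that order. *)
Lemma euclid_conjugate : exists2 a : B, a != 0 & forall m, m \in M -> zspan us (a * m * a^-1).
Proof.
have [G hG] := order_fg M.
pose I := zspan [seq u * g | u <- us, g <- G].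
have IE h m : zspan us h -> m \in M -> I (h * m).
  move=> hh /hG hm; apply: (zspan_sub (P := fun h => I (h * m))) hh.
  - by rewrite mul0r; exact: zspan0.
  - by move=> a b ha hb; rewrite mulrBl; apply: zspanB.
  move=> u uus; apply: (zspan_sub (P := fun m => I (u * m))) hm.
  - by rewrite mulr0; exact: zspan0.
  - by move=> a b ha hb; rewrite mulrBr; apply: zspanB.
  by move=> g gG; apply/zspan_mem/allpairs_f.
have GM g : g \in G -> g \in M by move=> gG; apply/hG/zspan_mem.
have Il h x : zspan us h -> I x -> I (h * x).
  move=> hh; apply: (zspan_sub (P := fun x => I (h * x))).
  - by rewrite mulr0; exact: zspan0.
  - by move=> a b ha hb; rewrite mulrBr; apply: zspanB.
  move=> _ /allpairsP [[u g] /= [uus gG ->]]; rewrite mulrA; apply: IE; last exact: GM.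
  by apply: zspan_mul => //; exact: zspan_mem.
have Ir x m : I x -> m \in M -> I (x * m).
  move=> hx mM; apply: (zspan_sub (P := fun x => I (x * m))) hx.
  - by rewrite mul0r; exact: zspan0.
  - by move=> a b ha hb; rewrite mulrBl; apply: zspanB.
  move=> _ /allpairsP [[u g] /= [uus gG ->]]; rewrite -mulrA; apply: IE; first exact: zspan_mem.
  by apply: zordM => //; exact: GM.
have [D [D0 hD]] := zspan_nm_denom hq [seq u * g | u <- us, g <- G].
pose P (n : nat) := `[< (0 < n)%N /\ exists2 x, I x & nm x * D%:R = n%:R >].
have exP : exists n, P n.
  exists D; apply/asboolP; split=> //; exists (1 * 1); first by apply: IE => //; exact: zord1.
  by rewrite mulr1 nm1 mul1r.
have [n /asboolP [n0 [a aI ha]] nmin] := ex_minnP exP.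
have a0 : a != 0.
  by apply: contraTneq n0 => a0; move: ha; rewrite a0 nm0 mul0r => /esym/eqP; rewrite pnatr_eq0 => /eqP ->.
have ua := imquad_unit hq a0.
exists a => // m mM.
have yus : a * m * a^-1 \in <<us>>%VS by rewrite (span_basis ub) memvf.
have [t ht hn] := cover_strict us1 euclid_size cov yus.
pose z := a * m - t * a; have zI : I z by apply: zspanB; [exact: Ir|exact: Il].
have nz : nm z < nm a.
  have -> : z = (a * m * a^-1 - t) * a by rewrite mulrBl mulrVK.
  by rewrite nmM gtr_pMl // nm_gt0.
suff z0 : z = 0.
  move/eqP: z0; rewrite subr_eq0 => /eqP ->; by rewrite mulrK.
apply/eqP/negPn/negP => z0.
have /intrP [k hk] := hD z zI.
have D0' : 0 < D%:R :> rat by rewrite ltr0n.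
have k0 : 0 < k by rewrite -(ltr_int rat) -hk mulr_gt0 // nm_gt0.
have kn : k < n by rewrite -(ltr_int rat) -hk -pmulrn -ha ltr_pM2r.
have /nmin : P `|k|%N.
  apply/asboolP; split; first by rewrite absz_gt0 gt_eqF.
  by exists z => //; rewrite hk -{1}(gez0_abs (ltW k0)) -pmulrn.
by rewrite leqNgt -ltz_nat (gez0_abs (ltW k0)) kn.
Qed.

(** By [euclid_conjugate], [M] lies in the conjugate [M'] of the order spanned by [us], so
    maximality gives equality. Conjugation preserves norms, and the conjugates of [us] are then
    spanning units of [M]. *)
Lemma euclid_unit_zbasis : unit_zbasis (M : nzRingType).
Proof.
have [a a0 hM] := euclid_conjugate; have ua := imquad_unit hq a0.
pose f y := a * y * a^-1; pose g y := a^-1 * y * a.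
have fg y : f (g y) = y by rewrite /f /g !mulrA divrr // mul1r mulrK.
have gf y : g (f y) = y by rewrite /f /g !mulrA mulVr // mul1r mulrVK.
have fB : {morph f : x y / x - y} by move=> x y; rewrite /f mulrBr mulrBl.
have gB : {morph g : x y / x - y} by move=> x y; rewrite /g mulrBr mulrBl.
have gD : {morph g : x y / x + y} by move=> x y; rewrite /g mulrDr mulrDl.
have fM : {morph f : x y / x * y} by move=> x y; rewrite /f !mulrA mulrVK.
have fZ c : {morph f : x / c *: x} by move=> x; rewrite /f -scalerAr -scalerAl.
have gZ c : {morph g : x / c *: x} by move=> x; rewrite /g -scalerAr -scalerAl.
pose M'p : {pred B} := fun y => `[< zspan us (f y) >].
have M'E y : (y \in M'p) <-> zspan us (f y) by split=> /asboolP.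
have sr : subring_closed M'p.
  split=> [|x y /M'E hx /M'E hy|x y /M'E hx /M'E hy]; apply/M'E.
  - by rewrite /f mulr1 divrr.
  - by rewrite fB; apply: zspanB.
  - by rewrite fM; apply: zspan_mul.
have fgen : exists L : seq B, forall x, x \in M'p <-> zspan L x.
  exists (map g us) => x; split=> [/M'E /(zspan_map gB)|/(zspan_map fB)]; first by rewrite gf.
  move=> h; apply/M'E; move: h; rewrite -map_comp (eq_map (g := id)) ?map_id //.
have full : exists2 L : seq B, basis_of fullv L & {subset L <= M'p}.
  apply: basis_of_scale => y; have [k [k0 hk]] := zspan_scale ub (f y).
  by exists k; split=> //; apply/M'E; rewrite fZ.
pose M' := ZOrder sr fgen full.
have M'M : {subset M' <= M}.
  by apply: maxM => m mM; apply/M'E; exact: hM.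
apply: (unit_zbasis_of_span (hq := hq) (L := map g us)).
  move=> _ /mapP [u uus ->]; split.
    by apply: M'M; apply/M'E; rewrite fg; exact: zspan_mem.
  rewrite /g !nmM (us1 uus) mulr1; have := congr1 nm (mulVr ua).
  by rewrite nmM nm1.
apply/vspaceP => y; rewrite memvf -(gf y); apply: span_map_fun => //.
by rewrite (span_basis ub) memvf.
Qed.

End Euclid.

Section Values.
Variables (A : falgType rat) (hq : imquad A).
Local Notation nm := (qnm hq).
Local Notation tr := (qtr hq).
Local Notation cj := (qcj hq).

(** [qtr] and [qnm] come from a choice; this evaluates them on explicit elements. *)
Lemma tr_nm_unique x t n : x * x = t *: x - n%:A -> t ^+ 2 < 4 * n -> tr x = t /\ nm x = n.
Proof.
move=> h h2; have py : pure (x - (t / 2)%:A).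
  exists (n - t ^+ 2 / 4); first by rewrite subr_ge0; lra.
  rewrite addrC -scaleNr sqr_addl h -addrA [X in _ + X](_ : _ = (- n)%:A).
    by rewrite -scalerDl; congr (_ *: _); field.
  rewrite addrA -scalerDl (_ : 2 * - (t / 2) + t = 0); last by field.
  by rewrite scale0r sub0r scaleNr.
have tx : tr x = t.
  by have := tr_uniq hq (t / 2) py; rewrite addrC subrK => ->; rewrite mulrC divfK.
split=> //; have [h' _] := trP hq x; move: h'; rewrite h tx => /addrI/oppr_inj.
by move/(@scalar_inj A).
Qed.

Lemma quadratic_order_mul w : nm w = 1 -> tr w \is a Num.int ->
  forall u v, u \in [:: 1; w] -> v \in [:: 1; w] -> zspan [:: 1; w] (u * v).
Proof.
move=> nw /intrP [m tw] u v; have s1 : zspan [:: 1; w] 1 by apply/zspan_mem; rewrite mem_head.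
have sw : zspan [:: 1; w] w by apply/zspan_mem; rewrite !inE eqxx orbT.
rewrite !inE => /orP [] /eqP -> /orP [] /eqP ->; rewrite ?mul1r ?mulr1 //.
by rewrite unit_sqr // tw scaler_int; apply: zspanB => //; apply: zspanMz.
Qed.

(** The only product that is not immediate is [w * i]. Adding its conjugate, which is [i * w - i],
    gives the integer [e], and this expresses it in the basis. *)
Lemma quaternion_order_mul w i (e : int) : nm w = 1 -> tr w = 1 -> nm i = 1 -> tr i = 0 ->
  tr (w * i) = e%:~R ->
  forall u v, u \in [:: 1; w; i; i * w] -> v \in [:: 1; w; i; i * w] ->
  zspan [:: 1; w; i; i * w] (u * v).
Proof.
move=> nw tw ni ti twi; set L := [:: 1; w; i; i * w].
have s1 : zspan L 1 by apply/zspan_mem; rewrite !inE eqxx.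
have sw : zspan L w by apply/zspan_mem; rewrite !inE eqxx ?orbT.
have si : zspan L i by apply/zspan_mem; rewrite !inE eqxx ?orbT.
have sk : zspan L (i * w) by apply/zspan_mem; rewrite !inE eqxx ?orbT.
have ww : w * w = w - 1 by rewrite unit_sqr // tw scale1r.
have ii : i * i = - 1 by rewrite unit_sqr // ti scale0r sub0r.
have cw : cj w = 1 - w by rewrite /qcj tw scale1r.
have ci : cj i = - i by rewrite /qcj ti scale0r sub0r.
have wi : w * i = 1 *~ e + i - i * w.
  have := add_cj hq (w * i); rewrite cjM cw ci twi scaler_int mulNr mulrBr mulr1 opprB => <-.
  by rewrite addrA subrK addrK.
have wk : w * (i * w) = w *~ e + i.
  by rewrite mulrA wi mulrBl mulrDl mulrzl -(mulrA i) ww mulrBr mulr1 opprB addrA addrAC addrK.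
have Li v : v \in L -> zspan L (i * v).
  rewrite !inE => /or4P [] /eqP -> //; first by rewrite mulr1.
    by rewrite ii; apply: zspanN.
  by rewrite mulrA ii mulN1r; apply: zspanN.
have Lw v : v \in L -> zspan L (w * v).
  rewrite !inE => /or4P [] /eqP ->; first by rewrite mulr1.
  - by rewrite ww; apply: zspanB.
  - by rewrite wi; apply: zspanB => //; apply: zspanD => //; apply: zspanMz.
  by rewrite wk; apply: zspanD => //; apply: zspanMz.
have zl x y : (forall v, v \in L -> zspan L (x * v)) -> zspan L y -> zspan L (x * y).
  move=> h; apply: (zspan_sub (P := fun y => zspan L (x * y))) => //.
    by rewrite mulr0; exact: zspan0.
  by move=> a b ha hb; rewrite mulrBr; apply: zspanB.
move=> u v; rewrite [u \in _]inE !in_cons in_nil orbF => /or4P [] /eqP -> vL.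
- by rewrite mul1r; exact: zspan_mem.
- exact: Lw.
- exact: Li.
by rewrite -mulrA; apply: zl => //; exact: Lw.
Qed.
End Values.

Lemma imquad_rat : imquad rat^o.
Proof.
move=> x; exists (2 * x), (x ^+ 2); split.
  by rewrite -[RHS]/(2 * x * x - x ^+ 2 * 1 : rat) -[LHS]/(x * x : rat); ring.
by right; rewrite -[RHS]/(2 * x / 2 * 1 : rat); field.
Qed.

Lemma maximal_unit_zbasis_rat (M : zorder rat^o) : maximal_order M -> unit_zbasis (M : nzRingType).
Proof.
have fr : free [:: 1 : rat^o] by rewrite seq1_free oner_eq0.
have bas : basis_of fullv [:: 1 : rat^o].
  by rewrite /basis_of fr andbT (free_span_full fr) // dimvf.
apply: (@euclid_unit_zbasis _ imquad_rat [:: 1]) => //.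
- by move=> u; rewrite inE => /eqP ->; rewrite nm1.
- by left.
- by apply/zspan_mem; rewrite inE.
by move=> u v; rewrite !inE => /eqP -> /eqP ->; rewrite mulr1; apply/zspan_mem; rewrite inE.
Qed.

Section QuadraticUnits.
Variable d : rat.
Hypothesis d0 : d < 0.
Local Notation X := (quadraticX d).

Lemma quadratic_coord (x : quadratic d) : exists a b, x = a%:A + b *: X.
Proof.
have : x \in <<[:: 1%R; X]>>%VS.
  by rewrite (free_span_full (quadratic_free d)) ?memvf ?quadratic_dim.
by move/span_coord2.
Qed.

Lemma imquad_quadratic : imquad (quadratic d).
Proof.
move=> x; have [a [b ->]] := quadratic_coord x.
exists (2 * a), (a ^+ 2 - d * b ^+ 2); split.
  rewrite (mul_quadratic _ _ _ _ (quadraticX_sqr d)) scalerDr !scalerA addrAC -scalerBl.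
  by congr (_ *: _ + _ *: _); ring.
have [->|b0] := eqVneq b 0; first by right; rewrite scale0r addr0; congr (_ *: _); field.
left; have : 0 < - d * b ^+ 2 by rewrite mulr_gt0 ?oppr_gt0 // exprn_even_gt0.
by rewrite expr2; lra.
Qed.

Lemma maximal_unit_zbasis_quadratic (w : quadratic d) (t : int) : w * w = t%:~R *: w - 1 ->
  t%:~R ^+ 2 < 4 :> rat -> free [:: 1; w] -> forall M : zorder (quadratic d),
  maximal_order M -> unit_zbasis (M : nzRingType).
Proof.
move=> ww t4 fr M maxM.
have [tw nw] : qtr imquad_quadratic w = t%:~R /\ qnm imquad_quadratic w = 1.
  by apply: tr_nm_unique; rewrite ?scale1r // mulr1.
have bas : basis_of fullv [:: 1; w].
  by rewrite /basis_of fr andbT (free_span_full fr) // quadratic_dim.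
apply: (@euclid_unit_zbasis _ imquad_quadratic [:: 1; w]) => //.
- by move=> u; rewrite !inE => /orP [] /eqP ->; rewrite ?nm1.
- by left.
- by apply/zspan_mem; rewrite inE eqxx.
by apply: (quadratic_order_mul nw); rewrite tw intr_int.
Qed.

End QuadraticUnits.

Lemma maximal_unit_zbasis_quadratic1 (M : zorder (quadratic (-1))) :
  maximal_order M -> unit_zbasis (M : nzRingType).
Proof.
apply: (@maximal_unit_zbasis_quadratic (-1) _ (quadraticX (-1)) 0) => //; last exact: quadratic_free.
by rewrite quadraticX_sqr scale0r sub0r scaleN1r.
Qed.

Lemma maximal_unit_zbasis_quadratic3 (M : zorder (quadratic (-3))) :
  maximal_order M -> unit_zbasis (M : nzRingType).
Proof.
pose X := quadraticX (-3); pose w := (1 / 2)%:A + (1 / 2) *: X.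
apply: (@maximal_unit_zbasis_quadratic (-3) _ w 1) => //.
  rewrite (mul_quadratic _ _ _ _ (quadraticX_sqr (-3))) /w scale1r.
  rewrite [RHS]addrAC -[X in _ = _ - X + _](scale1r 1) -scalerBl.
  by congr (_ *: _ + _ *: _); field.
apply: free_scalar => a h.
have : (1 / 2 - a)%:A + (1 / 2) *: X = 0.
  by rewrite scalerBl addrAC -[_ + _ *: X]/w h subrr.
by move/(free_coord2 (quadratic_free (-3))) => [_ /eqP].
Qed.

Section QuaternionUnits.
Variables u v : rat.
Hypotheses (u0 : u < 0) (v0 : v < 0).
Local Notation Q := (quaternion u v).

Lemma imquad_quaternion : imquad Q.
Proof.
case=> a b c d; exists (2 * a), (a ^+ 2 - u * b ^+ 2 - v * c ^+ 2 + u * v * d ^+ 2); split.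
  by congr Quaternion => /=; ring.
have [h|h] := boolP [&& b == 0, c == 0 & d == 0].
  case/and3P: h => /eqP -> /eqP -> /eqP ->; right.
  by congr Quaternion => /=; field.
left; have ub : 0 <= - u * b ^+ 2 by rewrite mulr_ge0 ?sqr_ge0 // oppr_ge0 ltW.
have vc : 0 <= - v * c ^+ 2 by rewrite mulr_ge0 ?sqr_ge0 // oppr_ge0 ltW.
have uv : 0 < u * v by rewrite nmulr_rgt0.
have uvd : 0 <= u * v * d ^+ 2 by rewrite mulr_ge0 ?sqr_ge0 // ltW.
suff : 0 < - u * b ^+ 2 + - v * c ^+ 2 + u * v * d ^+ 2 by rewrite exprMn; lra.
rewrite lt_def !addr_ge0 // andbT; apply: contra h.
rewrite !paddr_eq0 ?addr_ge0 // !mulf_eq0 !oppr_eq0 (lt_eqF u0) (lt_eqF v0) /= ?orbb ?sqrf_eq0 ?orbb.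
by rewrite -andbA.
Qed.

Lemma maximal_unit_zbasis_quaternion (w i : Q) (e : int) : w * w = w - 1 -> i * i = - 1 ->
  qtr imquad_quaternion (w * i) = e%:~R -> free [:: 1; w; i; i * w] ->
  forall M : zorder Q, maximal_order M -> unit_zbasis (M : nzRingType).
Proof.
move=> ww ii twi fr M maxM.
have [tw nw] : qtr imquad_quaternion w = 1 /\ qnm imquad_quaternion w = 1.
  by apply: tr_nm_unique; rewrite ?scale1r // mulr1 expr1n.
have [ti ni] : qtr imquad_quaternion i = 0 /\ qnm imquad_quaternion i = 1.
  by apply: tr_nm_unique; rewrite ?scale0r ?sub0r ?scale1r // mulr1 expr0n.
have d4 : \dim {: Q} = 4%N.
  have b := quat_basis u v; rewrite -(span_basis b).
  by move: (basis_free b); rewrite /free => /eqP ->.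
have bas : basis_of fullv [:: 1; w; i; i * w].
  by rewrite /basis_of fr andbT (free_span_full fr).
apply: (@euclid_unit_zbasis _ imquad_quaternion [:: 1; w; i; i * w]) => //.
- by move=> x; rewrite !inE => /or4P [] /eqP ->; rewrite ?nmM ?nm1 ?nw ?ni ?mulr1.
- right; exists w, 1; rewrite !inE !eqxx orbT; split=> //.
    by apply/eqP => w1; have := tw; rewrite w1 tr1.
  by rewrite bil1 tw.
- by apply/zspan_mem; rewrite inE eqxx.
exact: (quaternion_order_mul nw tw ni ti twi).
Qed.

End QuaternionUnits.

Lemma ltN10 : (-1 : rat) < 0. Proof. by []. Qed.
Lemma ltN30 : (-3 : rat) < 0. Proof. by []. Qed.

Lemma maximal_unit_zbasis_quaternion1 (M : zorder (quaternion (-1 : rat) (-1))) :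
  maximal_order M -> unit_zbasis (M : nzRingType).
Proof.
(* A Hurwitz unit: [1], [w], [i], [i * w] span the Hurwitz order. The sign of its second coordinate
   makes the trace of [w * i] equal to 1. *)
pose w := Quaternion (-1) (-1) (1 / 2 : rat) (- (1 / 2)) (1 / 2) (1 / 2).
pose i := quatI (-1 : rat) (-1).
apply: (@maximal_unit_zbasis_quaternion _ _ ltN10 ltN10 w i 1).
- by congr Quaternion => /=; field.
- by congr Quaternion => /=; ring.
- have h : (w * i) * (w * i) = (1 : rat) *: (w * i) - (1 : rat)%:A.
    by congr Quaternion => /=; field.
  by have [] := tr_nm_unique (imquad_quaternion ltN10 ltN10) h isT.
apply/(@freeP _ _ _ [tuple 1; w; i; i * w]) => k; rewrite !big_ord_recl big_ord0 addr0 /=.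
set k0 := k _; set k1 := k _; set k2 := k _; set k3 := k _.
move=> E; have h1 := congr1 (@qre _ _ _) E; have h2 := congr1 (@qi _ _ _) E.
have h3 := congr1 (@qj _ _ _) E; have h4 := congr1 (@qk _ _ _) E.
rewrite /= in h1 h2 h3 h4.
have e0 : k0 = 0 by lra.
have e1 : k1 = 0 by lra.
have e2 : k2 = 0 by lra.
have e3 : k3 = 0 by lra.
case=> -[|[|[|[|//]]]] hi.
- by rewrite -[RHS]e0; congr (k _); apply: val_inj.
- by rewrite -[RHS]e1; congr (k _); apply: val_inj.
- by rewrite -[RHS]e2; congr (k _); apply: val_inj.
by rewrite -[RHS]e3; congr (k _); apply: val_inj.
Qed.

Lemma maximal_unit_zbasis_quaternion3 (M : zorder (quaternion (-1 : rat) (-3))) :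
  maximal_order M -> unit_zbasis (M : nzRingType).
Proof.
(* [w] is (1 + j) / 2 with j^2 = -3, a sixth root of unity orthogonal to [i]. *)
pose w := Quaternion (-1) (-3) (1 / 2 : rat) 0 (1 / 2) 0.
pose i := quatI (-1 : rat) (-3).
apply: (@maximal_unit_zbasis_quaternion _ _ ltN10 ltN30 w i 0).
- by congr Quaternion => /=; field.
- by congr Quaternion => /=; ring.
- have h : (w * i) * (w * i) = (0 : rat) *: (w * i) - (1 : rat)%:A.
    by congr Quaternion => /=; field.
  by have [] := tr_nm_unique (imquad_quaternion ltN10 ltN30) h isT.
apply/(@freeP _ _ _ [tuple 1; w; i; i * w]) => k; rewrite !big_ord_recl big_ord0 addr0 /=.
set k0 := k _; set k1 := k _; set k2 := k _; set k3 := k _.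
move=> E; have h1 := congr1 (@qre _ _ _) E; have h2 := congr1 (@qi _ _ _) E.
have h3 := congr1 (@qj _ _ _) E; have h4 := congr1 (@qk _ _ _) E.
rewrite /= in h1 h2 h3 h4.
have e1 : k1 = 0 by lra.
have e0 : k0 = 0 by lra.
have e3 : k3 = 0 by lra.
have e2 : k2 = 0 by lra.
case=> -[|[|[|[|//]]]] hi.
- by rewrite -[RHS]e0; congr (k _); apply: val_inj.
- by rewrite -[RHS]e1; congr (k _); apply: val_inj.
- by rewrite -[RHS]e2; congr (k _); apply: val_inj.
by rewrite -[RHS]e3; congr (k _); apply: val_inj.
Qed.

Lemma unit_zbasis_lipschitz : unit_zbasis (lipschitz : nzRingType).
Proof.
have hq := imquad_quaternion ltN10 ltN10.
apply: (unit_zbasis_of_span (hq := hq) (L := [:: 1; quatI _ _; quatJ _ _; quatK _ _])); last first.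
  exact: (span_basis (quat_basis _ _)).
have sq (x : quaternion (-1 : rat) (-1)) : x * x = - 1 -> qnm hq x = 1.
  move=> xx; have [] // := @tr_nm_unique _ hq x 0 1 _ isT.
  by rewrite xx scale0r sub0r scale1r.
move=> x; rewrite !inE => /or4P [] /eqP ->; split.
- exact: zord1.
- exact: nm1.
- by apply/and4P; split; rewrite /= ?rpred0 ?rpred1.
- by apply: sq; congr Quaternion => /=; ring.
- by apply/and4P; split; rewrite /= ?rpred0 ?rpred1.
- by apply: sq; congr Quaternion => /=; ring.
- by apply/and4P; split; rewrite /= ?rpred0 ?rpred1.
by apply: sq; congr Quaternion => /=; ring.
Qed.

(** * Orthogonal unit bases and the Lipschitz order *)

Section Lipschitz.
Variables (A : falgType rat) (hq : imquad A) (O : zorder A) (us : seq A).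
Local Notation nm := (qnm hq).
Local Notation tr := (qtr hq).
Local Notation cj := (qcj hq).
Local Notation bil := (qbil hq).
Hypotheses (ul : unit_list hq O us) (ub : basis_of fullv us).
Hypothesis uspan : forall x, x \in O <-> zspan us x.

(** Dividing the basis by its first member gives an orthogonal basis 1, [i], [j], [l] of [O]. The
    product [i * j] lies in [O] and is orthogonal to 1, [i] and [j], hence an integer multiple of
    [l]; both have norm 1, so it is [l] up to sign. *)
Lemma class_dim4_lipschitz : \dim {:A} = 4%N -> ~ nonortho hq us -> ring_iso (O : nzRingType) lipschitz.
Proof.
move=> d4 no; have fr := basis_free ub; have [_ us1] := ul.
have uu := free_uniq fr; have su : size us = 4%N by rewrite (basis_size ub).
have orth u v : u \in us -> v \in us -> u != v -> bil u v = 0.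
  by move=> uus vus uv; apply/eqP/negPn/negP => b0; apply: no; exists u, v.
case: us su fr us1 uu orth {no} ub uspan ul => [|a [|b [|c [|d [|]]]]] // _ fr us1 uu orth ub' uspan' _.
have [aO na] := us1 a (mem_head _ _).
have [bO nb] : b \in O /\ nm b = 1 by apply: us1; rewrite !inE eqxx ?orbT.
have [cO nc] : c \in O /\ nm c = 1 by apply: us1; rewrite !inE eqxx ?orbT.
have [dO nd] : d \in O /\ nm d = 1 by apply: us1; rewrite !inE eqxx ?orbT.
move: uu; rewrite /= !inE !negb_or andbT => /and3P [/and3P [ab ac ad] /andP [bc bd] cd].
have oab : bil a b = 0 by apply: orth; rewrite ?inE ?eqxx ?orbT.
have oac : bil a c = 0 by apply: orth; rewrite ?inE ?eqxx ?orbT.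
have oad : bil a d = 0 by apply: orth; rewrite ?inE ?eqxx ?orbT.
have obc : bil b c = 0 by apply: orth; rewrite ?inE ?eqxx ?orbT.
have obd : bil b d = 0 by apply: orth; rewrite ?inE ?eqxx ?orbT.
have ocd : bil c d = 0 by apply: orth; rewrite ?inE ?eqxx ?orbT.
have ca : cj a * a = 1 by rewrite mulcj na scale1r.
have ac1 : a * cj a = 1 by rewrite mul_cj na scale1r.
have bilM x y : bil (cj a * x) (cj a * y) = bil x y.
  by have := nmD hq (cj a * x) (cj a * y); rewrite -mulrDr !nmM nm_cj na !mul1r nmD => /addrI ->.
pose i := cj a * b; pose j := cj a * c; pose l := cj a * d.
have caO : cj a \in O by apply: order_cj.
have iO : i \in O by apply: zordM.
have jO : j \in O by apply: zordM.
have ni : nm i = 1 by rewrite nmM nm_cj na nb mulr1.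
have nj : nm j = 1 by rewrite nmM nm_cj na nc mulr1.
have ti : tr i = 0 by rewrite -bil1 -ca bilM bilC.
have tj : tr j = 0 by rewrite -bil1 -ca bilM bilC.
have bij : bil i j = 0 by rewrite bilM.
have gP := class_quaternion (u := -1) (v := -1) d4 ti tj bij
  (etrans ni (esym (opprK 1))) (etrans nj (esym (opprK 1))) isT isT.
set g := fun q => _ in gP.
pose k := i * j.
have OE x : x \in O -> exists p q r s : int, x = p%:~R%:A + q%:~R *: i + r%:~R *: j + s%:~R *: l.
  move=> xO; have /uspan' : a * x \in O by apply: zordM.
  move=> [e he]; exists (e ord0), (e (@Ordinal 4 1 isT)), (e (@Ordinal 4 2 isT)), (e (@Ordinal 4 3 isT)).
  have -> : x = cj a * (a * x) by rewrite mulrA ca mul1r.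
  rewrite he !big_ord_recl big_ord0 /= addr0 !mulrDr -!scaler_int -!scalerAr ca !addrA.
  by congr (_ *: _ + _ *: _ + _ *: _ + _ *: _); congr (_%:~R); congr (e _); apply: val_inj.
have nk : nm k = 1 by rewrite nmM ni nj mulr1.
have fr4 : free [:: 1; i; j; k].
  by apply: (quaternion_basis (hq := hq)) => //; rewrite -(nm_eq0 hq) ?ni ?nj oner_eq0.
have kO : k \in O by apply: zordM.
have cjj : cj j = - j by rewrite /qcj tj scale0r sub0r.
have bk1 : bil k 1 = 0.
  by rewrite bil1 /k -[j in i * j]opprK -cjj mulrN trN -/(bil i j) bij oppr0.
have bki : bil k i = 0.
  by rewrite /qbil (tr_mulC hq) mulrA mulcj -scalerAl mul1r trZ tj mulr0.
have bkj : bil k j = 0.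
  by rewrite /qbil -mulrA mul_cj -scalerAr mulr1 trZ ti mulr0.
have lk : exists e : int, l = e%:~R *: k.
  have [p [q [r [s kE]]]] := OE k kO.
  have bl1 : bil l 1 = 0 by rewrite -ca bilM bilC.
  have bli : bil l i = 0 by rewrite bilM bilC.
  have blj : bil l j = 0 by rewrite bilM bilC.
  have p0 : p%:~R = 0 :> rat.
    have := bk1; rewrite kE !bilDl !bilZl bl1 !bil1 tr1 ti tj !mulr0 !addr0 => /eqP.
    by rewrite mulf_eq0 orbF => /eqP.
  have q0 : q%:~R = 0 :> rat.
    have := bki; rewrite kE !bilDl !bilZl bli bilxx ni [bil 1 i]bilC bil1 ti [bil j i]bilC bij.
    by rewrite !mulr0 !addr0 add0r => /eqP; rewrite mulf_eq0 orbF => /eqP.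
  have r0 : r%:~R = 0 :> rat.
    have := bkj; rewrite kE !bilDl !bilZl blj bilxx nj [bil 1 j]bilC bil1 tj bij.
    by rewrite !mulr0 !addr0 !add0r => /eqP; rewrite mulf_eq0 orbF => /eqP.
  rewrite p0 q0 r0 !scale0r !add0r in kE; exists s.
  have nl : nm l = 1 by rewrite nmM nm_cj na nd mulr1.
  have := nk; rewrite kE nmZ nl mulr1.
  by move=> s2; rewrite scalerA -expr2 s2 scale1r.
have [e lE] := lk.
apply: (order_ring_iso gP) => y; apply/idP/idP.
  case/and4P => /intrP [m0 h0] /intrP [m1 h1] /intrP [m2 h2] /intrP [m3 h3].
  rewrite /g h0 h1 h2 h3; apply: zordD; last exact: zordZz.
  by apply: zordD; [apply: zordD|]; apply: zordZz => //; exact: zord1.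
move=> /OE [p [q [r [s]]]]; rewrite lE scalerA -intrM => hy.
have : g (y - Quaternion (-1) (-1) p%:~R q%:~R r%:~R (s * e)%:~R) = 0.
  by have [_ gB _ _ _] := gP; rewrite gB hy subrr.
rewrite /g => /(free_coord4 fr4) [] /= /eqP e0 /eqP e1 /eqP e2 /eqP e3.
move: e0 e1 e2 e3; rewrite !subr_eq0 => /eqP e0 /eqP e1 /eqP e2 /eqP e3.
by apply/and4P; rewrite e0 e1 e2 e3 !intr_int.
Qed.

End Lipschitz.

(** * The abelianization of E_2 *)

Lemma gen_group_ind (G : groupType) (S : set G) (P : gen_group S -> Prop) :
  P 1%g -> (forall x y, P x -> P y -> P (x * y^-1)%g) ->
  (forall x, S (gen_val x) -> P x) -> forall x, P x.
Proof.
move=> P1 PD PS x.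
pose H : set G := [set g | exists2 y : gen_group S, gen_val y = g & P y].
have HG : group_closed (mem H).
  split; first by rewrite in_setE; exists 1%g.
  move=> a b; rewrite !in_setE => -[y <- Py] [z <- Pz].
  by exists (y * z^-1)%g; [|exact: PD].
have SH : S `<=` H.
  move=> g Sg; have gg : g \in gen_subgroup S by rewrite in_setE; exact: sub_gen_subgroup.
  by exists (GenGroup gg); [|exact: PS].
have : gen_subgroup S (gen_val x) by have := valP x; rewrite /= in_setE.
by move=> /(_ H (conj HG SH)) [y /val_inj ->].
Qed.

Section Ab.
Variable G : groupType.
Local Notation ab := (abelianization G).
Definition abpi (g : G) : ab := \pi_ab%qT g.

Lemma abpiM g h : abpi (g * h)%g = abpi g + abpi h.
Proof. exact: (esym (ab_addE g h)). Qed.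

Lemma abpi1 : abpi 1%g = 0. Proof. by []. Qed.

Lemma abpiV g : abpi g^-1%g = - abpi g.
Proof. exact: (esym (ab_oppE g)). Qed.

Lemma abpi_surj (a : ab) : exists g, a = abpi g.
Proof. by elim/quotW: a => g; exists g. Qed.

Lemma derived_kernel (V : zmodType) (F : G -> V) :
  (forall x y, F (x * y)%g = F x + F y) -> forall g, g \in @derived G -> F g = 0.
Proof.
move=> FM g; have F1 : F 1%g = 0 by apply: (addrI (F 1%g)); rewrite -FM mulg1 addr0.
have FV x : F x^-1%g = - F x by apply/eqP; rewrite -addr_eq0 -FM mulVg F1.
rewrite in_setE => /(_ [set g | F g = 0]) /= ; apply; split.
  split; first by rewrite in_setE.
  by move=> x y; rewrite !in_setE /= => hx hy; rewrite FM FV hx hy subrr.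
move=> _ [x [y ->]] /=; rewrite /commg /conjg !FM !FV.
by rewrite addrCA addKr addNr.
Qed.
End Ab.

Section M2.
Variable R : nzRingType.
Implicit Types (a b c d x y : R).

Definition m2 a b c d : 'M[R]_2 :=
  \matrix_(i, j) if i == 0 then (if j == 0 then a else b) else (if j == 0 then c else d).

Lemma m2M a b c d a' b' c' d' : m2 a b c d * m2 a' b' c' d' =
  m2 (a * a' + b * c') (a * b' + b * d') (c * a' + d * c') (c * b' + d * d').
Proof.
apply/matrixP => i j; rewrite !mxE !big_ord_recl big_ord0 addr0 !mxE /=.
by case: i => [[|[|//]] hi]; case: j => [[|[|//]] hj].
Qed.

Lemma m2_1 : m2 1 0 0 1 = 1.
Proof.
by apply/matrixP => i j; rewrite !mxE; case: i => [[|[|//]] hi]; case: j => [[|[|//]] hj].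
Qed.

Lemma m2_inj a b c d a' b' c' d' : m2 a b c d = m2 a' b' c' d' ->
  [/\ a = a', b = b', c = c' & d = d'].
Proof.
move=> h; split.
- by have := congr1 (fun A : 'M[R]_2 => A 0 0) h; rewrite !mxE.
- by have := congr1 (fun A : 'M[R]_2 => A 0 1) h; rewrite !mxE.
- by have := congr1 (fun A : 'M[R]_2 => A 1 0) h; rewrite !mxE.
- by have := congr1 (fun A : 'M[R]_2 => A 1 1) h; rewrite !mxE.
Qed.

Lemma m2_upper x : 1 + x *: delta_mx 0 1 = m2 1 x 0 1.
Proof.
by apply/matrixP => i j; rewrite !mxE; case: i => [[|[|//]] hi]; case: j => [[|[|//]] hj];
  rewrite /= ?mulr1 ?mulr0 ?addr0 ?add0r.
Qed.

Lemma m2_lower x : 1 + x *: delta_mx 1 0 = m2 1 0 x 1.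
Proof.
by apply/matrixP => i j; rewrite !mxE; case: i => [[|[|//]] hi]; case: j => [[|[|//]] hj];
  rewrite /= ?mulr1 ?mulr0 ?addr0 ?add0r.
Qed.

Lemma elementary2P (g : GL2 R) : elementary2 g ->
  exists x, unit_val g = m2 1 x 0 1 \/ unit_val g = m2 1 0 x 1.
Proof.
move=> [i [j [x [ij _ ->]]]]; exists x; rewrite -m2_upper -m2_lower.
by case: i ij => [[|[|//]] hi]; case: j => [[|[|//]] hj] // _; [left|right];
  congr (1 + x *: delta_mx _ _); apply: val_inj.
Qed.

Lemma upper_subproof x : m2 1 x 0 1 \in @ring_units 'M[R]_2.
Proof.
rewrite in_setE; exists (m2 1 (- x) 0 1).
by rewrite !m2M !(mul1r, mulr1, mul0r, mulr0, addr0, add0r) subrr addNr m2_1.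
Qed.

Lemma lower_subproof x : m2 1 0 x 1 \in @ring_units 'M[R]_2.
Proof.
rewrite in_setE; exists (m2 1 0 (- x) 1).
by rewrite !m2M !(mul1r, mulr1, mul0r, mulr0, addr0, add0r) subrr addNr m2_1.
Qed.

Definition upper x : GL2 R := UnitGroup (upper_subproof x).
Definition lower x : GL2 R := UnitGroup (lower_subproof x).

Lemma elementary_upper x : upper x \in gen_subgroup (@elementary2 R).
Proof.
have [->|x0] := eqVneq x 0.
  have -> : upper 0 = 1%g by apply: val_inj; rewrite /= m2_1.
  exact: (proj1 (gen_subgroup_closed _)).
rewrite in_setE; apply: sub_gen_subgroup; exists 0, 1, x; split=> //.
by rewrite m2_upper.
Qed.

Lemma elementary_lower x : lower x \in gen_subgroup (@elementary2 R).
Proof.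
have [->|x0] := eqVneq x 0.
  have -> : lower 0 = 1%g by apply: val_inj; rewrite /= m2_1.
  exact: (proj1 (gen_subgroup_closed _)).
rewrite in_setE; apply: sub_gen_subgroup; exists 1, 0, x; split=> //.
by rewrite m2_lower.
Qed.

Definition eupper x : E2 R := GenGroup (elementary_upper x).
Definition elower x : E2 R := GenGroup (elementary_lower x).

Definition e2val (g : E2 R) : 'M[R]_2 := unit_val (gen_val g).

Lemma e2val_inj : injective e2val.
Proof. by move=> g h; move/val_inj/val_inj. Qed.

Lemma e2valM g h : e2val (g * h)%g = e2val g * e2val h. Proof. by []. Qed.
Lemma e2val1 : e2val 1%g = 1. Proof. by []. Qed.

Definition phi x : abelianization (E2 R) := abpi (eupper x).

Lemma phiD : {morph phi : x y / x + y}.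
Proof.
move=> x y; rewrite -abpiM; congr abpi; apply: e2val_inj.
rewrite e2valM /e2val /= m2M !(mul1r, mulr1, mul0r, mulr0, addr0, add0r).
by rewrite addrC.
Qed.

Lemma phiB : {morph phi : x y / x - y}.
Proof.
move=> x y; apply/eqP; rewrite eq_sym subr_eq -phiD subrK; exact: eqxx.
Qed.

(** The Weyl element [w], which is [[0, 1], [-1, 0]], conjugates lower elementary matrices into
    upper ones and changes the sign of the entry. *)
Lemma abpi_lower x : abpi (elower x) = phi (- x).
Proof.
pose w : E2 R := (eupper 1 * elower (-1) * eupper 1)%g.
have h : (w * eupper (- x) = elower x * w)%g.
  apply: e2val_inj; rewrite !e2valM /e2val /= !m2M.
  rewrite !(mul1r, mulr1, mul0r, mulr0, addr0, add0r, mulN1r, mulrN1, subrr, addNr).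
  by rewrite ?opprK.
have := congr1 (@abpi _) h; rewrite !(abpiM w) abpiM [RHS]addrC => /addrI <-.
by [].
Qed.

Lemma phi_surj (a : abelianization (E2 R)) : exists x, a = phi x.
Proof.
have [g ->] := abpi_surj a; elim/gen_group_ind: g => [|g h [x hx] [y hy]|g].
- exists 0; apply/eqP; rewrite -subr_eq0; apply/eqP.
  by rewrite abpi1; have := phiB 0 0; rewrite !subrr sub0r => ->; rewrite oppr0.
- by exists (x - y); rewrite abpiM abpiV hx hy phiB.
move=> /elementary2P [x [h|h]]; [exists x|exists (- x)].
  by congr abpi; apply: e2val_inj.
by rewrite -abpi_lower; congr abpi; apply: e2val_inj.
Qed.

(* [[0, u], [- u^-1, 0]] is a product of three elementary matrices and its
   fourth power is 1, so 4 (2 phi u + phi u^-1) = 0. *)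
Lemma phi_unit u v : u * v = 1 -> v * u = 1 -> phi u *+ 12 = 0.
Proof.
have key a b : a * b = 1 -> b * a = 1 -> (phi a *+ 2 + phi b) *+ 4 = 0.
  move=> ab ba; pose w : E2 R := (eupper a * elower (- b) * eupper a)%g.
  have wE : e2val w = m2 0 a (- b) 0.
    rewrite !e2valM /e2val /= !m2M.
    by rewrite !(mul1r, mulr1, mul0r, mulr0, addr0, add0r, mulrN, mulNr, ab, ba, subrr, addNr).
  have ww : (w * w * (w * w) = 1)%g.
    apply: e2val_inj; rewrite (e2valM (w * w)%g) (e2valM w) wE !m2M e2val1.
    by rewrite !(mul1r, mulr1, mul0r, mulr0, addr0, add0r, mulrN, mulNr, ab, ba, opprK, oppr0) m2_1.
  have := congr1 (@abpi _) ww; rewrite !abpiM abpi_lower opprK abpi1 -/(phi a).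
  have -> : phi a + phi b + phi a = phi a *+ 2 + phi b by rewrite addrAC.
  by move=> h; rewrite -[RHS]h -!mulr2n -mulrnA.
move=> uv vu; have h1 := key _ _ uv vu; have h2 := key _ _ vu uv.
(* Twice the first relation minus the second eliminates [phi v] and leaves 16 - 4 = 12 copies of
   [phi u]. *)
have h : (phi u *+ 2 + phi v) *+ 4 *+ 2 - (phi v *+ 2 + phi u) *+ 4 = 0.
  by rewrite h1 h2 mul0rn subrr.
rewrite -[RHS]h (mulrnDl 4 (phi u *+ 2)) (mulrnDl 2 (phi u *+ 2 *+ 4)).
rewrite (mulrnDl 4 (phi v *+ 2)) -!mulrnA opprD addrA -[(4 * 2)%N]/8%N -[(2 * 4)%N]/8%N addrK.
by rewrite -[(2 * 8)%N]/16%N -mulrnBr.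
Qed.
End M2.

Section Words.
Variables (R : nzRingType) (V : zmodType) (lam : {additive R -> V}).
Hypothesis wsum_trivial : forall w : seq R, (forall s, wrun s w = s) -> wsum lam w = 0.
Implicit Types (w : seq R) (x : R).

Definition wmat w : 'M[R]_2 :=
  m2 (wrun (1, 0) w).1 (wrun (1, 0) w).2 (wrun (0, 1) w).1 (wrun (0, 1) w).2.

Lemma wrun_lin s w : wrun s w =
  (s.1 * (wrun (1, 0) w).1 + s.2 * (wrun (0, 1) w).1,
   s.1 * (wrun (1, 0) w).2 + s.2 * (wrun (0, 1) w).2).
Proof.
elim/last_ind: w s => [|w a ih] s; first by rewrite /= !mulr1 !mulr0 addr0 add0r -surjective_pairing.
rewrite !wrun_rcons /wstep ih /=; congr (_, _).
by rewrite !mulrBr !mulrDl !mulrA opprD addrACA.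
Qed.

Lemma wmat_cat w1 w2 : wmat (w1 ++ w2) = wmat w1 * wmat w2.
Proof.
rewrite /wmat m2M !wrun_cat.
rewrite [wrun (wrun (1, 0) w1) w2]wrun_lin [wrun (wrun (0, 1) w1) w2]wrun_lin /=.
by [].
Qed.

Lemma wmat_nil : wmat [::] = 1. Proof. exact: m2_1. Qed.

Lemma wmat_eq1 w : wmat w = 1 -> forall s, wrun s w = s.
Proof.
rewrite -m2_1 => /m2_inj [h1 h2 h3 h4] s; rewrite wrun_lin h1 h2 h3 h4.
by rewrite !mulr1 !mulr0 addr0 add0r -surjective_pairing.
Qed.

(* E(a)^-1 = E(0) E(- a) E(0). *)
Fixpoint winv w : seq R := if w is a :: w' then winv w' ++ [:: 0; - a; 0] else [::].

Lemma wmat_winv w : wmat w * wmat (winv w) = 1.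
Proof.
elim: w => [|a w ih] /=; first by rewrite wmat_nil mulr1.
rewrite -cat1s !wmat_cat mulrA -(mulrA (wmat [:: a])) ih mulr1 /wmat m2M /= -m2_1.
by rewrite !(mul1r, mulr1, mul0r, mulr0, addr0, add0r, sub0r, subr0)
  !(mulN1r, mulrN, mulNr, opprK, addNr, subrr, oppr0, mul1r, mulr1, mul0r, mulr0, addr0, add0r).
Qed.

Lemma wsum_winv w : wsum lam (winv w) = - wsum lam w.
Proof.
elim: w => [|a w ih] /=; first by rewrite wsum_nil oppr0.
by rewrite wsum_cat ih !wsum_cons wsum_nil raddf0 raddfN !addr0 add0r opprD addrC.
Qed.

(** Well-definedness: [w1] followed by the inverse word of [w2] has trivial product. *)
Lemma wsum_wmat w1 w2 : wmat w1 = wmat w2 -> wsum lam w1 = wsum lam w2.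
Proof.
move=> h; apply/eqP; rewrite -subr_eq0 -wsum_winv -wsum_cat; apply/eqP/wsum_trivial/wmat_eq1.
by rewrite wmat_cat h wmat_winv.
Qed.

Lemma e2_word (g : E2 R) : exists w, e2val g = wmat w.
Proof.
elim/gen_group_ind: g => [|g h [w1 h1] [w2 h2]|g]; first by exists [::]; rewrite wmat_nil.
  exists (w1 ++ winv w2); rewrite e2valM wmat_cat h1; congr (_ * _).
  have hh : e2val h * e2val h^-1%g = 1 by rewrite -e2valM mulgV.
  have hh' : e2val h^-1%g * e2val h = 1 by rewrite -e2valM mulVg.
  by rewrite -[LHS]mulr1 -(wmat_winv w2) -h2 mulrA hh' mul1r.
(* The upper matrix is E(- x) E(0)^3 and the lower one E(0) E(x) E(0)^2, where E(0)^2 = -1. *)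
move=> /elementary2P [x [h|h]]; [exists [:: - x; 0; 0; 0]|exists [:: 0; x; 0; 0]].
  rewrite /e2val h /wmat /=.
  by rewrite !(mul1r, mulr1, mul0r, mulr0, addr0, add0r, sub0r, subr0)
    !(mulN1r, mulrN, mulNr, opprK, addNr, subrr, oppr0, mul1r, mulr1, mul0r, mulr0, addr0, add0r).
rewrite /e2val h /wmat /=.
by rewrite !(mul1r, mulr1, mul0r, mulr0, addr0, add0r, sub0r, subr0)
  !(mulN1r, mulrN, mulNr, opprK, addNr, subrr, oppr0, mul1r, mulr1, mul0r, mulr0, addr0, add0r).
Qed.

Definition wPhi (g : E2 R) : V := wsum lam (sval (cid (e2_word g))).

Lemma wPhiE g w : e2val g = wmat w -> wPhi g = wsum lam w.
Proof. by rewrite /wPhi; case: cid => w' /= -> /wsum_wmat. Qed.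

Lemma wPhiM g h : wPhi (g * h)%g = wPhi g + wPhi h.
Proof.
have [w1 h1] := e2_word g; have [w2 h2] := e2_word h.
rewrite (wPhiE h1) (wPhiE h2) -wsum_cat; apply: wPhiE.
by rewrite e2valM h1 h2 wmat_cat.
Qed.

Lemma wPhi_upper x : wPhi (eupper x) = - lam x.
Proof.
rewrite (@wPhiE _ [:: - x; 0; 0; 0]).
  by rewrite !wsum_cons wsum_nil raddfN raddf0 !addr0.
rewrite /e2val /wmat /=.
by rewrite !(mul1r, mulr1, mul0r, mulr0, addr0, add0r, sub0r, subr0)
  !(mulN1r, mulrN, mulNr, opprK, addNr, subrr, oppr0, mul1r, mulr1, mul0r, mulr0, addr0, add0r).
Qed.

Definition abPhi (a : abelianization (E2 R)) : V := wPhi (repr a).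

Lemma abPhiE g : abPhi (abpi g) = wPhi g.
Proof.
have : abpi (repr (abpi g)) = abpi g by rewrite /abpi reprK.
move/pi_ab_eq/(derived_kernel wPhiM); rewrite wPhiM /abPhi.
have W1 : wPhi 1%g = 0 by apply: (addrI (wPhi 1%g)); rewrite -wPhiM mulg1 addr0.
have WV (x : E2 R) : wPhi x^-1%g = - wPhi x by apply/eqP; rewrite -addr_eq0 -wPhiM mulVg W1.
by rewrite WV => /eqP; rewrite addrC subr_eq0 => /eqP ->.
Qed.

Lemma abPhi_phi x : abPhi (phi x) = - lam x.
Proof. by rewrite abPhiE wPhi_upper. Qed.

End Words.

Lemma phi0 (R : nzRingType) : phi (0 : R) = 0.
Proof. by have := phiB (0 : R) 0; rewrite !subrr. Qed.

Lemma phiMz (R : nzRingType) (x : R) n : phi (x *~ n) = phi x *~ n.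
Proof.
have fD := @phiD R; have f0 := phi0 R.
have fN y : phi (- y) = - phi (y : R) by rewrite -sub0r phiB f0 sub0r.
have fn y m : phi (y *+ m) = phi (y : R) *+ m.
  by elim: m => [|m ih]; rewrite ?mulr0n // !mulrS fD ih.
by case: n => n; rewrite ?NegzE ?mulrNz ?fN -!pmulrn fn.
Qed.

(** [phi] is onto and each basis unit has image killed by 12, so coefficients may be reduced modulo
    12 and finitely many sums remain. *)
Lemma unit_zbasis_finite (R : nzRingType) : unit_zbasis R ->
  finite_set [set: abelianization (E2 R)].
Proof.
move=> [B [_ spB] uB].
pose g (h : {ffun 'I_(size B) -> 'I_12}) : abelianization (E2 R) :=
  \sum_(i < size B) phi B`_i *+ h i.
apply: (@sub_finite_set _ _ (g @` setT)); last exact/finite_image/finite_finset.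
move=> a _; have [x ->] := phi_surj a.
have : zspan B x by rewrite spB.
move=> [c ->]; exists [ffun i => inord `|(c i %% 12)%Z|%N] => //.
have phiDm := @phiD R.
rewrite /g (big_morph (@phi R) phiDm (phi0 R)); apply: eq_bigr => i _.
have : B`_i \in @ring_units R by apply: uB; rewrite mem_nth.
rewrite in_setE => -[v [vu uv]]; have h12 := phi_unit uv vu.
rewrite ffunE phiMz {2}(divz_eq (c i) 12) inordK; last by lia.
rewrite mulrzDr mulrC mulrzA -pmulrn h12 mul0rz add0r pmulrn gez0_abs //.
by rewrite modz_ge0.
Qed.

(** * The ranks of E_2(O)^ab and of O, and the invariant inv_O *)

Section MainRank.
Variables (A : falgType rat) (hq : imquad A) (O : zorder A) (us ws : seq A).
Local Notation nm := (qnm hq).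
Local Notation R := (order_ring O).
Local Notation ov := (@order_val A O).
Hypotheses (ul : unit_list hq O us) (usat : saturated O us).
Hypothesis uall : forall u, u \in O -> nm u = 1 -> zspan us u.
Hypotheses (wO : {subset ws <= O}) (bas : basis_of fullv (ws ++ us)) (sat : saturated O (ws ++ us)).

Let B := ws ++ us.
Let X := in_tuple B.
Let r := size ws.

Lemma order_basis_sub : {subset B <= O}.
Proof.
move=> x; rewrite mem_cat => /orP [/wO //|xus]; by have [_ us1] := ul; have [] := us1 x xus.
Qed.

Lemma free_order_basis : free X. Proof. exact: basis_free bas. Qed.

Lemma leq_rB : (r <= size B)%N. Proof. by rewrite size_cat leq_addr. Qed.

Definition windex (j : 'I_r) : 'I_(size B) := widen_ord leq_rB j.

Lemma nth_windex j : X`_(windex j) = ws`_j.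
Proof. by rewrite /= nth_cat ltn_ord. Qed.

Lemma coord_int x i : x \in O -> coord X i x \is a Num.int.
Proof.
move=> xO; have := sat xO; rewrite (span_basis bas) memvf => /(_ isT).
apply: (zspan_sub (P := fun x => coord X i x \is a Num.int)).
- by rewrite linear0.
- by move=> y z hy hz; rewrite linearB rpredB.
move=> b bB; have hb : (index b B < size B)%N by rewrite index_mem.
have -> : b = X`_(Ordinal hb) by rewrite /= nth_index.
by rewrite (coord_free (Ordinal hb) i free_order_basis) natr_int.
Qed.

Lemma coord_us x j : x \in <<us>>%VS -> coord X (windex j) x = 0.
Proof.
move=> xus; rewrite (coord_span (xus : x \in <<in_tuple us>>%VS)) linear_sum big1 // => i _.
have hi : (r + i < size B)%N by rewrite size_cat ltn_add2l.
have -> : (in_tuple us)`_i = X`_(Ordinal hi) by rewrite /= nth_cat ltnNge leq_addr addKn.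
rewrite linearZ /= (coord_free (Ordinal hi) (windex j) free_order_basis) -val_eqE /= gtn_eqF ?mulr0 //.
by apply: leq_trans (ltn_ord j) (leq_addr _ _).
Qed.

(** This is the projection of [O] onto its quotient by the span of the units, which is free on the
    classes of [ws] because [us] extends to a basis of [O]. The coordinates are integral by
    [coord_int], so the floor only changes their type. *)
Definition ws_coord (x : R) : 'rV[int]_r := \row_j Num.floor (coord X (windex j) (ov x)).

Lemma ws_coordE x j : (ws_coord x 0 j)%:~R = coord X (windex j) (ov x).
Proof.
by rewrite mxE; have /intrP [m ->] := coord_int (windex j) (order_ring_valK x); rewrite intrKfloor.
Qed.

Lemma ws_coordB : zmod_morphism ws_coord.
Proof.
move=> x y; apply/rowP => j; apply/eqP; rewrite -(eqr_int rat) ws_coordE !mxE rmorphB /=.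
by have := ws_coordE x j; have := ws_coordE y j; rewrite !mxE => -> ->; rewrite -linearB.
Qed.

HB.instance Definition _ := GRing.isZmodMorphism.Build R 'rV[int]_r ws_coord ws_coordB.
Let lam : {additive R -> 'rV[int]_r} := ws_coord.

Lemma lam_eq0 x : lam x = 0 <-> zspan us (ov x).
Proof.
split=> [h|/zspan_span h]; last first.
  by apply/rowP => j; rewrite [RHS]mxE; apply/eqP; rewrite -(intr_eq0 rat) ws_coordE coord_us.
apply: usat; first exact: order_ring_valK.
have xB : ov x \in <<X>>%VS by rewrite (span_basis bas) memvf.
rewrite (coord_span xB); apply: memv_suml => i _.
have [ir|ir] := ltnP i r.
  have -> : i = windex (Ordinal ir) by apply: val_inj.
  by rewrite -ws_coordE -[ws_coord x]/(lam x) h mxE scale0r mem0v.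
apply: memvZ; apply: memv_span; rewrite /= nth_cat ltnNge ir /= mem_nth //.
by rewrite ltn_subLR // -size_cat.
Qed.

Definition ocj (x : R) : R := OrderElt (order_cj hq (order_ring_valK x)).
Definition onrm (x : R) : nat := `|Num.floor (nm (ov x))|%N.

Lemma onrmE x : (onrm x)%:R = nm (ov x).
Proof.
have /intrP [m hm] := order_nm_int hq (order_ring_valK x).
have := nm_ge0 hq (ov x); rewrite /onrm hm intrKfloor ler0z => m0.
by rewrite pmulrn gez0_abs.
Qed.

Lemma ov_nat n : ov n%:R = n%:R%:A.
Proof. by elim: n => [|n ih]; rewrite ?scale0r // mulrS [in RHS]mulrS scalerDl scale1r -ih. Qed.

Lemma ov_int n : ov n%:~R = n%:~R%:A.
Proof.
case: n => n; first exact: ov_nat.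
by rewrite NegzE !mulrNz scaleNr -[n.+1%:~R in RHS]/(n.+1%:R) -ov_nat.
Qed.

Lemma lam_trivial (w : seq R) : (forall s, wrun s w = s) -> wsum lam w = 0.
Proof.
apply: (@wsum_id R _ ocj onrm).
- move=> m n h; have := congr1 ov h; rewrite !ov_nat => /(@scalar_inj A)/eqP.
  by rewrite eqr_nat => /eqP.
- by move=> x y; apply: val_inj; rewrite /= cjB.
- by move=> x y; apply: val_inj; rewrite /= cjM.
- by move=> x; apply: val_inj; rewrite /= cjK.
- by move=> x; apply: val_inj; rewrite /= ov_nat onrmE mul_cj.
- by move=> x; apply: val_inj; rewrite /= ov_nat onrmE mulcj.
- move=> x h; apply: val_inj; apply/eqP; rewrite /= -(nm_eq0 hq) -onrmE h //.
- move=> x h; apply/lam_eq0/uall; first exact: order_ring_valK.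
  by rewrite -onrmE h.
move=> x; have /intrP [t ht] := order_tr_int hq (order_ring_valK x).
by exists t; apply: val_inj; rewrite /= ov_int -ht add_cj.
Qed.

Local Notation E2ab := (abelianization (E2 R)).
Let Phi : E2ab -> 'rV[int]_r := abPhi lam.

Lemma phi_torsion x : zspan us (ov x) -> phi x *+ 12 = 0.
Proof.
have [us' hus] := order_lift (fun u (uus : u \in us) => (proj1 ((proj2 ul) u uus))).
rewrite -hus => /(zspan_map_inv (@order_val_inj A O) (@order_valB A O)).
apply: (zspan_sub (P := fun x => phi x *+ 12 = 0)).
- by rewrite (phi0 R) mul0rn.
- by move=> y z hy hz; rewrite phiB mulrnBl hy hz subrr.
move=> u uus'; have : u \in @ring_units R.
  rewrite (mem_ring_units hq); apply/eqP.
  by have [_ us1] := ul; have [] := us1 (ov u) _; rewrite // -hus map_f.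
by rewrite in_setE => -[v [vu uv]]; exact: phi_unit uv vu.
Qed.

Lemma Phi_phi x : Phi (phi x) = - lam x.
Proof. exact: (abPhi_phi lam_trivial). Qed.

(** [Phi] splits, up to sign, the map sending integer vectors to combinations of the [phi] of [ws],
    which gives rank at least [r]. With more than [r] independent elements, a nonzero combination
    comes from an element of the span of the units, and 12 times it vanishes. *)
Lemma zrank_E2ab : has_zrank E2ab r.
Proof.
split.
  have [ws' hws] := order_lift wO.
  have sw : size ws' = r by rewrite -(size_map ov) hws.
  pose f (v : 'rV[int]_r) : E2ab := phi (\sum_(j < r) ws'`_j *~ v 0 j).
  have fB : zmod_morphism f.
    move=> u v; rewrite /f -phiB -sumrB; congr phi; apply: eq_bigr => j _.
    by rewrite !mxE mulrzBr.
  have Phif v : Phi (f v) = - v.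
    rewrite Phi_phi; congr (- _); apply/rowP => j; apply/eqP; rewrite -(eqr_int rat) ws_coordE.
    have -> : ov (\sum_(j < r) ws'`_j *~ v 0 j) = \sum_(j < r) (v 0 j)%:~R *: ws`_j.
      have ovD : {morph ov : x y / x + y} by [].
      rewrite (big_morph ov ovD (erefl : ov 0 = 0)); apply: eq_bigr => k _.
      rewrite -mulrzl -[_ * _]/(_ * _) -hws (nth_map 0) ?sw //.
      by rewrite -[LHS]/(ov (v 0 k)%:~R * ov ws'`_k) ov_int -scalerAl mul1r.
    rewrite linear_sum (bigD1 j) //= big1 ?addr0 => [|k kj].
      rewrite linearZ /= -nth_windex (coord_free (windex j) (windex j) free_order_basis) eqxx.
      by rewrite mulr1.
    rewrite linearZ /= -nth_windex (coord_free (windex k) (windex j) free_order_basis).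
    by rewrite -val_eqE /= val_eqE (negPf kj) mulr0.
  pose F : {additive 'rV[int]_r -> E2ab} := HB.pack f (GRing.isZmodMorphism.Build _ _ f fB).
  by exists F => u v /(congr1 Phi); rewrite /F /= !Phif => /oppr_inj.
move=> m [f finj]; rewrite leqNgt; apply/negP => rm.
have ex i : exists x : R, f (delta_mx 0 i) = phi x by apply: phi_surj.
pose x i := sval (cid (ex i)); have xE i : f (delta_mx 0 i) = phi (x i) by rewrite /x; case: cid.
(* The [r] columns of coordinates are padded with zeros to a square matrix. Its column of index [r]
   is zero, so the determinant vanishes and yields an integral kernel vector [c]. *)
pose L : 'M[int]_m := \matrix_(i, j) if insub (val j) is Some k then lam (x i) 0 k else 0.
have [c c0 hc] : exists2 c : 'rV[int]_m, c != 0 & c *m L = 0.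
  apply/det0P; rewrite -det_tr; apply/det0P; pose e : 'I_m := Ordinal rm.
  exists (delta_mx 0 e); first by apply/eqP => /rowP/(_ e); rewrite !mxE !eqxx.
  rewrite -rowE; apply/rowP => i; rewrite !mxE insubN //= ltnn //.
pose y : R := \sum_i x i *~ c 0 i.
have ly : lam y = 0.
  rewrite raddf_sum; apply/rowP => k.
  have km : (k < m)%N by apply: ltn_trans rm.
  have e : \sum_i c 0 i * L i (Ordinal km) = 0.
    have : (c *m L) 0 (Ordinal km) = 0 by rewrite hc mxE.
    by rewrite mxE.
  have -> : (0 : 'rV[int]_r) 0 k = 0 by rewrite mxE.
  rewrite summxE -[RHS]e; apply: eq_bigr => i _.
  have -> : L i (Ordinal km) = (lam (x i)) 0 k.
    by rewrite mxE /= insubT //= => h; congr (lam _ _ _); apply: val_inj.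
  by rewrite raddfMz -scaler_int mxE intz.
have fy : f c = phi y.
  have phiDm := @phiD R.
  rewrite (big_morph (@phi R) phiDm (phi0 R)) [in LHS](row_sum_delta c) raddf_sum.
  by apply: eq_bigr => i _; rewrite phiMz -xE -{1}(intz (c 0 i)) scaler_int raddfMz.
have : f (c *+ 12) = f 0.
  by rewrite raddfMn /= fy raddf0; apply/phi_torsion/lam_eq0.
move/finj => /rowP c12; case/negP: c0; apply/eqP/rowP => i; have := c12 i.
by rewrite mulmxnE !mxE => /eqP; rewrite mulrn_eq0 => /eqP.
Qed.

Lemma zrank_order : has_zrank (R : zmodType) (size B).
Proof.
have [B' hB] := order_lift order_basis_sub.
have zB : zbasis B'.
  by apply: zbasis_lift; rewrite hB; [exact: free_order_basis|move=> z zO; apply: sat; rewrite // (span_basis bas) memvf].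
have sB : size B' = size B by rewrite -hB size_map.
have [frB' spB'] := zB.
split.
  rewrite -sB; pose f (v : 'rV[int]_(size B')) : R := \sum_(j < size B') B'`_j *~ v 0 j.
  have fB : zmod_morphism f.
    move=> u v; rewrite /f -sumrB; apply: eq_bigr => j _; by rewrite !mxE mulrzBr.
  pose F : {additive 'rV[int]_(size B') -> R} := HB.pack f (GRing.isZmodMorphism.Build _ _ f fB).
  exists F => u v /eqP; rewrite -subr_eq0 -raddfB /= => /eqP h.
  by apply/eqP; rewrite -subr_eq0; apply/eqP/rowP => j; rewrite [RHS]mxE; apply: frB' h j.
move=> m [f finj]; pose D : seq 'rV[int]_m := [seq delta_mx 0 i | i <- enum 'I_m].
have sD : size D = m by rewrite size_map size_enum_ord.
have DE (i : 'I_(size D)) : D`_i = delta_mx 0 (cast_ord sD i).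
  rewrite /D (nth_map (cast_ord sD i)) ?size_enum_ord ?(ltn_ord (cast_ord sD i)) //.
  by rewrite (nth_ord_enum _ (cast_ord sD i)).
have frD : zfree D.
  move=> c hc i; have := congr1 (fun M : 'rV[int]_m => M 0 (cast_ord sD i)) hc.
  rewrite summxE mxE (bigD1 i) //= big1 => [|k ki].
    by rewrite addr0 DE -scaler_int mxE intz mxE !eqxx mulr1.
  rewrite DE -scaler_int mxE intz mxE (inj_eq (@cast_ord_inj _ _ _)) eq_sym (negPf ki).
  by rewrite andbF mulr0.
have := zfree_free (proj2 (zfree_map _ (@order_val_inj A O) (@order_valB A O))
  (proj2 (zfree_map _ finj (raddfB f)) frD)).
rewrite /free 2!size_map sD => /eqP <-.
by rewrite (basis_size bas) dimvS // subvf.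
Qed.

(** In the basis [ws ++ us] no member of [ws] is a unit, for it would lie in the span of [us]. In
    any other basis the units are independent elements of that span, so they are at most as many. *)
Lemma order_is_inv : is_inv R (size us).
Proof.
have [_ us1] := ul.
have cnt (L : seq R) : count (mem (@ring_units R)) L = count (fun x => nm x == 1) (map ov L).
  by rewrite count_map; apply: eq_count => x /=; rewrite (mem_ring_units hq).
split.
  have [B' hB] := order_lift order_basis_sub; exists B'.
    apply: zbasis_lift; rewrite hB; first exact: free_order_basis.
    by move=> z zO; apply: sat; rewrite // (span_basis bas) memvf.
  rewrite cnt hB count_cat (eq_in_count (a2 := pred0)) => [|w ww].
    rewrite count_pred0 add0n; apply/eqP; rewrite -all_count.
    by apply/allP => u /us1 [_ ->]; rewrite eqxx.
  apply/negP => /eqP w1.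
  have := free_order_basis; rewrite /= cat_free => /and3P [_ _ /directv_addP dir].
  have : w \in (<<ws>> :&: <<us>>)%VS.
    rewrite memv_cap memv_span //=; apply/zspan_span/uall => //; exact: wO.
  by rewrite dir memv0 => /eqP w0; move: w1; rewrite w0 nm0 => /esym/eqP; rewrite oner_eq0.
move=> B' /zbasis_val [bas' B'O _].
rewrite cnt -size_filter; set L := [seq _ <- _ | _].
have frL : free L by apply/filter_free/(basis_free bas').
have : (<<L>> <= <<us>>)%VS.
  apply/span_subvP => x; rewrite mem_filter => /andP [/eqP x1 xB].
  by apply/zspan_span/uall; rewrite // B'O.
move/dimvS; move: frL (proj1 ul); rewrite /free => /eqP -> /eqP -> //.
Qed.

Lemma finite_unit_zbasis : finite_set [set: E2ab] -> unit_zbasis R.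
Proof.
move=> fin; have [[F Finj] _] := zrank_E2ab.
have r0 : r = 0%N.
  apply/eqP; rewrite -leqn0 leqNgt; apply/negP => r0.
  apply: infinite_nat; rewrite -(preimage_setT (fun n : nat => F (const_mx n%:Z))).
  apply: finite_preimage fin => m n _ _ /Finj /rowP /(_ (Ordinal r0)).
  by rewrite !mxE => -[].
apply: (unit_zbasis_of_span (proj2 ul)).
by rewrite -(span_basis bas) (size0nil r0).
Qed.

End MainRank.

Lemma unit_zbasis_classification (A : falgType rat) (O : zorder A) : imquad A ->
  unit_zbasis (O : nzRingType) ->
  iso_maximal_order_in O rat^o
    \/ iso_maximal_order_in O (quadratic (-1))
    \/ iso_maximal_order_in O (quadratic (-3))
    \/ iso_maximal_order_in O (quaternion (-1 : rat) (-1))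
    \/ iso_maximal_order_in O (quaternion (-1 : rat) (-3))
    \/ ring_iso O lipschitz.
Proof.
move=> hq [B zB uB]; have [bas BO spB] := zbasis_val zB.
have ul : unit_list hq O (map (@order_val A O) B).
  split; first exact: basis_free bas.
  move=> _ /mapP [u uL ->]; split; first exact: order_ring_valK.
  by apply/eqP; rewrite -mem_ring_units uB.
have [d|d|d] := imquad_dim hq.
- by left; exact: class_dim1 ul bas spB d.
- by have [h|h] := class_dim2 ul bas spB d; auto.
have [no|no] := pselect (nonortho hq (map (@order_val A O) B)).
  by have [h|h] := class_dim4_maximal ul bas spB d no; auto 6.
by do 5!right; exact: class_dim4_lipschitz ul bas spB d no.
Qed.

Theorem theorem3 (A : falgType rat) (hA : forall x : A, x != 0 -> x \is a GRing.unit)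
    (O : zorder A) (hO : finite_set (@ring_units O)) :
  let E2ab : zmodType := abelianization (E2 O) in
  let P1 := finite_set [set: E2ab] in
  let P2 := exists2 B : seq O, zbasis B & {subset B <= @ring_units O} in
  let P3 := iso_maximal_order_in O rat^o
    \/ iso_maximal_order_in O (quadratic (-1))
    \/ iso_maximal_order_in O (quadratic (-3))
    \/ iso_maximal_order_in O (quaternion (-1 : rat) (-1))
    \/ iso_maximal_order_in O (quaternion (-1 : rat) (-3))
    \/ ring_iso O lipschitz in
  (exists r m k : nat, [/\ has_zrank E2ab r, has_zrank O m, is_inv O k
     & r%:Z = m%:Z - k%:Z])
  /\ (P1 <-> P2) /\ (P2 <-> P3).
Proof.
have hq := imquad_of_finite_units hA hO.
have [us [ul usat uall]] := unit_basis hq O.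
have [fr us1] := ul.
have [|ws [wO bas sat]] := extend_basis fr _ usat.
  by move=> u /us1 [].
move=> E2ab P1 P2 P3; split; last split; [|split|split].
- exists (size ws), (size (ws ++ us)), (size us); split.
  + exact: zrank_E2ab ul usat uall wO bas sat.
  + exact: zrank_order ul wO bas sat.
  + exact: order_is_inv ul uall wO bas sat.
  by rewrite size_cat PoszD addrK.
- exact: finite_unit_zbasis ul usat uall wO bas sat.
- exact: unit_zbasis_finite.
- exact: unit_zbasis_classification hq.
have iso (A' : falgType rat) : iso_maximal_order_in O A' ->
    (forall M : zorder A', maximal_order M -> unit_zbasis (M : nzRingType)) -> P2.
  by move=> [M mM OM] h; exact: unit_zbasis_iso OM (h M mM).
case=> [h|[h|[h|[h|[h|h]]]]].
- exact: iso h maximal_unit_zbasis_rat.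
- exact: iso h maximal_unit_zbasis_quadratic1.
- exact: iso h maximal_unit_zbasis_quadratic3.
- exact: iso h maximal_unit_zbasis_quaternion1.
- exact: iso h maximal_unit_zbasis_quaternion3.
exact: unit_zbasis_iso h unit_zbasis_lipschitz.
Qed.
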